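(* Let $U\subset\mathbb{R}^2$ be a domain, let $(N^3,g)$ be a Riemannian $3$-manifold with Riemannian volume element $\Omega$, let $f:U\to (N^3,g)$ be a frontal with unit normal vector field $\nu$, and let $\gamma(t)$ be a singular curve on $U$ passing through a non-degenerate singular point $p=\gamma(0)$. Let $\eta(t)$ be a null vector field along $\gamma$ and set $$\psi(t):=\Omega(\tilde\gamma',D^f_\eta\nu,\nu),$$ where $\tilde\gamma=f\circ\gamma$, $D^f_\eta\nu$ is the canonical covariant derivative along the map $f$ induced from the Levi-Civita connection on $(N^3,g)$, and $'=d/dt$. Then the germ of $f$ at $p=\gamma(0)$ is $\mathcal{A}$-equivalent to a cuspidal cross cap if and only if (i) $\eta(0)$ is transversal to $\gamma'(0)$, and (ii) $\psi(0)=0$ and $\psi'(0)\neq0$.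
   Context: Frontal: a $C^\infty$-map $f:U\to (N^3,g)$ for which there is a smooth unit vector field $\nu$ along $f$ (the unit normal vector field) perpendicular to $f_*(TU)$. Singular points: points where $\mathrm{rank}\,df<2$, equivalently zeros of the signed area density function $\lambda=\Omega(f_u,f_v,\nu)$ ($(u,v)$ local coordinates of $U$). A singular point $p$ is non-degenerate if $d\lambda(p)\neq0$. Near such $p$ the singular set is a regular curve, parametrized by a regular curve $\gamma:(-\varepsilon,\varepsilon)\to U$ with $\gamma(0)=p$, called the singular curve; the kernel of $df$ is one-dimensional at each $\gamma(t)$. A null vector field along $\gamma$ is a smooth nowhere-vanishing field $\eta(t)\in T_{\gamma(t)}U$ spanning $\mathrm{Ker}\,df_{\gamma(t)}$. $\mathcal{A}$-equivalence: two $C^\infty$-maps $f:(U,p)\to N^3$ and $f':(V,q)\to M^3$ are $\mathcal{A}$-equivalent if $f'=\Phi\circ f\circ\varphi^{-1}$ as germs for local diffeomorphisms $\varphi$ with $\varphi(p)=q$ and $\Phi$ with $\Phi(f(p))=f'(q)$. ''$\mathcal{A}$-equivalent to a cuspidal cross cap'' means $\mathcal{A}$-equivalent to $(u,v)\mapsto(u,v^2,uv^3)\in\mathbb{R}^3$ at the origin. *)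

(* Defs.v *)
From HB Require Import structures.
From mathcomp Require Import all_boot all_order all_algebra.
From mathcomp Require Import all_classical all_reals all_analysis.
From mathcomp Require Import ring.

Set Implicit Arguments.
Unset Strict Implicit.
Unset Printing Implicit Defensive.

Import Order.TTheory GRing.Theory Num.Theory.
Import numFieldNormedType.Exports.

Local Open Scope ring_scope.
Local Open Scope classical_set_scope.

(* Meant for open A and finite-dimensional V: the C^k functions on A. *)
Fixpoint Ck_on (R : realType) (V W : normedModType R) (k : nat)
    (A : set V) (h : V -> W) : Prop :=
  match k with
  | 0 => forall x, A x -> {for x, continuous h}
  | k'.+1 => (forall x, A x -> differentiable h x) /\
             (forall v, Ck_on k' A ('D_v h))
  end.

Definition smooth_on (R : realType) (V W : normedModType R)
    (A : set V) (h : V -> W) : Prop :=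
  forall k, Ck_on k A h.

(* A manifold is presented by an indexed atlas. [param i] is the inverse of
   [chart i]; both are total functions, meaningful on [mdom i] and on its image
   only. [chart_at] selects a chart around each point, so that quantities which
   do not depend on the chart can be defined by evaluating them in that one. *)
Record manifold (R : realType) (n : nat) := Manifold {
  points :> topologicalType;
  atlas : Type;
  mdom : atlas -> set points;
  chart : atlas -> points -> 'rV[R]_n;
  param : atlas -> 'rV[R]_n -> points;
  chart_at : points -> atlas;
  mdom_chart_at : forall x, mdom (chart_at x) x;
  open_mdom : forall i, open (mdom i);
  open_chart_img : forall i, open (chart i @` mdom i);
  chartK : forall i x, mdom i x -> param i (chart i x) = x;
  continuous_chart : forall i x, mdom i x -> {for x, continuous (chart i)};
  continuous_param : forall i x, mdom i x ->
    {for chart i x, continuous (param i)};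
  smooth_transition : forall i j,
    smooth_on (chart i @` (mdom i `&` mdom j)) (chart j \o param i);
  manifold_hausdorff : hausdorff_space points;
  manifold_second_countable : @second_countable points
}.

Definition smooth_map (R : realType) (m n : nat)
    (M : manifold R m) (N : manifold R n) (A : set M) (h : M -> N) : Prop :=
  (forall x, A x -> {for x, continuous h}) /\
  forall i j, smooth_on (chart i @` (A `&` mdom i `&` h @^-1` mdom j))
                        (chart j \o h \o param i).

Section euclidean_space.
Context (R : realType) (n : nat).

Lemma Ck_on_cst (V W : normedModType R) k (A : set V) (c : W) :
  Ck_on k A (cst c).
Proof.
elim: k c => [|k IH] c /=; first by move=> x _; exact: cst_continuous.
split=> [x _|v]; first exact: differentiable_cst.
suff -> : 'D_v (cst c) = cst 0 :> (V -> W) by exact: IH.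
by apply/funext => x; rewrite derive_cst.
Qed.

Lemma smooth_on_id (V : normedModType R) (A : set V) : smooth_on A (@id V).
Proof.
case=> [|k] /=; first by move=> x _.
split=> [x _|v]; first exact: (@ex_diff _ _ _ _ _ _ _ (is_diff_id x)).
suff -> : 'D_v (@id V) = cst v by exact: Ck_on_cst.
by apply/funext => x; rewrite derive_id.
Qed.

Lemma rV_second_countable : @second_countable 'rV[R]_n.
Proof.
pose B (cq : 'rV[rat]_n * nat) : set 'rV[R]_n :=
  ball (map_mx ratr cq.1 : 'rV[R]_n) (cq.2.+1%:R^-1).
exists (range B); first exact: (card_le_trans (card_image_le _ _) (countableP _)).
split=> [_ [cq _ <-]|x A /nbhs_ballP[e e0 xA]].
  exact: ball_open.
have [k ke] : exists k : nat, k.+1%:R^-1 < e / 2.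
  pose k := Num.truncn (e / 2)^-1; exists k.
  rewrite invf_plt ?posrE ?divr_gt0 ?ltr0n //.
  exact: truncnS_gt.
have dense_q (y : R) : exists q : rat, `|y - ratr q| < k.+1%:R^-1.
  have [|q] := @rat_in_itvoo R (y - k.+1%:R^-1) (y + k.+1%:R^-1).
    by rewrite ltrD2l gtrN ?invr_gt0 ?ltr0n.
  by rewrite in_itv /= => qy; exists q; rewrite distrC ltr_distl.
pose c : 'rV[rat]_n := \row_j xget 0 [set q | `|x 0 j - ratr q| < k.+1%:R^-1].
have cx : ball (map_mx ratr c : 'rV[R]_n) k.+1%:R^-1 x.
  split=> [|i j]; first by rewrite invr_gt0.
  rewrite (ord1 i) !mxE /ball /= distrC.
  have [q hq] := dense_q (x 0 j).
  by apply: (@xgetPex _ 0 [set q | `|x 0 j - ratr q| < k.+1%:R^-1]); exists q.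
exists (B (c, k)); first by split; [exists (c, k) | exact: cx].
apply: subset_trans xA => y cy.
have := ball_triangle (ball_sym cx) cy.
by apply: le_ball; rewrite [leRHS]splitr lerD // ltW.
Qed.

Definition euclid : manifold R n.
Proof.
refine (@Manifold R n 'rV[R]_n unit (fun=> setT) (fun=> id) (fun=> id)
  (fun=> tt) _ _ _ _ _ _ _ _ _).
- by [].
- by move=> _; exact: openT.
- by move=> _; rewrite image_id; exact: openT.
- by [].
- by move=> _ x _.
- by move=> _ x _.
- by move=> _ _; exact: smooth_on_id.
- exact: norm_hausdorff.
- exact: rV_second_countable.
Defined.

End euclidean_space.

Section a_equivalence.
Context (R : realType).

Definition local_diffeo (n : nat) (M N : manifold R n) (x : M)
    (h : M -> N) (hinv : N -> M) : Prop :=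
  exists W : set M,
    [/\ open W /\ W x, open (h @` W),
        smooth_map W h, smooth_map (h @` W) hinv
      & forall y, W y -> hinv (h y) = y].

Definition A_equivalent (N M : manifold R 3)
    (f : euclid R 2 -> N) (p : euclid R 2)
    (f' : euclid R 2 -> M) (q : euclid R 2) : Prop :=
  exists (phi phiinv : euclid R 2 -> euclid R 2) (Phi : N -> M) (Phiinv : M -> N),
    [/\ local_diffeo p phi phiinv, phi p = q,
        local_diffeo (f p) Phi Phiinv, Phi (f p) = f' q
      & \forall y \near q, f' y = Phi (f (phiinv y))].

Definition cuspidal_cross_cap (w : 'rV[R]_2) : 'rV[R]_3 :=
  let u := w 0 0 in let v := w 0 1 in
  \row_(k < 3) [:: u; v ^+ 2; u * v ^+ 3]`_k.

End a_equivalence.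

Section tangent_vectors.
Context (R : realType) (n : nat) (N : manifold R n).

(* A tangent vector is given by its components in every chart; the components
   in the charts which do not contain the base point are irrelevant. *)
Definition tvec : Type := atlas N -> 'rV[R]_n.

Definition is_tangent (x : N) (v : tvec) : Prop :=
  forall i j, mdom i x -> mdom j x ->
    v j = v i *m 'J (chart j \o param i) (chart i x).

Definition pushforward (m : nat) (f : 'rV[R]_m -> N) (u v : 'rV[R]_m) : tvec :=
  fun i => 'D_v (chart i \o f) u.

Definition velocity (c : R -> N) (t : R) : tvec :=
  fun i => (chart i \o c)^`() t.

Definition df_mx (m : nat) (f : 'rV[R]_m -> N) (u : 'rV[R]_m) : 'M[R]_(m, n) :=
  'J (chart (chart_at (f u)) \o f) u.

End tangent_vectors.

(* [gram i y] is the matrix (g_ab) of the metric in the chart i at the point of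
   coordinates y. *)
Record riemannian_metric (R : realType) (n : nat) (N : manifold R n) :=
  RiemannianMetric {
  gram : atlas N -> 'rV[R]_n -> 'M[R]_n;
  gram_sym : forall i x, mdom i x -> (gram i (chart i x))^T = gram i (chart i x);
  gram_pos : forall i x, mdom i x -> forall v : 'rV[R]_n, v != 0 ->
    0 < (v *m gram i (chart i x) *m v^T) 0 0;
  gram_smooth : forall i, smooth_on (chart i @` mdom i) (gram i);
  gram_transition : forall i j x, mdom i x -> mdom j x ->
    let J := 'J (chart j \o param i) (chart i x) in
    gram i (chart i x) = J *m gram j (chart j x) *m J^T
}.

(* A volume element of (N, g): a smooth n-form which is, in each chart,
   rho dx_1 /\ .. /\ dx_n with rho = +- sqrt (det g). Its existence means that N
   is orientable, and choosing it amounts to choosing an orientation. *)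
Record volume_element (R : realType) (n : nat) (N : manifold R n)
    (g : riemannian_metric N) := VolumeElement {
  density : atlas N -> 'rV[R]_n -> R;
  density_sqr : forall i x, mdom i x ->
    density i (chart i x) ^+ 2 = \det (gram g i (chart i x));
  density_smooth : forall i,
    smooth_on (chart i @` mdom i) (density i : 'rV[R]_n -> R^o);
  density_transition : forall i j x, mdom i x -> mdom j x ->
    density i (chart i x) =
      density j (chart j x) * \det ('J (chart j \o param i) (chart i x))
}.

Section riemannian_geometry.
Context (R : realType) (n : nat) (N : manifold R n) (g : riemannian_metric N).

Definition inner (x : N) (v w : tvec N) : R :=
  let i := chart_at x in (v i *m gram g i (chart i x) *m (w i)^T) 0 0.

Lemma inner_chart (x : N) (v w : tvec N) i : is_tangent x v -> is_tangent x w ->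
  mdom i x -> inner x v w = (v i *m gram g i (chart i x) *m (w i)^T) 0 0.
Proof.
move=> tv tw ix; rewrite /inner; have cx := mdom_chart_at x.
rewrite (tv _ _ ix cx) (tw _ _ ix cx) (gram_transition g ix cx).
by rewrite trmx_mul !mulmxA.
Qed.

Definition dgram (i : atlas N) (y : 'rV[R]_n) (c a b : 'I_n) : R :=
  ('D_(delta_mx 0 c) (gram g i) y) a b.

(* The Christoffel symbol Gamma^k_ab of the Levi-Civita connection. *)
Definition christoffel (i : atlas N) (y : 'rV[R]_n) (k a b : 'I_n) : R :=
  2^-1 * \sum_(l < n) invmx (gram g i y) k l *
    (dgram i y a l b + dgram i y b l a - dgram i y l a b).

Lemma gram_unitmx i x : mdom i x -> gram g i (chart i x) \in unitmx.
Proof.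
move=> ix; rewrite -row_free_unit -kermx_eq0; apply/eqP/row_matrixP => k; rewrite row0.
apply/eqP; apply: contraT => /(gram_pos g ix).
by rewrite -row_mul mulmx_ker row0 mul0mx mxE ltxx.
Qed.

Lemma derivable_gram i x v : mdom i x -> derivable (gram g i) (chart i x) v.
Proof.
move=> ix; have [+ _] := @gram_smooth _ _ _ g i 1.
by move=> /(_ (chart i x)) dg; apply/diff_derivable/dg; exists x.
Qed.

Lemma dgram_sym i x c a b : mdom i x ->
  dgram i (chart i x) c a b = dgram i (chart i x) c b a.
Proof.
move=> ix; rewrite /dgram !derive_mx; [|exact: derivable_gram..].
rewrite !mxE; apply: near_eq_derive.
near=> y; have [z iz <-] : (chart i @` mdom i) y.
  by near: y; apply: open_nbhs_nbhs; split; [exact: open_chart_img|exists x].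
by rewrite -{1}(gram_sym g iz) mxE.
Unshelve. all: by end_near. Qed.

(* The next two lemmas characterize the Levi-Civita connection: it is
   torsion-free and compatible with the metric. *)
Lemma christoffel_sym i x k a b : mdom i x ->
  christoffel i (chart i x) k a b = christoffel i (chart i x) k b a.
Proof.
move=> ix; congr (_ * _); apply: eq_bigr => l _.
by rewrite (dgram_sym l a b ix) [dgram _ _ a _ _ + dgram _ _ b _ _]addrC.
Qed.

Lemma christoffel_metric i x c a b : mdom i x ->
  dgram i (chart i x) c a b =
    \sum_(l < n) (christoffel i (chart i x) l c a * gram g i (chart i x) l b +
                  christoffel i (chart i x) l c b * gram g i (chart i x) a l).
Proof.
move=> ix; set G := gram g i (chart i x); set y := chart i x.
have Gsym : G^T = G by exact: gram_sym.
have low p q r : \sum_(l < n) G r l * christoffel i y l p q =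
    2^-1 * (dgram i y p r q + dgram i y q r p - dgram i y r p q).
  under eq_bigr => l _ do rewrite /christoffel mulrCA.
  rewrite -mulr_sumr; congr (_ * _).
  under eq_bigr => l _ do rewrite mulr_sumr.
  rewrite exchange_big /=.
  under eq_bigr => m _.
    under eq_bigr => l _ do rewrite mulrA.
    rewrite -mulr_suml.
    have -> : \sum_(l < n) G r l * invmx G l m = (r == m)%:R.
      by have /matrixP/(_ r m) := mulmxV (gram_unitmx ix); rewrite !mxE.
    over.
  rewrite (bigD1 r) //= eqxx mul1r big1 ?addr0 // => m /negPf.
  by rewrite eq_sym => ->; rewrite mul0r.
rewrite big_split /=.
under eq_bigr => l _ do rewrite mulrC -[G]Gsym mxE.
under [X in _ = _ + X]eq_bigr => l _ do rewrite mulrC.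
rewrite !low (dgram_sym c b a ix) (dgram_sym a b c ix) (dgram_sym b a c ix).
by rewrite -/y; field.
Qed.

Definition covariant_derivative (m : nat) (f : 'rV[R]_m -> N)
    (X : 'rV[R]_m -> tvec N) (u v : 'rV[R]_m) : tvec N :=
  fun i => 'D_v (X ^~ i) u +
    \row_(k < n) \sum_(a < n) \sum_(b < n)
      christoffel i (chart i (f u)) k a b * pushforward f u v i 0 a * X u i 0 b.

End riemannian_geometry.

Section frontals.
Context (R : realType) (N : manifold R 3) (g : riemannian_metric N)
  (Om : volume_element g).

Definition vol (x : N) (a b c : tvec N) : R :=
  let i := chart_at x in
  density Om i (chart i x) * \det (\matrix_(k < 3) [:: a i; b i; c i]`_k).

Lemma vol_chart (x : N) (a b c : tvec N) i :
  is_tangent x a -> is_tangent x b -> is_tangent x c -> mdom i x ->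
  vol x a b c =
    density Om i (chart i x) * \det (\matrix_(k < 3) [:: a i; b i; c i]`_k).
Proof.
move=> ta tb tc ix; rewrite /vol; have cx := mdom_chart_at x.
rewrite (density_transition Om ix cx) -mulrA; congr (_ * _).
rewrite mulrC -det_mulmx; congr (\det _); apply/row_matrixP => k.
rewrite row_mul !rowK (ta _ _ ix cx) (tb _ _ ix cx) (tc _ _ ix cx).
by case: k => -[|[|[|]]].
Qed.

Variables (U : set 'rV[R]_2) (f : 'rV[R]_2 -> N) (nu : 'rV[R]_2 -> tvec N).

Definition frontal : Prop :=
  [/\ smooth_map (U : set (euclid R 2)) f,
      forall u, U u -> is_tangent (f u) (nu u),
      forall i, smooth_on (U `&` f @^-1` mdom i) (nu ^~ i),
      forall u, U u -> inner g (f u) (nu u) (nu u) = 1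
    & forall u v, U u -> inner g (f u) (pushforward f u v) (nu u) = 0].

Definition singular_set : set 'rV[R]_2 :=
  [set u | U u /\ (\rank (df_mx f u) < 2)%N].

Definition area_density (u : 'rV[R]_2) : R^o :=
  vol (f u) (pushforward f u (delta_mx 0 0)) (pushforward f u (delta_mx 0 1))
      (nu u).

Definition nondegenerate_singular_point (p : 'rV[R]_2) : Prop :=
  singular_set p /\ exists v, 'd area_density p v != 0.

Definition singular_curve (p : 'rV[R]_2) (eps : R) (gamma : R -> 'rV[R]_2) :
    Prop :=
  [/\ smooth_on `]-eps, eps[ (gamma : R^o -> _),
      forall t : R, -eps < t < eps -> gamma^`() t != 0,
      gamma 0 = p,
      forall t : R, -eps < t < eps -> singular_set (gamma t)
    & \forall u \near p, singular_set u ->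
        exists2 t : R, -eps < t < eps & gamma t = u].

Definition null_vector_field (eps : R) (gamma eta : R -> 'rV[R]_2) : Prop :=
  [/\ smooth_on `]-eps, eps[ (eta : R^o -> _),
      forall t : R, -eps < t < eps -> eta t != 0
    & forall t : R, -eps < t < eps -> (eta t == kermx (df_mx f (gamma t)))%MS].

Definition psi (gamma eta : R -> 'rV[R]_2) (t : R) : R^o :=
  vol (f (gamma t)) (velocity (f \o gamma) t)
    (covariant_derivative g f nu (gamma t) (eta t)) (nu (gamma t)).

End frontals.

Definition transverse (R : realType) (v w : 'rV[R]_2) : Prop :=
  row_free (col_mx v w).

(* Main.v *)
From HB Require Import structures.
Require Import Defs.
From mathcomp Require Import all_boot all_order all_algebra.
From mathcomp Require Import all_classical all_reals all_analysis.
From mathcomp Require Import ring lra.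

(** Write [F] for the map [f] in a chart around [f p], and [n] for [nu] in that
    chart. The push-forward of a null vector vanishes, so the Christoffel terms of
    the covariant derivative of [nu] along [eta] vanish as well, and [psi] is the
    density, which has no zeros, times the determinant of the derivative of [F]
    along [gamma'], the derivative of [n] along [eta], and [n] (psi_chart). All
    that remains of the metric is that [n] is a unit normal.

    Normal form. If [eta] is transversal to [gamma'], then
    [(s, v) |-> gamma s + v eta s] is a coordinate system in which
    [F (s, v) = F (s, 0) + v^2 K (s, v)], and non-degeneracy says that [F_s], [K]
    and [n] are independent at the origin (adapted_coordinates). A target
    diffeomorphism straightens the curve [F (s, 0)], and a change of the source
    makes the second component [v^2], so that the map becomes
    [(u, v^2, v^2 beta (u, v))]. By Whitney's theorem on even functions
    [beta (u, v) = b (u, v^2) + v c (u, v^2)] with smooth [b] and [c], and a shear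
    of the target removes [b] (normal_form). What is left is the cross form
    [(u, v^2, v^3 c (u, v^2))]. If [c] vanishes at the origin and [c_u] does not,
    then [c] can be taken as first coordinate both in the source and in the target,
    which turns the cross form into the cuspidal cross cap, where [c = u]
    (cross_form_cuspidal_cross_cap).

    Invariance. Suppose that the germ of [F] is equivalent to the cross form of
    some [c], and transport metric and normal to this model. The lowered normal
    annihilates both partial derivatives of the model, and differentiating these
    equations along the null direction computes the determinant above: it is a
    function without zeros times [c (sigma t, 0)], where [(sigma t, 0)] is the
    transported singular curve and [sigma' <> 0] (model_identity,
    cusp_edge_invariant). In particular [psi] has a simple zero at 0 if and only if
    [c] vanishes at the origin and [c_u] does not. Moreover the null direction of
    the model is transversal to its singular set, so [eta] is transversal to
    [gamma'].

    For [c = u] the second point gives the necessity of the two conditions. For the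
    [c] provided by the first point it turns the condition on [psi] into the one
    under which the cross form is a cuspidal cross cap, which gives the
    sufficiency.

    Whitney's theorem is obtained from a Borel sum: for [e] even there is a smooth
    [B] such that [e (u, v) - B (u, v^2)] is flat along [v = 0] (borel_even), and a
    flat even function is a smooth function of [(u, v^2)] (whitney_even). The
    coordinate changes come from the inverse function theorem, proved by
    contraction (inverse_function), and the divisions by [v] from Hadamard's lemma
    (hadamard). *)

Set Implicit Arguments.
Unset Strict Implicit.
Unset Printing Implicit Defensive.
Import Order.TTheory GRing.Theory Num.Theory.
Import numFieldNormedType.Exports.
Local Open Scope ring_scope.
Local Open Scope classical_set_scope.

(** * Differentiability and the calculus of C^k maps *)

Lemma near_translate (R : realType) (V : normedModType R) (P : set V) (x : V) :
  nbhs x P -> \forall h \near (0 : V), P (h + x).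
Proof.
move=> nP; have : \forall z \near x, P z by [].
by rewrite (near_shift 0) /=; apply: filterS => h /=; rewrite subr0.
Qed.

Lemma near_norm_lt (R : realType) (V : normedModType R) (d : R) : 0 < d ->
  \forall h \near (0 : V), `|h| < d.
Proof.
move=> d0; have : nbhs (0 : V) (ball 0 d) by exact: nbhsx_ballx.
by apply: filterS => h; rewrite -ball_normE /ball_ /= sub0r normrN.
Qed.

Section diff_criterion.
Context (R : realType) (V W : normedModType R).
Implicit Types (f g : V -> W) (x : V).

(** Averages, sums of series and inverse maps come with a candidate for the
    differential and an explicit error bound; this turns such a bound into
    differentiability, since the differential is unique. *)
Lemma differentiable_eps f x (L : {linear V -> W}) (C : R) :
    (forall h, `|L h| <= C * `|h|) ->
    (forall e, 0 < e -> \forall h \near (0 : V),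
        `|f (h + x) - f x - L h| <= e * `|h|) ->
  differentiable f x /\ forall v, 'D_v f x = L v.
Proof.
move=> LC Lf.
have cL : continuous L.
  apply/linear_bounded_continuous/linear_boundedP.
  near=> r => y; apply: le_trans (LC y) _.
  by apply: ler_wpM2r => //; near: r; apply: nbhs_pinfty_ge; rewrite num_real.
have fL : f \o shift x = cst (f x) + L +o_ 0 id.
  apply/eqaddoP => e e0; near=> h.
  rewrite /= !fctE /= opprD addrA; near: h; exact: Lf.
have dL := diff_unique cL fL.
have df : differentiable f x.
  by apply/diff_locallyP; rewrite dL; split.
by split=> // v; rewrite deriveE // dL.
Unshelve. all: by end_near. Qed.

Lemma diff_bound f x : differentiable f x ->
  exists2 C, 0 < C & forall h, `|'d f x h| <= C * `|h|.
Proof.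
move=> /diff_continuous/linear_bounded_continuous/linear_boundedP [r [rr]] H.
exists (Num.max 1 (r + 1)); first by rewrite lt_max ltr01.
by apply: H; rewrite lt_max ltrDl ltr01 orbT.
Qed.

Lemma diff_eps f x : differentiable f x -> forall e, 0 < e ->
  \forall h \near (0 : V), `|f (h + x) - f x - 'd f x h| <= e * `|h|.
Proof.
move=> /diff_locallyP[_ /eqaddoP fL] e e0.
by have := fL e e0; apply: filterS => h; rewrite /= !fctE /= opprD addrA.
Qed.

Lemma near_eq_differentiable f g x :
  (\near x, f x = g x) -> differentiable f x -> differentiable g x.
Proof.
move=> fg df; have [C C0 dC] := diff_bound df.
apply: (proj1 (@differentiable_eps g x ('d f x) C dC _)) => e e0.
have fg0 : \forall h \near (0:V), f (h + x) = g (h + x).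
  exact: near_translate fg.
near=> h.
rewrite -(near fg0 h) // -(nbhs_singleton fg).
by near: h; exact: diff_eps.
Unshelve. all: by end_near. Qed.

End diff_criterion.

Section Ck_calculus.
Context (R : realType).
Implicit Types (V W X : normedModType R).

Lemma Ck_ext V W k (A : set V) (f g : V -> W) : open A ->
  (forall x, A x -> f x = g x) -> Ck_on k A f -> Ck_on k A g.
Proof.
move=> oA; elim: k f g => [|k IH] f g fg /=.
  move=> cf x Ax; have nfg : \forall y \near x, f y = g y.
    by apply: filterS (open_nbhs_nbhs (conj oA Ax)) => y; exact: fg.
  suff : g @ x --> g x by [].
  rewrite -(fg _ Ax); apply: cvg_trans (cf x Ax).
  by apply: near_eq_cvg; apply: filterS nfg => y ->.
have nfg x : A x -> \forall y \near x, f y = g y.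
  by move=> Ax; apply: filterS (open_nbhs_nbhs (conj oA Ax)) => y; exact: fg.
move=> [df Df]; split=> [x Ax|v]; first exact: near_eq_differentiable (nfg x Ax) (df x Ax).
by apply: IH (Df v) => x Ax; apply: near_eq_derive; exact: nfg.
Qed.

Lemma Ck_sub V W k (A B : set V) (f : V -> W) :
  A `<=` B -> Ck_on k B f -> Ck_on k A f.
Proof.
move=> AB; elim: k f => [|k IH] f /=; first by move=> H x /AB; exact: H.
by move=> [df Df]; split=> [x /AB|v]; [exact: df|exact: IH].
Qed.

Lemma Ck_lower V W k (A : set V) (f : V -> W) : Ck_on k.+1 A f -> Ck_on k A f.
Proof.
elim: k f => [|k IH] f /=.
  by move=> [df _] x /df; exact: differentiable_continuous.
by move=> [df Df]; split=> // v; exact/IH/Df.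
Qed.

Lemma Ck_add V W k (A : set V) (f g : V -> W) : open A ->
  Ck_on k A f -> Ck_on k A g -> Ck_on k A (fun x => f x + g x).
Proof.
move=> oA; elim: k f g => [|k IH] f g /=.
  by move=> cf cg x Ax; apply: cvgD; [exact: cf|exact: cg].
move=> [df Df] [dg Dg]; split=> [x Ax|v].
  by apply: differentiableD; [exact: df|exact: dg].
apply: Ck_ext (IH _ _ (Df v) (Dg v)) => // x Ax.
by rewrite -deriveD //; apply: diff_derivable; [exact: df|exact: dg].
Qed.

Lemma Ck_sum V W k (A : set V) (I : Type) (r : seq I) (P : pred I) (f : I -> V -> W) :
  open A -> (forall i, P i -> Ck_on k A (f i)) ->
  Ck_on k A (fun x => \sum_(i <- r | P i) f i x).
Proof.
move=> oA cf; elim: r => [|i r IH].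
  by rewrite (_ : (fun x => _) = cst 0); [exact: Ck_on_cst|apply/funext=> x; rewrite big_nil].
case Pi : (P i); last by under eq_fun => x do rewrite big_cons Pi.
by under eq_fun => x do rewrite big_cons Pi; apply: Ck_add => //; exact: cf.
Qed.

Lemma Ck_lin V W X k (A : set V) (f : V -> W) (L : {linear W -> X}) : open A ->
  continuous L -> Ck_on k A f -> Ck_on k A (L \o f).
Proof.
move=> oA cL; elim: k f => [|k IH] f.
  by move=> cf x Ax; apply: continuous_comp; [exact: cf|exact: cL].
move=> [df Df]; split=> [x Ax|v].
  by apply: differentiable_comp; [exact: df|exact: linear_differentiable].
apply: Ck_ext (IH _ (Df v)) => // x Ax /=.
have dLf : differentiable (L \o f) x.
  by apply: differentiable_comp; [exact: df|exact: linear_differentiable].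
rewrite [RHS]deriveE // diff_comp; [|exact: df|exact: linear_differentiable].
by rewrite [in LHS]deriveE /=; [rewrite diff_lin|exact: df].
Qed.

Lemma Ck_scalev V W k (A : set V) (f : V -> R^o) (w : W) : open A ->
  Ck_on k A f -> Ck_on k A (fun x => f x *: w).
Proof.
move=> oA; elim: k f => [|k IH] f.
  by move=> cf x Ax; apply: cvgZl; exact: cf.
move=> [df Df]; split=> [x Ax|v].
  exact: differentiableZl (df _ Ax).
apply: Ck_ext (IH _ (Df v)) => // x Ax /=.
have dfw := differentiableZl w (df _ Ax).
by rewrite [RHS]deriveE // diffZl; [rewrite deriveE //; exact: df|exact: df].
Qed.

Lemma Ck_mul V k (A : set V) (f g : V -> R^o) : open A ->
  Ck_on k A f -> Ck_on k A g -> Ck_on k A (fun x => f x * g x : R^o).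
Proof.
move=> oA; elim: k f g => [|k IH] f g.
  by move=> cf cg x Ax; apply: cvgM; [exact: cf|exact: cg].
move=> cf cg; have [df Df] := cf; have [dg Dg] := cg; split=> [x Ax|v].
  by apply: differentiableM; [exact: df|exact: dg].
have D := Ck_add oA (IH _ _ (Ck_lower cf) (Dg v)) (IH _ _ (Ck_lower cg) (Df v)).
apply: Ck_ext D => // x Ax /=.
by rewrite -deriveM //; apply: diff_derivable; [exact: df|exact: dg].
Qed.

Lemma Ck_inv V k (A : set V) (f : V -> R^o) : open A ->
  (forall x, A x -> f x != 0) -> Ck_on k A f -> Ck_on k A (fun x => (f x)^-1 : R^o).
Proof.
move=> oA f0; elim: k => [|k IH].
  by move=> cf x Ax; apply: cvgV; [exact: f0|exact: cf].
move=> cf; have [df Df] := cf; split=> [x Ax|v].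
  by apply: differentiableV; [exact: df|exact: f0].
have D := Ck_mul oA (IH (Ck_lower cf)) (IH (Ck_lower cf)).
have {}D := Ck_mul oA D (Ck_mul oA (Ck_on_cst (W := R^o) k A (-1)) (Df v)).
apply: Ck_ext D => // x Ax /=.
rewrite deriveV ?f0 //; last exact/diff_derivable/df.
by rewrite /cst /GRing.scale /= mulN1r mulrN mulNr -exprVn expr2.
Qed.

Lemma linear_scale V W (L : {linear V -> W}) (a : R) v : L (a *: v) = a *: L v.
Proof. exact: linearZ. Qed.

(** Finite dimension in the form used by the chain rule: a finite basis with
    continuous coordinate functionals. *)
Definition fin_basis V := exists n (e : 'I_n -> V) (l : 'I_n -> {linear V -> R^o}),
  (forall i, continuous (l i)) /\ forall w, w = \sum_i l i w *: e i.

(** Expanding [D_v f] in a basis [e i] of the middle space, the derivative of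
    [g \o f] along [v] is the sum of the products of a coordinate of [D_v f] and
    of [D_(e i) g \o f], and the induction hypothesis on [k] applies to the second
    factor. *)
Lemma Ck_comp V X k (A : set V) (B : set X) (f : V -> X) (g : X -> R^o) : open A ->
  fin_basis X -> (forall x, A x -> B (f x)) ->
  Ck_on k A f -> Ck_on k B g -> Ck_on k A (g \o f).
Proof.
move=> oA [n [e [l [cl le]]]] AB; elim: k g => [|k IH] g.
  by move=> cf cg x Ax; apply: continuous_comp; [exact: cf|exact/cg/AB].
move=> cf cg; have [df Df] := cf; have [dg Dg] := cg; split=> [x Ax|v].
  by apply: differentiable_comp; [exact: df|exact/dg/AB].
have D i := Ck_mul oA (Ck_lin oA (cl i) (Df v)) (IH _ (Ck_lower cf) (Dg (e i))).
apply: Ck_ext (Ck_sum (index_enum _) oA (fun i (_ : true) => D i)) => // x Ax /=.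
have dc : differentiable (g \o f) x.
  by apply: differentiable_comp; [exact: df|exact/dg/AB].
rewrite [RHS]deriveE // diff_comp //; [|exact: df|exact/dg/AB].
rewrite /= [in RHS](le ('d f x v)) raddf_sum; apply: eq_bigr => i _.
have dgf : differentiable g (f x) by exact/dg/AB.
have dfx : differentiable f x by exact: df.
rewrite [in LHS]deriveE // [in LHS]deriveE //; apply/esym.
exact: (linear_scale ('d g (f x))).
Qed.

End Ck_calculus.

Section Ck_matrix.
Context (R : realType).
Implicit Types (V X : normedModType R).

Definition coord_fun m n (i : 'I_m) (j : 'I_n) (M : 'M[R]_(m, n)) : R^o := M i j.

Lemma coord_fun_linear m n i j : linear (@coord_fun m n i j).
Proof. by move=> a M N; rewrite /coord_fun !mxE. Qed.

HB.instance Definition _ m n i j :=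
  GRing.isLinear.Build R 'M[R]_(m, n) R^o _ (@coord_fun m n i j) (coord_fun_linear i j).

Lemma Ck_mxP V k (A : set V) m n (f : V -> 'M[R]_(m, n)) : open A ->
  Ck_on k A f <-> forall i j, Ck_on k A (fun x => f x i j : R^o).
Proof.
move=> oA; split=> [cf i j|cf].
  exact: (Ck_lin (L := @coord_fun m n i j) oA (@coord_continuous R m n i j) cf).
have D i : Ck_on k A (fun x => \sum_j f x i j *: delta_mx i j : 'M[R]_(m, n)).
  by apply: Ck_sum => // j _; exact: Ck_scalev.
apply: Ck_ext (Ck_sum (index_enum _) oA (fun i (_ : true) => D i)) => // x _.
by rewrite -matrix_sum_delta.
Qed.

Lemma fin_basis_scalar : fin_basis (R^o : normedModType R).
Proof.
exists 1%N, (fun=> 1 : R^o), (fun=> idfun : {linear R^o -> R^o}).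
split=> [_|w]; first by move=> x.
by rewrite big_ord1 /GRing.scale /= mulr1.
Qed.

Lemma fin_basis_rV n : fin_basis ('rV[R]_n : normedModType R).
Proof.
exists n, (fun j => delta_mx 0 j), (fun j => @coord_fun 1 n 0 j).
split=> [j|w]; first exact: coord_continuous.
by rewrite {1}[w]row_sum_delta.
Qed.

Lemma Ck_comp_mx V X k (A : set V) (B : set X) m n (f : V -> X) (g : X -> 'M[R]_(m, n)) :
  open A -> open B -> fin_basis X -> (forall x, A x -> B (f x)) ->
  Ck_on k A f -> Ck_on k B g -> Ck_on k A (g \o f).
Proof.
move=> oA oB bX AB cf /(Ck_mxP _ _ oB) cg; apply/(Ck_mxP _ _ oA) => i j.
exact: (Ck_comp (g := fun x => g x i j : R^o) oA bX AB cf (cg i j)).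
Qed.

End Ck_matrix.

Section smooth_calculus.
Context (R : realType).
Implicit Types (V W X : normedModType R).

Lemma smooth_ext V W (A : set V) (f g : V -> W) : open A ->
  (forall x, A x -> f x = g x) -> smooth_on A f -> smooth_on A g.
Proof. by move=> oA fg sf k; exact: Ck_ext (sf k). Qed.

Lemma smooth_subset V W (A B : set V) (f : V -> W) :
  A `<=` B -> smooth_on B f -> smooth_on A f.
Proof. by move=> AB sf k; exact: Ck_sub AB (sf k). Qed.

Lemma smooth_diff V W (A : set V) (f : V -> W) x :
  smooth_on A f -> A x -> differentiable f x.
Proof. by move=> /(_ 1%N)[df _] /df. Qed.

Lemma smooth_continuous V W (A : set V) (f : V -> W) x :
  smooth_on A f -> A x -> {for x, continuous f}.
Proof. by move=> /(_ 0%N); exact. Qed.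

Lemma smooth_derive V W (A : set V) (f : V -> W) v :
  smooth_on A f -> smooth_on A ('D_v f).
Proof. by move=> sf k; have [_] := sf k.+1; exact. Qed.

Lemma smooth_cst V W (A : set V) (c : W) : smooth_on A (fun=> c).
Proof. by move=> k; exact: Ck_on_cst. Qed.

Lemma smooth_add V W (A : set V) (f g : V -> W) : open A ->
  smooth_on A f -> smooth_on A g -> smooth_on A (fun x => f x + g x).
Proof. by move=> oA sf sg k; exact: Ck_add. Qed.

Lemma smooth_sum V W (A : set V) (I : Type) (r : seq I) (P : pred I) (f : I -> V -> W) :
  open A -> (forall i, P i -> smooth_on A (f i)) ->
  smooth_on A (fun x => \sum_(i <- r | P i) f i x).
Proof. by move=> oA sf k; apply: Ck_sum => // i Pi; exact: sf. Qed.

Lemma smooth_lin V W X (A : set V) (f : V -> W) (L : {linear W -> X}) : open A ->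
  continuous L -> smooth_on A f -> smooth_on A (L \o f).
Proof. by move=> oA cL sf k; exact: Ck_lin. Qed.

Lemma smooth_scalev V W (A : set V) (f : V -> R^o) (w : W) : open A ->
  smooth_on A f -> smooth_on A (fun x => f x *: w).
Proof. by move=> oA sf k; exact: Ck_scalev. Qed.

Lemma smooth_mul V (A : set V) (f g : V -> R^o) : open A ->
  smooth_on A f -> smooth_on A g -> smooth_on A (fun x => f x * g x : R^o).
Proof. by move=> oA sf sg k; exact: Ck_mul. Qed.

Lemma smooth_inv V (A : set V) (f : V -> R^o) : open A ->
  (forall x, A x -> f x != 0) -> smooth_on A f -> smooth_on A (fun x => (f x)^-1 : R^o).
Proof. by move=> oA f0 sf k; exact: Ck_inv. Qed.

Lemma smooth_opp V W (A : set V) (f : V -> W) : open A ->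
  smooth_on A f -> smooth_on A (fun x => - f x).
Proof.
move=> oA; apply: (smooth_lin (L := -%R : {linear W -> W})) => //.
by move=> x; exact: cvgN.
Qed.

Lemma smooth_minus V W (A : set V) (f g : V -> W) : open A ->
  smooth_on A f -> smooth_on A g -> smooth_on A (fun x => f x - g x).
Proof. by move=> oA sf sg; apply: smooth_add => //; exact: smooth_opp. Qed.

Lemma smooth_exp V (A : set V) (f : V -> R^o) n : open A ->
  smooth_on A f -> smooth_on A (fun x => f x ^+ n : R^o).
Proof.
move=> oA sf; elim: n => [|n IH]; first by under eq_fun do rewrite expr0; exact: smooth_cst.
by under eq_fun do rewrite exprS; exact: smooth_mul.
Qed.

Lemma smooth_prod V (A : set V) (I : Type) (r : seq I) (P : pred I) (f : I -> V -> R^o) :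
  open A -> (forall i, P i -> smooth_on A (f i)) ->
  smooth_on A (fun x => \prod_(i <- r | P i) f i x : R^o).
Proof.
move=> oA sf; elim: r => [|i r IH].
  by under eq_fun do rewrite big_nil; exact: smooth_cst.
case Pi : (P i); last by under eq_fun => x do rewrite big_cons Pi.
by under eq_fun => x do rewrite big_cons Pi; apply: smooth_mul => //; exact: sf.
Qed.

Lemma smooth_comp V X (A : set V) (B : set X) (f : V -> X) (g : X -> R^o) : open A ->
  fin_basis X -> (forall x, A x -> B (f x)) ->
  smooth_on A f -> smooth_on B g -> smooth_on A (g \o f).
Proof. by move=> oA bX AB sf sg k; exact: Ck_comp AB (sf k) (sg k). Qed.

Lemma smooth_mxP V (A : set V) m n (f : V -> 'M[R]_(m, n)) : open A ->
  smooth_on A f <-> forall i j, smooth_on A (fun x => f x i j : R^o).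
Proof.
by move=> oA; split=> [sf i j k|sf k]; [move: i j|]; apply/(Ck_mxP _ _ oA) => // i j; exact: sf.
Qed.

Lemma smooth_coord V (A : set V) m n (f : V -> 'M[R]_(m, n)) i j : open A ->
  smooth_on A f -> smooth_on A (fun x => f x i j : R^o).
Proof. by move=> oA /smooth_mxP; exact. Qed.

Lemma smooth_comp_mx V X (A : set V) (B : set X) m n (f : V -> X) (g : X -> 'M[R]_(m, n)) :
  open A -> open B -> fin_basis X -> (forall x, A x -> B (f x)) ->
  smooth_on A f -> smooth_on B g -> smooth_on A (g \o f).
Proof. by move=> oA oB bX AB sf sg k; exact: Ck_comp_mx AB (sf k) (sg k). Qed.

Lemma smooth_mulmx V (A : set V) m n p (f : V -> 'M[R]_(m, n)) (g : V -> 'M[R]_(n, p)) :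
  open A -> smooth_on A f -> smooth_on A g -> smooth_on A (fun x => f x *m g x).
Proof.
move=> oA sf sg; apply/smooth_mxP => // i j; under eq_fun do rewrite mxE.
by apply: smooth_sum => // k _; apply: smooth_mul => //; exact: smooth_coord.
Qed.

Lemma smooth_trmx V (A : set V) m n (f : V -> 'M[R]_(m, n)) :
  open A -> smooth_on A f -> smooth_on A (fun x => (f x)^T).
Proof.
move=> oA sf; apply/smooth_mxP => // i j; under eq_fun do rewrite mxE.
exact: smooth_coord.
Qed.

Lemma smooth_det V (A : set V) n (f : V -> 'M[R]_n) :
  open A -> smooth_on A f -> smooth_on A (fun x => \det (f x) : R^o).
Proof.
move=> oA sf; rewrite /determinant.
apply: smooth_sum => // s _; apply: smooth_mul => //; first exact: smooth_cst.
by apply: smooth_prod => // i _; exact: smooth_coord.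
Qed.

Lemma smooth_invmx V (A : set V) n (f : V -> 'M[R]_n) : open A ->
  (forall x, A x -> f x \in unitmx) -> smooth_on A f -> smooth_on A (fun x => invmx (f x)).
Proof.
move=> oA uf sf.
apply: (@smooth_ext _ _ _ (fun x => (\det (f x))^-1 *: \adj (f x))) => //.
  by move=> x Ax; rewrite /invmx uf.
apply/smooth_mxP => // i j; under eq_fun do rewrite !mxE.
apply: smooth_mul => //.
  apply: smooth_inv => //; last exact: smooth_det.
  by move=> x /uf; rewrite unitmxE unitfE.
apply: smooth_mul => //; first exact: smooth_cst.
apply: smooth_det => //; apply/smooth_mxP => // k l.
by under eq_fun do rewrite !mxE; exact: smooth_coord.
Qed.

End smooth_calculus.

(** * Mean value theorem and Jacobians *)

Section mean_value.
Context (R : realType) (V : normedModType R).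

Lemma is_derive_line (W : normedModType R) (f : V -> W) (x v : V) (t : R) :
  differentiable f (x + t *: v) ->
  is_derive (t : R^o) (1 : R^o) (fun s : R^o => f (x + s *: v)) ('D_v f (x + t *: v)).
Proof.
move=> df.
have dl : is_diff (t : R^o) (fun s : R^o => x + s *: v) (fun s => s *: v).
  have := @is_diffD _ _ _ (cst x) (fun s : R^o => s *: v) 0 (fun s => s *: v) (t : R^o) _ _.
  move=> H; apply: is_diff_eq (H _ _) _.
    by apply/funext => s /=; rewrite /= !fctE add0r.
have dld := @ex_diff _ _ _ _ _ _ _ dl.
have dc : differentiable (f \o (fun s : R^o => x + s *: v)) (t : R^o).
  exact: differentiable_comp dld df.
apply: DeriveDef; first exact: diff_derivable.
rewrite deriveE // diff_comp //=.
by rewrite diff_val scale1r -deriveE.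
Qed.

Lemma mvt_line (f : V -> R^o) (x v : V) :
  (forall t : R, 0 <= t <= 1 -> differentiable f (x + t *: v)) ->
  exists2 t : R, 0 < t < 1 & f (x + v) - f x = 'D_v f (x + t *: v).
Proof.
move=> df.
have := @MVT R (fun s => f (x + s *: v)) (fun t => 'D_v f (x + t *: v)) 0 1 ltr01.
case=> [t /[!in_itv] /= /andP[t0 t1]||t t01 /=].
- by apply: is_derive_line; apply: df; rewrite !ltW.
- apply: derivable_within_continuous => t; rewrite in_itv /= => t01.
  by have [] := is_derive_line (df t t01).
- by rewrite subr0 mulr1 scale1r scale0r addr0 => ->; exists t.
Qed.

(** The mean value theorem is applied to [f] and then to [D_v f]; the bound is not
    the sharp [M / 2], but only the order of the remainder matters. *)
Lemma taylor2_line (f : V -> R^o) (x v : V) (M : R) :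
  (forall t : R, 0 <= t <= 1 -> differentiable f (x + t *: v)) ->
  (forall t : R, 0 <= t <= 1 -> differentiable ('D_v f) (x + t *: v)) ->
  (forall t : R, 0 <= t <= 1 -> `|'D_v ('D_v f) (x + t *: v)| <= M) ->
  `|f (x + v) - f x - 'D_v f x| <= M.
Proof.
move=> df ddf bM; have [t /andP[t0 t1] ->] := mvt_line df.
have tt s : 0 <= s <= 1 -> 0 <= s * t <= 1.
  move=> /andP[s0 s1]; apply/andP; split; first by rewrite mulr_ge0 // ltW.
  by rewrite mulr_ile1 // ltW.
have [s /andP[s0 s1] ] : exists2 s : R, 0 < s < 1 &
   'D_v f (x + t *: v) - 'D_v f x = 'D_(t *: v) ('D_v f) (x + s *: (t *: v)).
  by apply: mvt_line => s s01; rewrite scalerA; apply/ddf/tt.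
have st : 0 <= s * t <= 1 by apply: tt; rewrite !ltW.
rewrite scalerA => ->; rewrite deriveE; last exact: ddf.
rewrite (linear_scale ('d _ _)) -deriveE; last exact: ddf.
rewrite normrZ (ger0_norm (ltW t0)); apply: le_trans (bM _ st).
by apply: ler_piMl => //; exact: ltW.
Qed.

Lemma ball_convex (c x y : V) (r t : R) :
  `|x - c| < r -> `|y - c| < r -> 0 <= t <= 1 -> `|x + t *: (y - x) - c| < r.
Proof.
move=> xr yr /andP[t0 t1].
have -> : x + t *: (y - x) - c = (1 - t) *: (x - c) + t *: (y - c).
  have -> : y - x = (y - c) - (x - c) by rewrite opprB addrA subrK.
  by rewrite addrAC scalerBr scalerBl scale1r addrA addrAC.
have [->|tn0] := eqVneq t 0; first by rewrite subr0 scale1r scale0r addr0.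
have t_gt0 : 0 < t by rewrite lt_neqAle eq_sym tn0.
apply: le_lt_trans (ler_normD _ _) _; rewrite !normrZ !ger0_norm // ?subr_ge0 //.
have -> : r = (1 - t) * r + t * r by rewrite mulrBl mul1r subrK.
by apply: ler_ltD; [rewrite ler_wpM2l ?subr_ge0 // ltW|rewrite ltr_pM2l].
Qed.

End mean_value.

Section row_norm.
Context (R : realType).

Lemma normrV_le n (v : 'rV[R]_n) (c : R) : 0 <= c ->
  (forall i, `|v 0 i| <= c) -> `|v| <= c.
Proof.
move=> c0 vc; rewrite [leLHS]/Num.Def.normr /= mx_normrE.
by apply: bigmax_le => // -[i j] _ /=; rewrite (ord1 i).
Qed.

Lemma normrV_ge n (v : 'rV[R]_n) i : `|v 0 i| <= `|v|.
Proof.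
rewrite [leRHS]/Num.Def.normr /= mx_normrE.
exact: (le_bigmax _ (fun ij : 'I_1 * 'I_n => `|v ij.1 ij.2|) (0, i)).
Qed.

Lemma norm_mulmx_le m n (M : 'M[R]_(m, n)) :
  exists2 C, 0 < C & forall v : 'rV[R]_m, `|v *m M| <= C * `|v|.
Proof.
exists (1 + \sum_i \sum_j `|M i j|).
  by rewrite ltr_pwDl // sumr_ge0 // => i _; rewrite sumr_ge0.
move=> v; apply: normrV_le => [|j].
  by rewrite mulr_ge0 // addr_ge0 // sumr_ge0 // => i _; rewrite sumr_ge0.
rewrite mxE; apply: le_trans (ler_norm_sum _ _ _) _.
rewrite mulrDl mul1r mulr_suml -[leLHS]add0r lerD //.
apply: ler_sum => i _; rewrite normrM mulrC ler_pM ?normrV_ge //.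
by rewrite (bigD1 j) //= lerDl sumr_ge0.
Qed.

End row_norm.

Section jacobians.
Context (R : realType).

Lemma jacobian_row m n (f : 'rV[R]_m -> 'rV[R]_n) x i :
  differentiable f x -> row i ('J f x) = 'D_(delta_mx 0 i) f x.
Proof. by move=> df; rewrite deriveEjacobian // -rowE. Qed.

(** The rows of the Jacobian matrix are the directional derivatives along the
    coordinate axes. *)
Lemma smooth_jacobian m n (A : set 'rV[R]_m) (f : 'rV[R]_m -> 'rV[R]_n) : open A ->
  smooth_on A f -> smooth_on A (fun x => 'J f x).
Proof.
move=> oA sf; apply/smooth_mxP => // i j.
apply: (@smooth_ext _ _ _ _ (fun x => ('D_(delta_mx 0 i) f x) 0 j : R^o)) => //.
  by move=> x Ax; rewrite -jacobian_row ?mxE //; exact: smooth_diff sf Ax.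
by apply: smooth_coord => //; exact: smooth_derive.
Qed.

Lemma derive_coord (V : normedModType R) m n (f : V -> 'M[R]_(m, n)) x v i j :
  differentiable f x -> 'D_v (fun y => f y i j : R^o) x = ('D_v f x) i j.
Proof. by move=> df; rewrite derive_mx ?mxE //; exact: diff_derivable. Qed.

Lemma diff_coord (V : normedModType R) m n (f : V -> 'M[R]_(m, n)) x i j :
  differentiable f x -> differentiable (fun y => f y i j : R^o) x.
Proof.
move=> df; have := differentiable_comp df (differentiable_coord (f x) i j).
exact.
Qed.

Lemma diff_mx (V : normedModType R) m n (f : V -> 'M[R]_(m, n)) x :
  (forall i j, differentiable (fun y => f y i j : R^o) x) -> differentiable f x.
Proof.
move=> df.
have -> : f = \sum_i \sum_j (fun y => (f y i j : R^o) *: (delta_mx i j : 'M[R]_(m, n))).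
  apply/funext => y; rewrite fct_sumE {1}[f y]matrix_sum_delta.
  by apply: eq_bigr => i _; rewrite fct_sumE.
apply: differentiable_sum => i; apply: differentiable_sum => j.
exact: differentiableZl.
Qed.

Lemma diff_mulmx (V : normedModType R) m n p (f : V -> 'M[R]_(m, n))
    (g : V -> 'M[R]_(n, p)) x : differentiable f x -> differentiable g x ->
  differentiable (fun y => f y *m g y) x.
Proof.
move=> df dg; apply: diff_mx => i j.
have -> : (fun y => (f y *m g y) i j : R^o) =
    \sum_k ((fun y => f y i k : R^o) * (fun y => g y k j : R^o)).
  by apply/funext => y; rewrite mxE fct_sumE.
by apply: differentiable_sum => k; apply: differentiableM; exact: diff_coord.
Qed.

Lemma derive_mulmx (V : normedModType R) m n p (f : V -> 'M[R]_(m, n))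
    (g : V -> 'M[R]_(n, p)) x v : differentiable f x -> differentiable g x ->
  'D_v (fun y => f y *m g y) x = 'D_v f x *m g x + f x *m 'D_v g x.
Proof.
move=> df dg; apply/matrixP => i j.
rewrite -derive_coord; last exact: diff_mulmx.
have -> : (fun y => (f y *m g y) i j : R^o) =
    \sum_k ((fun y => f y i k : R^o) * (fun y => g y k j : R^o)).
  by apply/funext => y; rewrite mxE fct_sumE.
have dfk i' j' : derivable (fun y => f y i' j' : R^o) x v.
  exact/diff_derivable/diff_coord.
have dgk i' j' : derivable (fun y => g y i' j' : R^o) x v.
  exact/diff_derivable/diff_coord.
rewrite derive_sum; last by move=> k; exact: derivableM.
rewrite !mxE -big_split /=; apply: eq_bigr => k _.
rewrite deriveM // !derive_coord // addrC; congr (_ + _).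
by rewrite /GRing.scale /= mulrC.
Qed.

End jacobians.

(** * Inverse function theorem *)

Section inverse_function.
Context (R : realType) (n : nat).
Local Notation V := 'rV[R]_n.

(** Banach's fixed point theorem asks for a complete normed module. *)
HB.instance Definition _ := Uniform_isComplete.Build V cauchy_cvg.

(** A diffeomorphism of [W] onto its image. The inverse is a total function, of
    which only the values on [h @` W] matter. *)
Definition ldiff (W : set V) (h hinv : V -> V) : Prop :=
  [/\ open W, open (h @` W), smooth_on W h, smooth_on (h @` W) hinv
    & forall x, W x -> hinv (h x) = x].

(** The Jacobian matrix is continuous and vanishes at [x0], so it is small near
    [x0]; the mean value theorem turns this into a Lipschitz bound. The constant
    [1 / 2] is the one which makes [id - q] injective with an inverse of Lipschitz
    constant [2]. *)
Lemma contraction_near_id (A : set V) (q : V -> V) (x0 : V) : open A -> A x0 ->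
  smooth_on A q -> (forall v, 'D_v q x0 = 0) ->
  exists2 r : R, 0 < r & (forall x, `|x - x0| < r -> A x) /\
    (forall x y, `|x - x0| < r -> `|y - x0| < r -> `|q x - q y| <= 2^-1 * `|x - y|) /\
    (forall x v, `|x - x0| < r -> `|'D_v q x| <= 2^-1 * `|v|).
Proof.
move=> oA Ax0 sq Dq0.
have [M M0 MJ] : exists2 M : R, 0 < M & forall (J : 'M[R]_n) (e : R), 0 <= e ->
    (forall i j, `|J i j| <= e / M) -> forall v : V, `|v *m J| <= e * `|v|.
  exists n.+1%:R => // J e e0 Je v; apply: normrV_le => [|j]; first by rewrite mulr_ge0.
  rewrite mxE; apply: le_trans (ler_norm_sum _ _ _) _.
  apply: (@le_trans _ _ (\sum_(i < n) e / n.+1%:R * `|v|)).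
    by apply: ler_sum => i _; rewrite normrM mulrC ler_pM ?normrV_ge.
  rewrite sumr_const card_ord -[leLHS]mulr_natr mulrAC ler_wpM2r //.
  rewrite -mulrA ler_piMr // mulrC ler_pdivrMr // mul1r ler_nat leqnSn.
  by [].
have J0 : 'J q x0 = 0.
  apply/row_matrixP => i; rewrite jacobian_row ?Dq0 ?row0 //.
  exact: smooth_diff sq Ax0.
have cJ : {for x0, continuous (fun x => 'J q x)}.
  exact: smooth_continuous (smooth_jacobian oA sq) Ax0.
have e0 : 0 < 2^-1 / M by rewrite divr_gt0.
have [r r0 rA] : exists2 r : R, 0 < r &
    forall x, `|x - x0| < r -> A x /\ forall i j, `|'J q x i j| <= 2^-1 / M.
  have nA : \forall x \near x0, A x by exact: open_nbhs_nbhs.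
  have /cvgrPdist_lt /(_ _ e0) nJ := cJ.
  have [r /= r0 rH] := (nbhs_ballP _ _).1 (filterI nA nJ).
  exists r => // x xr; have [|Ax Jx] := rH x.
    by rewrite -ball_normE /ball_ /= distrC.
  split => // i j; apply: ltW; apply: le_lt_trans Jx.
  rewrite J0 sub0r normrN [leRHS]/Num.Def.normr /= mx_normrE.
  exact: (le_bigmax _ (fun ij : 'I_n * 'I_n => `|'J q x ij.1 ij.2|) (i, j)).
have bD x v : `|x - x0| < r -> `|'D_v q x| <= 2^-1 * `|v|.
  move=> /rA [Ax Jx]; rewrite deriveEjacobian; last exact: smooth_diff sq Ax.
  exact: MJ.
exists r => //; split; first by move=> x /rA[].
split=> // x y xr yr; apply: normrV_le => [|i]; first by rewrite mulr_ge0.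
have dq t : 0 <= t <= 1 -> differentiable q (y + t *: (x - y)).
  by move=> t01; apply: smooth_diff sq _; exact: (rA _ (ball_convex yr xr t01)).1.
have [t /andP[t0 t1]] : exists2 t : R, 0 < t < 1 & (q (y + (x - y)) 0 i : R^o) - q y 0 i =
    'D_(x - y) (fun z => q z 0 i : R^o) (y + t *: (x - y)).
  by apply: mvt_line => t t01; apply: diff_coord; exact: dq.
rewrite [y + (x - y)]addrC subrK derive_coord; last by apply: dq; rewrite !ltW.
rewrite !mxE => ->; apply: le_trans (normrV_ge _ _) _.
by apply: bD; apply: ball_convex => //; rewrite !ltW.
Qed.

Lemma continuous_dist (x0 : V) : continuous (fun x : V => `|x - x0| : R).
Proof.
move=> x; have cB : (fun y : V => y - x0) @ x --> x - x0.
  exact: (cvgB (@cvg_id _ (nbhs x)) (cvg_cst x0)).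
exact: (cvg_norm cB).
Qed.

(** Let [B] be the inverse of the Jacobian matrix at [x0]. Then
    [q x = x - h x *m B] has vanishing differential at [x0], and [h x = y] is the
    fixed point equation [x = q x + y *m B], which is solved by contraction on a
    closed ball. The inequality [`|x - y| <= 2 * `|(h x - h y) *m B|] gives the
    injectivity of [h] and the differentiability of its inverse. The differential
    of the inverse is the inverse matrix of the Jacobian, evaluated along the
    inverse map; by induction on the order this formula makes the inverse smooth. *)
Theorem inverse_function (A : set V) (h : V -> V) (x0 : V) : open A -> A x0 ->
  smooth_on A h -> 'J h x0 \in unitmx ->
  exists W hinv, [/\ W `<=` A, W x0 & ldiff W h hinv].
Proof.
move=> oA Ax0 sh Ju.
set B := invmx ('J h x0); pose q x := x - h x *m B.
have dh x : A x -> differentiable h x by exact: smooth_diff.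
have shB : smooth_on A (fun x => h x *m B).
  by apply: smooth_mulmx => //; exact: smooth_cst.
have sq : smooth_on A q by apply: smooth_minus => //; exact: smooth_on_id.
have DhB x v : A x -> 'D_v (fun x => h x *m B) x = 'D_v h x *m B.
  move=> Ax; rewrite derive_mulmx //; last exact: dh.
  by rewrite derive_cst mulmx0 addr0.
have Dq x v : A x -> 'D_v q x = v - 'D_v h x *m B.
  move=> Ax; rewrite /q deriveB ?derive_id ?DhB //.
  exact/diff_derivable/(smooth_diff shB).
have Dq0 v : 'D_v q x0 = 0.
  by rewrite Dq // deriveEjacobian; [rewrite /B mulmxK // subrr|exact: dh].
have [r r0 [rA [rlip rD]]] := contraction_near_id oA Ax0 sq Dq0.
have lip x y : `|x - x0| < r -> `|y - x0| < r -> `|x - y| <= 2 * `|(h x - h y) *m B|.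
  move=> xr yr; have := rlip _ _ xr yr.
  have -> : x - y = (q x - q y) + (h x - h y) *m B.
    by rewrite /q mulmxBl opprB addrACA !addrA subrK addrAC addrK // -addrA addrC.
  set a := q x - q y; set b := _ *m _ => H.
  have := ler_normD a b; move: H; set X := `|a + b|; move=> H H2.
  by lra.
have Junit x : `|x - x0| < r -> 'J h x \in unitmx.
  move=> xr; have Ax := rA _ xr.
  rewrite -row_free_unit -kermx_eq0; apply/eqP/row_matrixP => i; rewrite row0.
  set v := row i _; have vJ : v *m 'J h x = 0 by rewrite /v -row_mul mulmx_ker row0.
  have := rD x v xr; rewrite Dq // deriveEjacobian; last exact: dh.
  rewrite vJ mul0mx subr0 => nv.
  by apply/normr0_eq0/eqP; rewrite eq_le normr_ge0 andbT; lra.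
have bB (y : V) : `|(y - h x0) *m B| < r / 2 ->
    exists2 x, `|x - x0| < r & h x = y.
  move=> yr; set s := 2 * `|(y - h x0) *m B|.
  have sr : s < r by rewrite /s; lra.
  pose U : set V := [set x | `|x - x0| <= s].
  have Ur x : U x -> `|x - x0| < r by move=> Ux; apply: le_lt_trans sr.
  pose T (x : V) : V := q x + y *m B.
  have x0r : `|x0 - x0| < r by rewrite subrr normr0.
  have TU x : U x -> U (T x).
    move=> Ux; rewrite /U /=.
    have -> : T x - x0 = (q x - q x0) + (y - h x0) *m B.
      rewrite /T /q mulmxBl; move: (h x *m B) (h x0 *m B) (y *m B) => a b c.
      by apply/rowP => j; rewrite !mxE; ring.
    apply: le_trans (ler_normD _ _) _.
    have := rlip _ _ (Ur _ Ux) x0r; move: Ux; rewrite /U /= /s.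
    set a := `|(y - _) *m B|; set b := `|q x - _|; set c := `|x - x0|; lra.
  pose f : {fun U >-> U} := HB.pack T (isFun.Build V V U U T TU).
  have [|||x Ux xT] := @banach_fixed_point R V U f.
  - exists (2^-1)%:nng; split => /=; first by rewrite invf_lt1 // ltr1n.
    move=> [x x'] [/= Ux Ux']; rewrite /T opprD addrACA subrr addr0.
    by apply: rlip; exact: Ur.
  - apply: (@preimage_closed _ _ (fun x : V => `|x - x0| : R) [set t | t <= s]); last exact: closed_le.
    by move=> x _; exact: continuous_dist.
  - by exists x0; rewrite /U /= subrr normr0 /s mulr_ge0.
  exists x; first exact: Ur.
  have xB : h x *m B = y *m B.
    move: xT => /= ; rewrite /T /q -addrA => /eqP; rewrite -subr_eq0 opprD addrA subrr sub0r.
    by rewrite oppr_eq0 addrC subr_eq0 => /eqP.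
  by rewrite -[LHS](mulmxKV Ju) -/B xB /B mulmxKV.
(* Y is the image of W: the values for which the fixed point exists. *)
pose Y : set V := [set y | `|(y - h x0) *m B| < r / 2].
pose W : set V := [set x | `|x - x0| < r] `&` h @^-1` Y.
have [CB CB0 nB] := norm_mulmx_le B.
have WA : W `<=` A by move=> x [/rA].
have hW : h @` W = Y.
  apply/seteqP; split=> [_ [x [_ Yx] <-]//|y Yy].
  by have [x xr xy] := bB _ Yy; exists x => //; split=> //; rewrite /= xy.
have oY : open Y.
  apply: (@open_comp _ _ (fun y : V => `|(y - h x0) *m B| : R) [set t | t < r / 2]).
    move=> y _; have sB : smooth_on setT (fun y : V => (y - h x0) *m B).
      apply: smooth_mulmx; [exact: openT| |exact: smooth_cst].
      by apply: smooth_minus; [exact: openT|exact: smooth_on_id|exact: smooth_cst].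
    exact: (cvg_norm (smooth_continuous sB (I : setT y))).
  exact: open_lt.
have oW : open W.
  have -> : W = A `&` [set x | `|x - x0| < r] `&` h @^-1` Y.
    by apply/seteqP; split=> x; [move=> [xr Yx]; split=> //; split => //; exact: rA|move=> [[]]].
  rewrite openE => x [[Ax xr] Yx]; apply: filterI; last first.
    apply: (smooth_continuous sh Ax); exact: open_nbhs_nbhs.
  apply: filterI; first exact: open_nbhs_nbhs.
  apply/nbhs_ballP; exists (r - `|x - x0|); first by rewrite /= subr_gt0.
  move=> y; rewrite -ball_normE /ball_ /= => yx.
  have := ler_distD x y x0; rewrite (distrC y x); lra.
pose hinv y := get [set x | W x /\ h x = y].
have hinvP y : Y y -> W (hinv y) /\ h (hinv y) = y.
  rewrite -hW => -[x Wx xy]; rewrite /hinv.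
  by case: (xgetPex point (P := [set x | W x /\ h x = y])); first by exists x.
have hinvK x : W x -> hinv (h x) = x.
  move=> Wx; have [Wx' hx'] := hinvP (h x) Wx.2.
  apply/eqP; rewrite -subr_eq0 -normr_eq0 eq_le normr_ge0 andbT.
  by have := lip _ _ Wx'.1 Wx.1; rewrite hx' subrr mul0mx normr0 mulr0.
(* The error of the linear approximation of h at x, divided by the Jacobian
   matrix, is the error for the inverse; both are o(k) by the bound on x' - x. *)
have Dhinv y : Y y -> differentiable hinv y /\
    forall v, 'D_v hinv y = v *m invmx ('J h (hinv y)).
  move=> Yy; have [Wx hx] := hinvP y Yy; set x := hinv y in Wx hx *.
  set Jx := 'J h x; have uJ : Jx \in unitmx by exact: Junit Wx.1.
  have [CJ CJ0 nJ] := norm_mulmx_le (invmx Jx).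
  apply: (@differentiable_eps _ _ _ hinv y (mulmxr (invmx Jx)) CJ nJ) => e e0.
  have nY : \forall k \near (0 : V), Y (k + y).
    exact: near_translate (open_nbhs_nbhs (conj oY Yy)).
  pose e' := e / (CJ * (2 * CB)).
  have e'0 : 0 < e' by rewrite divr_gt0 // !mulr_gt0.
  have /nbhs_ballP[d /= d0 dH] := diff_eps (dh x (WA _ Wx)) e'0.
  have nd : \forall k \near (0 : V), `|k| < d / (2 * CB).
    by apply: near_norm_lt; rewrite divr_gt0 // mulr_gt0.
  near=> k.
  have Yky : Y (k + y) by near: k.
  have [Wx' hx'] := hinvP (k + y) Yky.
  set x' := hinv (k + y) in Wx' hx' *.
  have kd : `|k| < d / (2 * CB) by near: k.
  have hk : h x' - h x = k by rewrite hx hx' addrK.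
  have xk : `|x' - x| <= 2 * CB * `|k|.
    by apply: le_trans (lip _ _ Wx'.1 Wx.1) _; rewrite hk -mulrA ler_wpM2l //.
  have := dH (x' - x); rewrite -ball_normE /ball_ /= sub0r normrN subrK hk.
  rewrite -deriveE ?deriveEjacobian; try exact: (dh x (WA _ Wx)).
  rewrite -/Jx => /(_ _)H.
  have -> : x' - x - k *m invmx Jx = - ((k - (x' - x) *m Jx) *m invmx Jx).
    by rewrite mulmxBl mulmxK // opprB.
  rewrite normrN; apply: le_trans (nJ _) _.
  apply: le_trans (_ : CJ * (e' * (2 * CB * `|k|)) <= _).
    apply: (ler_wpM2l (ltW CJ0)); apply: le_trans (H _) (ler_wpM2l (ltW e'0) xk).
    apply: le_lt_trans xk _; rewrite mulrC -ltr_pdivlMr //; exact: mulr_gt0.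
  rewrite /e' le_eqVlt; apply/orP; left; apply/eqP; field.
  by rewrite !gt_eqF.
have shinv : smooth_on Y hinv.
  elim=> [|k IH].
    by move=> y Yy; apply/differentiable_continuous; exact: (Dhinv _ Yy).1.
  split=> [y Yy|v]; first exact: (Dhinv _ Yy).1.
  apply: (@Ck_ext _ _ _ _ _ (fun y => v *m invmx ('J h (hinv y)))) => //.
    by move=> y Yy; rewrite (Dhinv _ Yy).2.
  have sJ : smooth_on W (fun x => v *m invmx ('J h x)).
    apply: (smooth_mulmx oW (smooth_cst _ _)).
    apply: (smooth_invmx oW) => [x Wx|]; first exact: Junit Wx.1.
    apply: smooth_jacobian oW _; exact: smooth_subset sh.
  apply: (@Ck_comp_mx R V V k Y W 1 n hinv (fun x => v *m invmx ('J h x)) oY oW _ _ IH (sJ k)).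
    exact: fin_basis_rV.
  by move=> y /hinvP[].
exists W, hinv; split=> //.
  by split; rewrite /= ?subrr ?mul0mx ?normr0 // /Y /= subrr mul0mx normr0 divr_gt0.
split=> //; rewrite ?hW //; exact: smooth_subset sh.
Unshelve. all: by end_near. Qed.

End inverse_function.

(** * Integrals over the unit interval and functions on the plane *)

Section unit_interval_integral.
Context (R : realType).
Local Notation mu := (@lebesgue_measure R).

Definition int01 (f : R -> R) : R := Rintegral mu `[0, 1] f.

Definition cont01 (f : R -> R) := forall t, 0 <= t <= 1 -> {for t, continuous f}.

Lemma cont01_within f : cont01 f -> {within `[0%R, 1%R], continuous f}.
Proof.
move=> cf; apply: continuous_in_subspaceT => t; rewrite inE /= in_itv /= => t01.
exact: cf.
Qed.

Lemma cont01_integrable f : cont01 f -> mu.-integrable `[0, 1] (EFin \o f).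
Proof.
move=> cf; apply: continuous_compact_integrable; first exact: segment_compact.
exact: cont01_within.
Qed.

Lemma int01_add f g : cont01 f -> cont01 g ->
  int01 (fun t => f t + g t) = int01 f + int01 g.
Proof. by move=> cf cg; rewrite /int01 RintegralD //; exact: cont01_integrable. Qed.

Lemma int01_scale r f : cont01 f -> int01 (fun t => r * f t) = r * int01 f.
Proof. by move=> cf; rewrite /int01 RintegralZl //; exact: cont01_integrable. Qed.

Lemma int01_bound f M : cont01 f -> (forall t, 0 <= t <= 1 -> `|f t| <= M) ->
  `|int01 f| <= M.
Proof.
move=> cf fM; have cn : cont01 (fun t => `|f t|).
  by move=> t t01; apply: cvg_norm; exact: cf.
have cM : cont01 (fun=> M) by move=> t _; exact: cvg_cst.
apply: le_trans (le_normr_Rintegral _ (cont01_integrable cf)) _ => //.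
apply: le_trans (le_Rintegral (f2 := fun=> M) _ (cont01_integrable cn) (cont01_integrable cM) _) _ => //.
  by rewrite Rintegral_cst //= lebesgue_measure_itv /= lte_fin ltr01 oppr0 adde0 mulr1.
Qed.

Lemma int01_FTC f F : cont01 f ->
  (forall t : R, 0 <= t <= 1 -> is_derive (t : R^o) (1 : R^o) (F : R^o -> R^o) (f t)) ->
  int01 f = F 1 - F 0.
Proof.
move=> cf dF.
have cF (t : R) : 0 <= t <= 1 -> F @ t --> F t.
  move=> t01; have [dt _] := dF t t01.
  by apply: differentiable_continuous; exact/derivable1_diffP.
rewrite /int01 /Rintegral (@continuous_FTC2 R f F 0 1) //.
- exact: cont01_within.
- split.
  + move=> t; rewrite in_itv /= => /andP[t0 t1].
    by have [] := dF t; rewrite ?ltW //= ?ltW.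
  + by apply: cvg_at_right_filter; apply: cF; rewrite lexx ler01.
  + by apply: cvg_at_left_filter; apply: cF; rewrite lexx ler01.
- move=> t; rewrite in_itv /= => /andP[t0 t1].
  by rewrite derive1E; have [] := dF t; rewrite ?ltW //= ?ltW.
Qed.

End unit_interval_integral.

Section plane.
Context (R : realType).
Local Notation V := 'rV[R]_2.
Implicit Types (x v w : V) (r : R).

Definition mk2 (a b : R) : V := \row_(k < 2) [:: a; b]`_k.

Lemma mk2_0 a b : mk2 a b 0 0 = a. Proof. by rewrite mxE. Qed.
Lemma mk2_1 a b : mk2 a b 0 1 = b. Proof. by rewrite mxE. Qed.

Lemma row2P x v : x 0 0 = v 0 0 -> x 0 1 = v 0 1 -> x = v.
Proof.
move=> e0 e1; apply/rowP => -[[|[|//]] i2].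
  by rewrite (_ : Ordinal i2 = 0) //; exact: val_inj.
by rewrite (_ : Ordinal i2 = 1) //; exact: val_inj.
Qed.

Lemma mk2E x : mk2 (x 0 0) (x 0 1) = x.
Proof. by apply: row2P; rewrite ?mk2_0 ?mk2_1. Qed.

Lemma norm2_lt x r : `|x| < r <-> `|x 0 0| < r /\ `|x 0 1| < r.
Proof.
split=> [xr|[x0 x1]]; first by split; apply: le_lt_trans xr; exact: normrV_ge.
rewrite [ltLHS]/Num.Def.normr /= mx_normrE; apply: bigmax_lt.
  exact: le_lt_trans x0.
move=> [i [[|[|//]] j2]] _ /=; rewrite (ord1 i).
  by rewrite (_ : Ordinal j2 = 0) //; exact: val_inj.
by rewrite (_ : Ordinal j2 = 1) //; exact: val_inj.
Qed.

Lemma norm2_le x r : `|x| <= r <-> `|x 0 0| <= r /\ `|x 0 1| <= r.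
Proof.
split=> [xr|[x0 x1]]; first by split; apply: le_trans xr; exact: normrV_ge.
apply: normrV_le; first exact: le_trans x0.
move=> [[|[|//]] j2].
  by rewrite (_ : Ordinal j2 = 0) //; exact: val_inj.
by rewrite (_ : Ordinal j2 = 1) //; exact: val_inj.
Qed.

(** Row vectors carry the supremum norm, so this is an open square. *)
Definition box r : set V := [set x | `|x| < r].

Lemma boxE r x : box r x <-> `|x 0 0| < r /\ `|x 0 1| < r.
Proof. exact: norm2_lt. Qed.

Lemma box_sqr r x : r <= 1 -> box r x -> box r (mk2 (x 0 0) (x 0 1 ^+ 2)).
Proof.
move=> r1 /boxE[x0 x1]; apply/boxE; rewrite mk2_0 mk2_1; split=> //.
rewrite normrX; apply: (le_lt_trans _ x1); rewrite expr2 ler_piMr //.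
by apply: le_trans r1; exact: ltW.
Qed.

Lemma open_box r : open (box r).
Proof.
apply: (@open_comp _ _ (fun y : V => `|y| : R) [set t | t < r]); last exact: open_lt.
by move=> y _; exact: norm_continuous.
Qed.

Lemma smooth_fst (A : set V) : open A -> smooth_on A (fun x => x 0 0 : R^o).
Proof. by move=> oA; apply: smooth_coord => //; exact: smooth_on_id. Qed.

Lemma smooth_snd (A : set V) : open A -> smooth_on A (fun x => x 0 1 : R^o).
Proof. by move=> oA; apply: smooth_coord => //; exact: smooth_on_id. Qed.

Lemma smooth_mk2 (W : normedModType R) (A : set W) (f g : W -> R^o) : open A ->
  smooth_on A f -> smooth_on A g -> smooth_on A (fun y => mk2 (f y) (g y)).
Proof.
move=> oA sf sg; apply/smooth_mxP => // i -[[|[|//]] j2].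
  by under eq_fun do rewrite mxE /=.
by under eq_fun do rewrite mxE /=.
Qed.

Local Notation e0 := (delta_mx 0 0 : V).
Local Notation e1 := (delta_mx 0 1 : V).

Lemma vec2_sum v : v = v 0 0 *: e0 + v 0 1 *: e1.
Proof. by apply: row2P; rewrite !mxE /= ?mulr1 ?mulr0 ?addr0 ?add0r. Qed.

Lemma derive2 (W : normedModType R) (f : V -> W) x v : differentiable f x ->
  'D_v f x = v 0 0 *: 'D_e0 f x + v 0 1 *: 'D_e1 f x.
Proof.
move=> df; rewrite deriveE // {1}(vec2_sum v) raddfD /=.
by rewrite !(linear_scale ('d f x)) !deriveE.
Qed.

Lemma smooth_bounded (f : V -> R^o) r r' : smooth_on (box r) f -> r' < r ->
  exists2 M : R, 0 <= M & forall x, `|x| <= r' -> `|f x| <= M.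
Proof.
move=> sf rr.
pose K := [set x : V | `|x| <= r'].
have cK : compact K.
  apply: bounded_closed_compact.
    exists r'; split; first by rewrite num_real.
    by move=> M rM x /= /le_trans; apply; exact: ltW.
  apply: (@preimage_closed _ _ (fun x : V => `|x| : R) [set t | t <= r']).
    by move=> x _; exact: norm_continuous.
  exact: closed_le.
have cf : {within K, continuous f}.
  apply: continuous_in_subspaceT => x; rewrite inE /K /= => xr.
  by apply: (smooth_continuous sf); exact: le_lt_trans rr.
have [M [Mr MH]] := compact_bounded (continuous_compact cf cK).
exists (Num.max 0 (M + 1)); first by rewrite le_max lexx.
move=> x xr; apply: (MH (Num.max 0 (M + 1))); first by rewrite lt_max ltrDl ltr01 orbT.
by exists x.
Qed.

Lemma quad_bound (a b X0 X1 X2 X3 M0 M1 M2 M3 N : R) :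
  `|a| <= N -> `|b| <= N -> `|X0| <= M0 -> `|X1| <= M1 -> `|X2| <= M2 -> `|X3| <= M3 ->
  `|a * (a * X0 + b * X1) + b * (a * X2 + b * X3)| <= (M0 + M1 + M2 + M3) * N ^+ 2.
Proof.
move=> aN bN X0M X1M X2M X3M.
have B (c d x y m m' : R) : `|c| <= N -> `|d| <= N -> `|x| <= m -> `|y| <= m' ->
    `|c * x + d * y| <= N * m + N * m'.
  move=> cN dN xm ym; apply: le_trans (ler_normD _ _) _.
  by rewrite !normrM; apply: lerD; apply: ler_pM.
apply: le_trans (B _ _ _ _ _ _ aN bN (B _ _ _ _ _ _ aN bN X0M X1M) (B _ _ _ _ _ _ aN bN X2M X3M)) _.
by rewrite le_eqVlt; apply/orP; left; apply/eqP; ring.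
Qed.

(** The second derivatives are bounded on a smaller closed square by compactness,
    so the remainder of the first order Taylor formula is uniform there. *)
Lemma taylor2_box (h : V -> R^o) r r' : smooth_on (box r) h -> r' < r ->
  exists2 M : R, 0 <= M & forall x v, `|x| <= r' -> `|x + v| <= r' ->
    `|h (x + v) - h x - 'D_v h x| <= M * `|v| ^+ 2.
Proof.
move=> sh rr.
have sD w := smooth_derive w sh.
have [M0 M00 H0] := smooth_bounded (smooth_derive e0 (sD e0)) rr.
have [M1 M10 H1] := smooth_bounded (smooth_derive e1 (sD e0)) rr.
have [M2 M20 H2] := smooth_bounded (smooth_derive e0 (sD e1)) rr.
have [M3 M30 H3] := smooth_bounded (smooth_derive e1 (sD e1)) rr.
exists (M0 + M1 + M2 + M3); first by rewrite !addr_ge0.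
move=> x v xr xvr.
have seg t : 0 <= t <= 1 -> `|x + t *: v| <= r'.
  move=> /andP[t0 t1].
  have -> : x + t *: v = (1 - t) *: x + t *: (x + v).
    by apply/rowP => j; rewrite !mxE; ring.
  apply: le_trans (ler_normD _ _) _; rewrite !normrZ !ger0_norm ?subr_ge0 //.
  have -> : r' = (1 - t) * r' + t * r' by ring.
  by apply: lerD; apply: ler_wpM2l => //; rewrite subr_ge0.
have segb t : 0 <= t <= 1 -> box r (x + t *: v) by move=> /seg /le_lt_trans; apply.
apply: taylor2_line => t t01.
- exact: smooth_diff sh (segb t t01).
- exact: smooth_diff (sD v) (segb t t01).
- set y := x + t *: v.
  have by_ : box r y by exact: segb.
  have yr : `|y| <= r' by exact: seg.
  have -> : 'D_v ('D_v h) y = 'D_v (fun z => v 0 0 *: 'D_e0 h z + v 0 1 *: 'D_e1 h z) y.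
    apply: near_eq_derive; have := open_nbhs_nbhs (conj (@open_box r) by_).
    by apply: filterS => z bz; apply: derive2; exact: smooth_diff sh bz.
  have d0 : derivable ('D_e0 h) y v by exact/diff_derivable/(smooth_diff (sD e0)).
  have d1 : derivable ('D_e1 h) y v by exact/diff_derivable/(smooth_diff (sD e1)).
  rewrite deriveD; [|exact: derivableZ|exact: derivableZ].
  rewrite !deriveZ // !(derive2 v); [|exact: smooth_diff (sD _) _|exact: smooth_diff (sD _) _].
  apply: quad_bound; rewrite ?normrV_ge //; [exact: H0|exact: H1|exact: H2|exact: H3].
Qed.

End plane.

(** * Hadamard's lemma *)

Section hadamard.
Context (R : realType).
Local Notation V := 'rV[R]_2.
Local Notation e0 := (delta_mx 0 0 : V).
Local Notation e1 := (delta_mx 0 1 : V).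
Implicit Types (x v : V) (r : R).

Definition lincomb2 (a b : R) (v : V) : R^o := v 0 0 * a + v 0 1 * b.

Lemma lincomb2_linear a b : linear (lincomb2 a b).
Proof. by move=> c v w; rewrite /lincomb2 !mxE /GRing.scale /=; ring. Qed.

HB.instance Definition _ a b :=
  GRing.isLinear.Build R V R^o _ (lincomb2 a b) (lincomb2_linear a b).

Lemma lincomb2_bound a b v : `|lincomb2 a b v| <= (`|a| + `|b|) * `|v|.
Proof.
rewrite /lincomb2; apply: le_trans (ler_normD _ _) _.
rewrite (normrM (v 0 0) a) (normrM (v 0 1) b) mulrDl mulrC [X in _ + X]mulrC.
by apply: lerD; apply: ler_wpM2l => //; exact: normrV_ge.
Qed.

Definition scale_snd (t : R) x : V := mk2 (x 0 0) (t * x 0 1).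

Lemma scale_snd_le t x r : 0 <= t <= 1 -> `|x| <= r -> `|scale_snd t x| <= r.
Proof.
move=> /andP[t0 t1] /norm2_le[x0 x1]; apply/norm2_le; rewrite mk2_0 mk2_1; split=> //.
rewrite normrM (ger0_norm t0); apply: le_trans x1.
exact: ler_piMl.
Qed.

Lemma scale_snd_box t x r : 0 <= t <= 1 -> box r x -> box r (scale_snd t x).
Proof. by move=> t01 bx; apply: le_lt_trans bx; exact: scale_snd_le. Qed.

Lemma scale_sndD t x v : scale_snd t (x + v) = scale_snd t x + scale_snd t v.
Proof. by apply: row2P; rewrite !mxE /= ?mulrDr. Qed.

(** Average of [h] over the segment from the axis to [x]. The weight [a] is there
    for induction: differentiating along the second coordinate multiplies it
    by [t]. *)
Definition slice_int (a : R -> R) (h : V -> R^o) (x : V) : R^o :=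
  int01 (fun t => a t * h (scale_snd t x)).

Lemma slice_cont a h r x : cont01 a -> smooth_on (box r) h -> box r x ->
  cont01 (fun t => a t * h (scale_snd t x)).
Proof.
move=> ca sh bx t t01; apply: cvgM; first exact: ca.
have ss : smooth_on setT (fun t : R^o => scale_snd t x).
  apply: smooth_mk2; [exact: openT|exact: smooth_cst|].
  by apply: smooth_mul; [exact: openT|exact: smooth_on_id|exact: smooth_cst].
apply: (@continuous_comp _ _ _ (fun t : R^o => scale_snd t x) h).
  exact: (smooth_continuous ss).
exact: smooth_continuous sh (scale_snd_box t01 bx).
Qed.

(** Differentiation under the integral sign: the remainders of the first order
    Taylor formula are bounded uniformly in the integration variable. *)
Lemma slice_int_diff a h r x : cont01 a -> (forall t, 0 <= t <= 1 -> `|a t| <= 1) ->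
  smooth_on (box r) h -> box r x ->
  differentiable (slice_int a h) x /\ forall v, 'D_v (slice_int a h) x =
    v 0 0 * slice_int a ('D_e0 h) x + v 0 1 * slice_int (fun t => a t * t) ('D_e1 h) x.
Proof.
move=> ca a1 sh bx.
have cat : cont01 (fun t => a t * t) by move=> t t01; apply: cvgM; [exact: ca|exact: cvg_id].
have sh0 := smooth_derive e0 sh; have sh1 := smooth_derive e1 sh.
set c0 := slice_int a _ _; set c1 := slice_int (fun t => a t * t) _ _.
have xr : `|x| < r := bx.
pose r' := (`|x| + r) / 2.
have xr' : `|x| < r' by rewrite /r'; lra.
have r'r : r' < r by rewrite /r'; lra.
have [M M0 HM] := taylor2_box sh r'r.
apply: (@differentiable_eps _ _ _ (slice_int a h) x (lincomb2 c0 c1) (`|c0| + `|c1|)).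
  exact: lincomb2_bound.
move=> e ep.
have n1 : \forall k \near (0 : V), `|k| < r' - `|x|.
  by apply: near_norm_lt; rewrite subr_gt0.
have n2 : \forall k \near (0 : V), `|k| < e / (M + 1).
  by apply: near_norm_lt; rewrite divr_gt0 // ltr_wpDl.
near=> k.
have k1 : `|k| < r' - `|x| by near: k.
have k2 : `|k| < e / (M + 1) by near: k.
have xk : `|x + k| <= r' by apply: le_trans (ler_normD _ _) _; lra.
have bxk : box r (x + k) by exact: le_lt_trans r'r.
have C1 := slice_cont ca sh bxk; have C2 := slice_cont ca sh bx.
have C3 := slice_cont ca sh0 bx; have C4 := slice_cont cat sh1 bx.
have CZ f (s : R) : cont01 f -> cont01 (fun t => s * f t).
  by move=> cf t t01; apply: cvgM; [exact: cvg_cst|exact: cf].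
have CD f g : cont01 f -> cont01 g -> cont01 (fun t : R => f t + g t :> R).
  by move=> cf cg t t01; apply: cvgD; [exact: cf|exact: cg].
have K2 := CZ _ (-1) C2; have K3 := CZ _ (- k 0 0) C3; have K4 := CZ _ (- k 0 1) C4.
have K34 := CD _ _ K3 K4; have K234 := CD _ _ K2 K34.
have -> : slice_int a h (k + x) - slice_int a h x - lincomb2 c0 c1 k =
  int01 (fun t => a t * h (scale_snd t (x + k)) + (-1 * (a t * h (scale_snd t x)) +
    (- k 0 0 * (a t * 'D_e0 h (scale_snd t x)) +
     - k 0 1 * ((a t * t) * 'D_e1 h (scale_snd t x))))).
  rewrite (int01_add C1 K234) (int01_add K2 K34) (int01_add K3 K4).
  rewrite (int01_scale _ C2) (int01_scale _ C3) (int01_scale _ C4).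
  rewrite (addrC k x) /lincomb2 -/(slice_int a h (x + k)) -/(slice_int a h x).
  by rewrite -/(slice_int a ('D_e0 h) x) -/(slice_int (fun t => a t * t) ('D_e1 h) x) -/c0 -/c1; ring.
apply: le_trans (_ : M * `|k| ^+ 2 <= _); last first.
  rewrite expr2 mulrA ler_wpM2r //.
  apply: le_trans (_ : (M + 1) * `|k| <= _); first by rewrite ler_wpM2r // lerDl.
  by rewrite mulrC -ler_pdivlMr ?ltW // ltr_wpDl.
apply: int01_bound; first exact: (CD _ _ C1 K234).
move=> t t01.
have Lx := scale_snd_box t01 bx.
have -> : a t * h (scale_snd t (x + k)) + (-1 * (a t * h (scale_snd t x)) +
    (- k 0 0 * (a t * 'D_e0 h (scale_snd t x)) +
     - k 0 1 * ((a t * t) * 'D_e1 h (scale_snd t x)))) =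
    a t * (h (scale_snd t x + scale_snd t k) - h (scale_snd t x) -
       'D_(scale_snd t k) h (scale_snd t x)).
  rewrite scale_sndD (derive2 (scale_snd t k)); last exact: smooth_diff sh Lx.
  by rewrite mk2_0 mk2_1 /GRing.scale /=; ring.
rewrite normrM -[leRHS]mul1r; apply: ler_pM => //; first exact: a1.
apply: le_trans (HM _ _ _ _) _.
- by apply: scale_snd_le => //; exact: ltW.
- by rewrite -scale_sndD; exact: scale_snd_le.
- by rewrite ler_wpM2l // lerXn2r ?nnegrE // scale_snd_le.
Unshelve. all: by end_near. Qed.

Lemma smooth_slice_int a h r : cont01 a -> (forall t, 0 <= t <= 1 -> `|a t| <= 1) ->
  smooth_on (box r) h -> smooth_on (box r) (slice_int a h).
Proof.
move=> + + + k; elim: k a h => [|k IH] a h ca a1 sh.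
  by move=> x bx; apply/differentiable_continuous; exact: (slice_int_diff ca a1 sh bx).1.
split=> [x bx|v]; first exact: (slice_int_diff ca a1 sh bx).1.
have ob := @open_box R r.
have ca' : cont01 (fun t => a t * t) by move=> t t01; apply: cvgM; [exact: ca|exact: cvg_id].
have a1' (t : R) : 0 <= t <= 1 -> `|a t * t| <= 1.
  move=> t01; have := a1 _ t01; case/andP: t01 => t0 t1 ta.
  by rewrite normrM (ger0_norm t0) mulr_ile1.
have I0 := IH _ _ ca a1 (smooth_derive e0 sh).
have I1 := IH _ _ ca' a1' (smooth_derive e1 sh).
have := Ck_add ob (Ck_mul ob (Ck_on_cst (W := R^o) k (box r) (v 0 0)) I0)
                  (Ck_mul ob (Ck_on_cst (W := R^o) k (box r) (v 0 1)) I1).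
apply: Ck_ext => // x bx.
by rewrite (slice_int_diff ca a1 sh bx).2.
Qed.

(** The quotient is [k (u, v)], the integral of [h_v (u, t v)] for [t] between 0
    and 1. *)
Theorem hadamard (h : V -> R^o) r : smooth_on (box r) h ->
  (forall u, `|u| < r -> h (mk2 u 0) = 0) ->
  exists2 k : V -> R^o, smooth_on (box r) k & forall x, box r x -> h x = x 0 1 * k x.
Proof.
move=> sh h0; exists (slice_int (fun=> 1) ('D_e1 h)).
  apply: smooth_slice_int; [by move=> t _; exact: cvg_cst|by move=> t _; rewrite normr1|].
  exact: smooth_derive.
move=> x bx; have sD := smooth_derive e1 sh.
have c1 : cont01 (fun=> 1 : R) by move=> t _; exact: cvg_cst.
have cs := slice_cont c1 sD bx.
rewrite /slice_int -int01_scale //.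
have cF : cont01 (fun t => x 0 1 * (1 * 'D_e1 h (scale_snd t x))).
  by move=> t t01; apply: cvgM; [exact: cvg_cst|exact: cs].
have dF (t : R) : 0 <= t <= 1 -> is_derive (t : R^o) (1 : R^o)
    (fun t : R^o => h (scale_snd t x)) (x 0 1 * (1 * 'D_e1 h (scale_snd t x))).
  move=> t01.
  have E s : scale_snd s x = mk2 (x 0 0) 0 + s *: (x 0 1 *: e1).
    by apply: row2P; rewrite !mxE /= ?mulr0 ?addr0 ?mulr1 ?add0r.
  under eq_fun do rewrite E.
  have dh : differentiable h (mk2 (x 0 0) 0 + t *: (x 0 1 *: e1)).
    by rewrite -E; apply: smooth_diff sh _; exact: scale_snd_box.
  have [dl dv] := is_derive_line dh; apply: DeriveDef => //.
  by rewrite dv deriveE // (linear_scale ('d h _)) -deriveE // mul1r E.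
rewrite (int01_FTC cF dF) /scale_snd mul1r mul0r mk2E h0 ?subr0 //.
by have [] := (boxE r x).1 bx.
Qed.

End hadamard.

(** * Series of smooth functions *)

Section series_of_smooth.
Context (R : realType).
Local Notation V := 'rV[R]_2.
Implicit Types (x v : V) (r : R).

Definition ssum (u : nat -> R) : R := limn (series u).

Definition dominated (u M : nat -> R) :=
  cvgn (series M) /\ forall j, `|u j| <= M j.

Lemma dominated_normed u M : dominated u M -> cvgn [normed series u].
Proof.
move=> [cM uM]; apply: (series_le_cvg _ _ uM cM) => n; first exact: normr_ge0.
exact: le_trans (normr_ge0 _) (uM n).
Qed.

Lemma dominated_cvg u M : dominated u M -> cvgn (series u).
Proof. by move=> /dominated_normed H; exact: (@normed_cvg R R^o). Qed.

Lemma ssum_add u w : cvgn (series u) -> cvgn (series w) ->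
  cvgn (series (fun j => u j + w j)) /\ ssum (fun j => u j + w j) = ssum u + ssum w.
Proof.
by move=> cu cw; split; [exact: is_cvg_seriesD|exact: lim_seriesD].
Qed.

Lemma ssum_scale (a : R) u : cvgn (series u) ->
  cvgn (series (fun j => a * u j)) /\ ssum (fun j => a * u j) = a * ssum u.
Proof.
move=> cu; split; first exact: (@is_cvg_seriesZ R u a).
exact: (@lim_seriesZ R u a).
Qed.

Lemma ssum_bound u M : dominated u M -> `|ssum u| <= ssum M.
Proof.
move=> duM; have cn := dominated_normed duM.
apply: le_trans (@lim_series_norm R R^o u cn) _.
by apply: lim_series_le => //; [case: duM|case: duM].
Qed.

(** Termwise differentiation. The function [g p q j] stands for the derivative of
    order [(p, q)] of the [j]-th term. Having all orders in one family makes the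
    hypotheses invariant under differentiation, so it suffices to differentiate
    once: there the remainder of each term is bounded by its second derivatives,
    which are dominated by a convergent series. *)
Lemma smooth_series (g : nat -> nat -> nat -> V -> R^o) r :
    (forall p q j x, box r x -> differentiable (g p q j) x /\
       forall v, 'D_v (g p q j) x = v 0 0 * g p.+1 q j x + v 0 1 * g p q.+1 j x) ->
    (forall p q, exists M, forall x, box r x -> dominated (g p q ^~ x) M) ->
  forall p q, smooth_on (box r) (fun x => ssum (g p q ^~ x)).
Proof.
move=> dg domg.
have cg p q x : box r x -> cvgn (series (g p q ^~ x)).
  by move=> bx; have [M /(_ x bx) /dominated_cvg] := domg p q.
have ob := @open_box R r.
have dS p q x : box r x -> differentiable (fun x => ssum (g p q ^~ x) : R^o) x /\
    forall v, 'D_v (fun x => ssum (g p q ^~ x) : R^o) x =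
     v 0 0 * ssum (g p.+1 q ^~ x) + v 0 1 * ssum (g p q.+1 ^~ x).
  move=> bx; set c0 := ssum _; set c1 := ssum (g p q.+1 ^~ x).
  have [M0 H0] := domg p.+2 q; have [M1 H1] := domg p.+1 q.+1.
  have [M2 H2] := domg p q.+2.
  pose M j := (M0 j + M1 j) + (M1 j + M2 j).
  have cM : cvgn (series M).
    have [c0' _] := H0 x bx; have [c1' _] := H1 x bx; have [c2' _] := H2 x bx.
    exact: (ssum_add (ssum_add c0' c1').1 (ssum_add c1' c2').1).1.
  have S0 : 0 <= ssum M.
    have := ssum_bound (u := fun=> 0) (M := M).
    move=> H; apply: le_trans (H _); first exact: normr_ge0.
    split=> // j; rewrite normr0.
    have [_ /(_ j) h0] := H0 x bx; have [_ /(_ j) h1] := H1 x bx; have [_ /(_ j) h2] := H2 x bx.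
    have := le_trans (normr_ge0 _) h0; have := le_trans (normr_ge0 _) h1.
    have := le_trans (normr_ge0 _) h2; rewrite /M; lra.
  apply: (@differentiable_eps _ _ _ _ x (lincomb2 c0 c1) (`|c0| + `|c1|)).
    exact: lincomb2_bound.
  move=> e ep.
  have n1 : \forall k \near (0 : V), box r (k + x).
    exact: near_translate (open_nbhs_nbhs (conj ob bx)).
  have n2 : \forall k \near (0 : V), `|k| < e / (ssum M + 1).
    by apply: near_norm_lt; rewrite divr_gt0 // ltr_wpDl.
  near=> k.
  have bxk : box r (x + k) by rewrite addrC; near: k.
  have k2 : `|k| < e / (ssum M + 1) by near: k.
  have cc := cg p q _ bxk; have cx := cg p q _ bx.
  have cp := cg p.+1 q _ bx; have cq := cg p q.+1 _ bx.
  have [K2 E2] := ssum_scale (-1) cx.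
  have [K3 E3] := ssum_scale (- k 0 0) cp.
  have [K4 E4] := ssum_scale (- k 0 1) cq.
  have [K34 E34] := ssum_add K3 K4.
  have [K234 E234] := ssum_add K2 K34.
  have [_ E1] := ssum_add cc K234.
  have -> : ssum (g p q ^~ (k + x)) - ssum (g p q ^~ x) - lincomb2 c0 c1 k =
    ssum (fun j => g p q j (x + k) + (-1 * g p q j x + (- k 0 0 * g p.+1 q j x + - k 0 1 * g p q.+1 j x))).
    by rewrite E1 E234 E34 E2 E3 E4 (addrC k x) /lincomb2 /c0 /c1; ring.
  have dom : dominated (fun j => g p q j (x + k) + (-1 * g p q j x + (- k 0 0 * g p.+1 q j x + - k 0 1 * g p q.+1 j x)))
     (fun j => `|k| ^+ 2 * M j).
    split=> [|j]; first exact: (ssum_scale _ cM).1.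
    have -> : g p q j (x + k) + (-1 * g p q j x + (- k 0 0 * g p.+1 q j x + - k 0 1 * g p q.+1 j x)) =
      g p q j (x + k) - g p q j x - 'D_k (g p q j) x.
      by rewrite (dg p q j x bx).2; ring.
    have seg t : 0 <= t <= 1 -> box r (x + t *: k).
      move=> t01; have := @ball_convex R V 0 x (x + k) r t.
      rewrite !subr0 addrAC subrr add0r; apply => //.
    have Dk y : box r y -> 'D_k (g p q j) y = k 0 0 * g p.+1 q j y + k 0 1 * g p q.+1 j y.
      by move=> by_; rewrite (dg p q j y by_).2.
    have nDk y : box r y -> \forall z \near y, k 0 0 *: g p.+1 q j z + k 0 1 *: g p q.+1 j z = 'D_k (g p q j) z.
      move=> by_; have := open_nbhs_nbhs (conj ob by_).
      by apply: filterS => z bz; rewrite Dk.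
    have ds y : box r y -> differentiable (fun z => k 0 0 *: g p.+1 q j z + k 0 1 *: g p q.+1 j z) y.
      move=> by_; apply: differentiableD; apply: differentiableZ.
        exact: (dg p.+1 q j y by_).1.
      exact: (dg p q.+1 j y by_).1.
    apply: taylor2_line => t /seg by_.
    - exact: (dg p q j _ by_).1.
    - exact: near_eq_differentiable (nDk _ by_) (ds _ by_).
    - set y := x + t *: k in by_ *.
      rewrite -(near_eq_derive k (nDk _ by_)).
      have [d0 D0] := dg p.+1 q j y by_; have [d1 D1] := dg p q.+1 j y by_.
      rewrite deriveD; [|exact/derivableZ/diff_derivable|exact/derivableZ/diff_derivable].
      rewrite !deriveZ; [|exact/diff_derivable|exact/diff_derivable].
      have [_ h0] := H0 y by_; have [_ h1] := H1 y by_; have [_ h2] := H2 y by_.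
      have := quad_bound (normrV_ge k 0) (normrV_ge k 1) (h0 j) (h1 j) (h1 j) (h2 j).
      by rewrite D0 D1 /M [_ ^+ 2 * _]mulrC !addrA.
  apply: le_trans (ssum_bound dom) _.
  rewrite (ssum_scale _ cM).2 expr2 mulrAC ler_wpM2r //.
  apply: le_trans (_ : `|k| * (ssum M + 1) <= _); first by rewrite ler_wpM2l // lerDl.
  by rewrite -ler_pdivlMr ?ltW // ltr_wpDl.
move=> p q k; elim: k p q => [|k IH] p q.
  by move=> x bx; apply/differentiable_continuous; exact: (dS p q x bx).1.
split=> [x bx|v]; first exact: (dS p q x bx).1.
have := Ck_add ob (Ck_mul ob (Ck_on_cst (W := R^o) k (box r) (v 0 0)) (IH p.+1 q))
                  (Ck_mul ob (Ck_on_cst (W := R^o) k (box r) (v 0 1)) (IH p q.+1)).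
by apply: Ck_ext => // x bx; rewrite (dS p q x bx).2.
Unshelve. all: by end_near. Qed.

End series_of_smooth.

(** * Powers of the sine, even functions *)

Section bounded_jets.
Context (R : realType).
Implicit Types f g : R -> R.

Fixpoint bounded_upto (n : nat) f : Prop :=
  (exists M : R, forall x, `|f x| <= M) /\
  match n with
  | 0 => True
  | n'.+1 => (forall x, derivable f x 1) /\ bounded_upto n' (derive1 f)
  end.

Lemma bounded_upto_bound n f : bounded_upto n f -> exists M : R, forall x, `|f x| <= M.
Proof. by case: n => [|n] []. Qed.

Lemma bounded_upto_lower n f : bounded_upto n.+1 f -> bounded_upto n f.
Proof.
elim: n f => [|n IH] f [bf [df Df]]; first by split.
by split=> //; split => //; exact: IH.
Qed.

Lemma bounded_upto_add n f g : bounded_upto n f -> bounded_upto n g ->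
  bounded_upto n (fun x => f x + g x).
Proof.
elim: n f g => [|n IH] f g bf bg.
  have [M fM] := bounded_upto_bound bf; have [N gN] := bounded_upto_bound bg.
  by split=> //; exists (M + N) => x; apply: le_trans (ler_normD _ _) (lerD _ _).
have [M fM] := bounded_upto_bound bf; have [N gN] := bounded_upto_bound bg.
have [_ [df Df]] := bf; have [_ [dg Dg]] := bg.
split; first by exists (M + N) => x; apply: le_trans (ler_normD _ _) (lerD _ _).
split=> [x|]; first exact: derivableD.
suff -> : derive1 (fun x => f x + g x) = (fun x => derive1 f x + derive1 g x) by exact: IH.
by apply/funext => x; rewrite !derive1E deriveD.
Qed.

Lemma bounded_upto_mul n f g : bounded_upto n f -> bounded_upto n g ->
  bounded_upto n (fun x => f x * g x).
Proof.
have B (F G : R -> R) : (exists M : R, forall x, `|F x| <= M) ->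
    (exists M : R, forall x, `|G x| <= M) -> exists M : R, forall x, `|F x * G x| <= M.
  by move=> [M FM] [N GN]; exists (M * N) => x; rewrite normrM; apply: ler_pM.
elim: n f g => [|n IH] f g bf bg.
  by split=> //; exact: B (bounded_upto_bound bf) (bounded_upto_bound bg).
have [bf0 [df Df]] := bf; have [bg0 [dg Dg]] := bg.
split; first exact: B.
split=> [x|]; first exact: derivableM.
suff -> : derive1 (fun x => f x * g x) = (fun x => f x * derive1 g x + g x * derive1 f x).
  by apply: bounded_upto_add; apply: IH => //; exact: bounded_upto_lower.
by apply/funext => x; rewrite !derive1E deriveM.
Qed.

Lemma bounded_upto_cst n (c : R) : bounded_upto n (fun=> c).
Proof.
elim: n c => [|n IH] c; first by split=> //; exists `|c|.
split; first by exists `|c|.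
split=> [x|]; first exact: derivable_cst.
suff -> : derive1 (fun=> c) = (fun=> 0 : R) :> (R -> R) by exact: IH.
by apply/funext => x; rewrite derive1_cst.
Qed.

Lemma bounded_upto_sin_cos n : bounded_upto n (@sin R) /\ bounded_upto n (@cos R).
Proof.
elim: n => [|n [IHs IHc]].
  by split; split=> //; exists 1 => x; [exact: sin_max|exact: cos_max].
split; split.
- by exists 1 => x; exact: sin_max.
- split=> [x|]; first exact: derivable_sin.
  suff -> : derive1 (@sin R) = @cos R :> (R -> R) by [].
  by apply/funext => x; rewrite derive1E derive_val.
- by exists 1 => x; exact: cos_max.
- split=> [x|]; first exact: derivable_cos.
  suff -> : derive1 (@cos R) = (fun x => -1 * sin x) :> (R -> R).
    by apply: bounded_upto_mul => //; exact: bounded_upto_cst.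
  by apply/funext => x; rewrite derive1E derive_val mulN1r.
Qed.

(** In the construction of Borel sums below, [eps * sin (t / eps)] is used in place
    of a cut-off of [t]: it is [t] to first order at 0, it is bounded by [eps], and
    all derivatives of its powers are bounded. *)
Definition sin_pow (j : nat) (x : R) : R := sin x ^+ j.

Lemma bounded_upto_sin_pow n j : bounded_upto n (sin_pow j).
Proof.
elim: j => [|j IH].
  rewrite (_ : sin_pow 0 = fun=> 1); first exact: bounded_upto_cst.
  by apply/funext => x; rewrite /sin_pow expr0.
rewrite (_ : sin_pow j.+1 = fun x => sin x * sin_pow j x).
  by apply: bounded_upto_mul => //; exact: (bounded_upto_sin_cos n).1.
by apply/funext => x; rewrite /sin_pow exprS.
Qed.

Lemma sin_pow_jet j q : (forall x, derivable (derive1n q (sin_pow j)) x 1) /\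
  exists2 M : R, 0 <= M & forall x, `|derive1n q (sin_pow j) x| <= M.
Proof.
have H n : bounded_upto n (derive1n q (sin_pow j)).
  elim: q n => [|q IH] n; first exact: bounded_upto_sin_pow.
  by have [_ [_]] := IH n.+1; rewrite derive1nS.
split; first by have [_ []] := H 1%N.
have [M HM] := bounded_upto_bound (H 0%N); exists M => //.
exact: le_trans (normr_ge0 _) (HM 0).
Qed.

Lemma Ck_sin_cos k : Ck_on k setT (@sin R : R^o -> R^o) /\ Ck_on k setT (@cos R : R^o -> R^o).
Proof.
elim: k => [|k [IHs IHc]].
  by split=> x _; [exact: continuous_sin|exact: continuous_cos].
have ds (x : R^o) : differentiable (@sin R : R^o -> R^o) x.
  exact/derivable1_diffP/derivable_sin.
have dc (x : R^o) : differentiable (@cos R : R^o -> R^o) x.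
  exact/derivable1_diffP/derivable_cos.
have D1 (f : R^o -> R^o) (x v : R^o) : differentiable f x -> 'D_v f x = v * 'D_1 f x.
  move=> df; rewrite !deriveE // -{1}[v]mulr1; exact: (linear_scale ('d f x) v 1).
split; split.
- by [].
- move=> v; have := Ck_mul openT (Ck_on_cst (W := R^o) k setT v) IHc.
  by apply: Ck_ext => [|x _]; [exact: openT|rewrite D1 // derive_val].
- by [].
- move=> v; have := Ck_mul openT (Ck_on_cst (W := R^o) k setT (- v)) IHs.
  by apply: Ck_ext => [|x _]; [exact: openT|rewrite D1 // derive_val /cst mulrN mulNr].
Qed.

Lemma smooth_sin : smooth_on setT (@sin R : R^o -> R^o).
Proof. by move=> k; exact: (Ck_sin_cos k).1. Qed.

End bounded_jets.

Section even_functions.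
Context (R : realType).
Local Notation V := 'rV[R]_2.
Local Notation e0 := (delta_mx 0 0 : V).
Local Notation e1 := (delta_mx 0 1 : V).
Implicit Types (x v : V) (r : R).

(** The bound tends to 0 along the points [x + t *: e1] as [t] decreases to 0. *)
Lemma axis_vanish (A : set V) (f : V -> R^o) (C : R) x : open A -> A x ->
  {for x, continuous f} -> (forall y, A y -> y 0 1 != 0 -> `|f y| <= C * `|y 0 1|) ->
  x 0 1 = 0 -> f x = 0.
Proof.
move=> oA Ax cf fC x1.
apply/eqP; rewrite -normr_eq0 eq_le normr_ge0 andbT.
apply/ler_addgt0Pr => e ep; rewrite add0r.
have n1 : \forall y \near x, `|f x - f y| < e / 2.
  by move/cvgrPdist_lt : cf; apply; rewrite divr_gt0.
have n2 := open_nbhs_nbhs (conj oA Ax).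
have [d /= d0 dH] := (nbhs_ballP _ _).1 (filterI n1 n2).
pose t := Num.min (d / 2) (e / (2 * (`|C| + 1))).
have t0 : 0 < t by rewrite lt_min !divr_gt0 // mulr_gt0 // ltr_wpDl.
pose y := x + t *: e1.
have y1 : y 0 1 = t by rewrite !mxE x1 /= mulr1 add0r.
have [fxy Ay] : `|f x - f y| < e / 2 /\ A y.
  apply: dH; rewrite -ball_normE /ball_ /= opprD addrA subrr sub0r normrN.
  apply/norm2_lt; rewrite !mxE /= mulr0 mulr1 normr0 gtr0_norm //; split=> //.
  by apply: le_lt_trans (_ : d / 2 < d); [rewrite ge_min lexx|lra].
have := fC y Ay; rewrite y1 gt_eqF // => /(_ isT); rewrite (gtr0_norm t0) => fy.
have Ct : C * t <= e / 2.
  apply: le_trans (_ : `|C| * (e / (2 * (`|C| + 1))) <= _).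
    apply: le_trans (_ : `|C| * t <= _); first by rewrite ler_wpM2r ?ler_norm // ltW.
    by rewrite ler_wpM2l // ge_min lexx orbT.
  have C1 : 0 < `|C| + 1 by rewrite ltr_wpDl.
  have -> : `|C| * (e / (2 * (`|C| + 1))) = e / 2 * (`|C| / (`|C| + 1)).
    by field; rewrite gt_eqF.
  apply: ler_piMr; first by rewrite divr_ge0 // ltW.
  by rewrite ler_pdivrMr // mul1r lerDl.
have := ler_normD (f x - f y) (f y); rewrite subrK; lra.
Qed.

(** Quotients by the second coordinate are unique: off the axis one can divide, and
    the axis follows by continuity. *)
Lemma snd_cancel (A : set V) (f : V -> R^o) : open A -> smooth_on A f ->
  (forall x, A x -> x 0 1 * f x = 0) -> forall x, A x -> f x = 0.
Proof.
move=> oA sf f0 x Ax; have [x1|x1] := eqVneq (x 0 1) 0; last first.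
  by have /eqP := f0 x Ax; rewrite mulf_eq0 (negPf x1) => /eqP.
apply: (@axis_vanish A f 0) => //; first exact: smooth_continuous sf Ax.
move=> y Ay y1; have /eqP := f0 y Ay; rewrite mulf_eq0 (negPf y1) => /eqP ->.
by rewrite normr0 mul0r.
Qed.

Definition even_on r (f : V -> R^o) :=
  forall u v : R, box r (mk2 u v) -> f (mk2 u (- v)) = f (mk2 u v).

Definition flip x : V := mk2 (x 0 0) (- x 0 1).

Lemma flip_mk2 (u v : R) : flip (mk2 u v) = mk2 u (- v).
Proof. by rewrite /flip mk2_0 mk2_1. Qed.

Lemma flipK x : flip (flip x) = x.
Proof. by rewrite {2}/flip flip_mk2 opprK mk2E. Qed.

Lemma box_flip r x : box r x -> box r (flip x).
Proof. by move=> /boxE[x0 x1]; apply/boxE; rewrite mk2_0 mk2_1 normrN. Qed.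

Lemma smooth_flip r (k : V -> R^o) : smooth_on (box r) k -> smooth_on (box r) (k \o flip).
Proof.
move=> sk; have ob := @open_box R r.
apply: (smooth_comp ob (fin_basis_rV R 2) (@box_flip r) _ sk).
exact: (smooth_mk2 ob (smooth_fst ob) (smooth_opp ob (smooth_snd ob))).
Qed.

(** Hadamard's lemma gives [f = x 0 1 * k1]. As [f] is even, [k1] is odd, so it
    vanishes on the axis and can be divided once more. *)
Lemma even_div r (f : V -> R^o) : smooth_on (box r) f -> even_on r f ->
    (forall u, `|u| < r -> f (mk2 u 0) = 0) ->
  exists k : V -> R^o, [/\ smooth_on (box r) k, even_on r k
    & forall x, box r x -> f x = x 0 1 ^+ 2 * k x].
Proof.
move=> sf ef f0; have [k1 sk1 fk1] := hadamard sf f0.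
have ob := @open_box R r.
have flip0 x : x 0 1 = 0 -> flip x = x.
  by move=> x1; rewrite /flip x1 oppr0 -[in RHS](mk2E x) x1.
have k1odd x : box r x -> k1 x + k1 (flip x) = 0.
  apply: (snd_cancel (f := fun x => k1 x + k1 (flip x)) ob).
    by apply: (smooth_add ob sk1); exact: smooth_flip.
  move=> y by_; rewrite mulrDr -fk1 //.
  have := fk1 _ (box_flip by_); rewrite mk2_1 mulNr => /eqP; rewrite -eqr_oppLR => /eqP <-.
  by rewrite ef ?mk2E // subrr.
have k10 u : `|u| < r -> k1 (mk2 u 0) = 0.
  move=> ur; have bu : box r (mk2 u 0).
    by apply/boxE; rewrite mk2_0 mk2_1 normr0; split => //; exact: le_lt_trans ur.
  have := k1odd _ bu; rewrite flip0 ?mk2_1 // => H; lra.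
have [k sk k1k] := hadamard sk1 k10.
exists k; split=> //; last by move=> x bx; rewrite fk1 // k1k // mulrA expr2.
move=> u v buv.
suff H x : box r x -> k (flip x) - k x = 0.
  by have := H _ buv; rewrite /flip mk2_0 mk2_1 => /eqP; rewrite subr_eq0 => /eqP.
apply: (snd_cancel (f := fun x => k (flip x) - k x) ob).
  by apply: (smooth_minus ob _ sk); exact: smooth_flip.
move=> y by_; have := k1odd y by_; rewrite !k1k //; last exact: box_flip.
by rewrite mk2_1 => H; lra.
Qed.

End even_functions.

(** * Borel's lemma for even functions *)

Section borel.
Context (R : realType).
Local Notation V := 'rV[R]_2.
Local Notation e0 := (delta_mx 0 0 : V).
Local Notation e1 := (delta_mx 0 1 : V).
Implicit Types (x v : V) (r : R).

Lemma lincomb2_continuous (a b : R) : continuous (lincomb2 a b).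
Proof.
apply/linear_bounded_continuous/linear_boundedP.
near=> M => y; apply: le_trans (lincomb2_bound a b y) _.
by apply: ler_wpM2r => //; near: M; apply: nbhs_pinfty_ge; rewrite num_real.
Unshelve. all: by end_near. Qed.

Lemma derive_snd_comp (phi : R -> R) (c : R) x : derivable phi (c * x 0 1) 1 ->
  differentiable (fun y : V => phi (c * y 0 1) : R^o) x /\
  forall v, 'D_v (fun y : V => phi (c * y 0 1) : R^o) x = v 0 1 * c * derive1 phi (c * x 0 1).
Proof.
move=> dphi; have cL := @lincomb2_continuous 0 c.
have E : (fun y : V => phi (c * y 0 1) : R^o) = (phi : R^o -> R^o) \o lincomb2 0 c.
  by apply/funext => y /=; rewrite /lincomb2 mulr0 add0r mulrC.
have Ex : lincomb2 0 c x = c * x 0 1 by rewrite /lincomb2 mulr0 add0r mulrC.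
have dp : differentiable (phi : R^o -> R^o) (lincomb2 0 c x).
  by apply/derivable1_diffP; rewrite Ex.
have dl : differentiable (lincomb2 0 c) x by exact: linear_differentiable.
have dc := differentiable_comp dl dp.
rewrite E; split=> // v; rewrite deriveE // diff_comp // diff_lin //=.
have Ev : lincomb2 0 c v = (v 0 1 * c) * 1 by rewrite /lincomb2 mulr0 add0r mulr1.
rewrite derive1E -Ex deriveE // Ev.
exact: (linear_scale ('d (phi : R^o -> R^o) _)).
Qed.

Definition axis_jet (k : V -> R^o) (p : nat) (u : R) : R :=
  iter p (fun f : V -> R^o => 'D_e0 f) k (mk2 u 0).

Lemma smooth_iter_derive (A : set V) (k : V -> R^o) p w : smooth_on A k ->
  smooth_on A (iter p (fun f : V -> R^o => 'D_w f) k).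
Proof. by move=> sk; elim: p => //= p IH; exact: smooth_derive. Qed.

Lemma box_axis r (u : R) : `|u| < r -> box r (mk2 u 0).
Proof.
by move=> ur; apply/boxE; rewrite mk2_0 mk2_1 normr0; split => //; exact: le_lt_trans ur.
Qed.

Lemma axis_jet_bounded r r' (k : V -> R^o) p : smooth_on (box r) k -> r' < r ->
  exists2 M : R, 0 <= M & forall u : R, `|u| <= r' -> `|axis_jet k p u| <= M.
Proof.
move=> sk rr; have [M M0 HM] := smooth_bounded (smooth_iter_derive p e0 sk) rr.
exists M => // u ur; apply: HM; apply/norm2_le; rewrite mk2_0 mk2_1 normr0.
by split=> //; exact: le_trans ur.
Qed.

(** The factor [S] is 1 on the axis. This is why [eps * sin (v^2 / eps)] can
    replace [v^2] in the leading term of an expansion in powers of [v^2], the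
    difference being again divisible by [v^2]. *)
Lemma sinc_factor (eps : R) (r : R) : 0 < eps -> exists S : V -> R^o,
  [/\ smooth_on (box r) S, forall u v : R, S (mk2 u (- v)) = S (mk2 u v),
      forall x, box r x -> x 0 1 ^+ 2 * S x = eps * sin (x 0 1 ^+ 2 / eps)
    & forall u, `|u| < r -> S (mk2 u 0) = 1].
Proof.
move=> eps0; pose h x : R^o := eps * sin (eps^-1 * x 0 1).
have sh : smooth_on setT h.
  apply: (smooth_mul openT (smooth_cst _ _)).
  apply: (@smooth_comp R V R^o setT setT (fun x => eps^-1 * x 0 1) (@sin R) openT) => //.
  - exact: fin_basis_scalar.
  - exact: (smooth_mul openT (smooth_cst _ _) (smooth_snd openT)).
  - exact: smooth_sin.
pose r0 := r ^+ 2 + 1 + `|r|.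
have [|u ur|S sS hS] := @hadamard R h r0.
- exact: smooth_subset sh.
- by rewrite /h mk2_1 mulr0 sin0 mulr0.
have r00 : 0 < r0 by rewrite /r0 addrAC ltr_wpDl // addr_ge0 // sqr_ge0.
have S1 : S 0 = 1.
  have b0 : box r0 (0 : V) by rewrite /box /= normr0.
  have ob := @open_box R r0.
  have nh : \forall x \near (0 : V), h x = x 0 1 * S x.
    by have := open_nbhs_nbhs (conj ob b0); apply: filterS => x; exact: hS.
  have := near_eq_derive e1 nh.
  have dS : derivable S (0 : V) e1 by exact/diff_derivable/(smooth_diff sS).
  have dc : derivable (fun x : V => x 0 1 : R^o) (0 : V) e1.
    exact/diff_derivable/(smooth_diff (smooth_snd ob) b0).
  have -> : 'D_e1 (fun x : V => x 0 1 * S x) 0 = S 0.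
    have := deriveM dc dS; rewrite derive_coord; last first.
      exact: (smooth_diff (smooth_on_id (V:=V) setT)).
    by rewrite derive_id !mxE /= scale0r add0r /GRing.scale /= mulr1.
  move=> <-; have dph : derivable (fun t : R => eps * sin t) (eps^-1 * (0 : V) 0 1) 1.
    by apply: derivableM; [exact: derivable_cst|exact: derivable_sin].
  have [_ /(_ e1)] := derive_snd_comp dph; rewrite /h => ->.
  rewrite !mxE mulr0 derive1Ml; last exact: derivable_sin.
  by rewrite derive1E derive_val cos0 mulr1 /= mul1r mulVf // gt_eqF.
have bq x : box r x -> box r0 (mk2 0 (x 0 1 ^+ 2)).
  move=> /boxE[_ x1]; apply/boxE; rewrite mk2_0 mk2_1 normr0; split=> //.
  have r_ge0 := le_lt_trans (normr_ge0 _) x1.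
  have : `|x 0 1 ^+ 2| < r ^+ 2 by rewrite normrX ltrXn2r // nnegrE ltW.
  by rewrite /r0; have := normr_ge0 r; lra.
exists (fun x => S (mk2 0 (x 0 1 ^+ 2))); split.
- have ob := @open_box R r.
  apply: (@smooth_comp R V V (box r) (box r0) (fun x => mk2 0 (x 0 1 ^+ 2)) S ob) => //.
  + exact: fin_basis_rV.
  + exact: (smooth_mk2 ob (smooth_cst _ _) (smooth_exp 2 ob (smooth_snd ob))).
- by move=> u v; rewrite !mk2_1 sqrrN.
- by move=> x bx; have := hS _ (bq x bx); rewrite /h mk2_1 => <-; rewrite [_ / eps]mulrC.
- move=> u ur; rewrite mk2_1 expr0n /=.
  by rewrite (_ : mk2 0 0 = 0) //; apply: row2P; rewrite !mxE.
Qed.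

(** One step in the construction of a Borel sum. The term [v^(2j) k (u, v)] is
    replaced by [k (u, 0) (eps sin (y / eps))^j] at [y = v^2], up to an even
    multiple of [v^(2j+2)]. A small [eps] makes the derivatives of this
    replacement of orders [p] in [u] and [q] in [y] at most [2^-j], as long
    as [p] and [q] are less than [j]. *)
Lemma borel_step r r' j (k : V -> R^o) : r' < r -> smooth_on (box r) k -> even_on r k ->
  exists (eps : R) (k' : V -> R^o), [/\ smooth_on (box r) k' /\ even_on r k', 0 < eps <= 1,
   forall x, box r x -> x 0 1 ^+ j.*2 * k x =
     k (mk2 (x 0 0) 0) * (eps * sin (x 0 1 ^+ 2 / eps)) ^+ j + x 0 1 ^+ j.+1.*2 * k' x,
   forall p q (u y : R), (p < j)%N -> (q < j)%N -> `|u| <= r' ->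
     `|axis_jet k p u * (eps ^+ j / eps ^+ q * derive1n q (sin_pow j) y)| <= 2^-1 ^+ j
   & forall u : R, `|u| <= r' -> `|k (mk2 u 0)| * eps <= 2^-1 ^+ j].
Proof.
move=> rr sk ek.
have /choice[M HM] : forall p, exists M : R, 0 <= M /\ forall u : R, `|u| <= r' -> `|axis_jet k p u| <= M.
  by move=> p; have [M] := axis_jet_bounded p sk rr; exists M.
have /choice[B HB] : forall q, exists B : R, 0 <= B /\ forall y : R, `|derive1n q (sin_pow j) y| <= B.
  by move=> q; have [_ [B]] := sin_pow_jet R j q; exists B.
pose C := \sum_(p < j) M p; pose D := \sum_(q < j) B q.
have C0 : 0 <= C by apply: sumr_ge0 => p _; have [] := HM p.
have D0 : 0 <= D by apply: sumr_ge0 => q _; have [] := HB q.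
have M00 : 0 <= M 0%N by have [] := HM 0%N.
have CD0 : 0 <= C * D by exact: mulr_ge0.
have K0 : 0 < 1 + C * D + M 0%N by lra.
pose eps := Num.min 1 (2^-1 ^+ j / (1 + C * D + M 0%N)).
have h0 : (0 : R) < 2^-1 ^+ j by rewrite exprn_gt0.
have eps0 : 0 < eps by rewrite lt_min ltr01 divr_gt0.
have eps1 : eps <= 1 by rewrite ge_min lexx.
have epsK (a : R) : 0 <= a -> a <= 1 + C * D + M 0%N -> a * eps <= 2^-1 ^+ j.
  move=> a0 aK; apply: le_trans (_ : (1 + C * D + M 0%N) * eps <= _).
    by rewrite ler_wpM2r // ltW.
  by rewrite mulrC -ler_pdivlMr // ge_min lexx orbT.
have [S [sS eS SE S1]] := sinc_factor r eps0.
have ob := @open_box R r.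
pose f x : R^o := k x - k (mk2 (x 0 0) 0) * S x ^+ j.
have [k' [sk' ek' fk']] : exists k' : V -> R^o, [/\ smooth_on (box r) k', even_on r k'
    & forall x, box r x -> f x = x 0 1 ^+ 2 * k' x].
  apply: even_div.
  - apply: (smooth_minus ob sk); apply: (smooth_mul ob); last exact: smooth_exp.
    apply: (@smooth_comp R V V (box r) (box r) (fun x => mk2 (x 0 0) 0) k ob) => //.
    + exact: fin_basis_rV.
    + by move=> x /boxE[x0 _]; exact: box_axis.
    + exact: (smooth_mk2 ob (smooth_fst ob) (smooth_cst _ _)).
  - by move=> u v buv; rewrite /f eS ek // !mk2_0.
  - by move=> u ur; rewrite /f mk2_0 S1 // expr1n mulr1 subrr.
exists eps, k'; split=> //; first by rewrite eps0 eps1.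
- move=> x bx; have := fk' x bx; rewrite /f -SE // => /eqP.
  rewrite subr_eq => /eqP ->; rewrite exprMn -exprM mul2n doubleS !exprS; ring.
- move=> p q u y pj qj ur.
  (* As q < j, a factor eps is left to absorb the bounds of the other factors. *)
  have -> : eps ^+ j / eps ^+ q = eps ^+ (j - q).
    by rewrite -{1}(subnK (ltnW qj)) exprD mulfK // expf_neq0 // gt_eqF.
  have -> : eps ^+ (j - q) = eps ^+ (j - q).-1 * eps.
    by rewrite -exprSr prednK // subn_gt0.
  rewrite !normrM (gtr0_norm eps0) (ger0_norm (exprn_ge0 _ (ltW eps0))).
  have [Mp0 /(_ u ur) uM] := HM p; have [Bq0 /(_ y) yB] := HB q.
  have MC : M p <= C.
    rewrite /C (bigD1 (Ordinal pj)) //= lerDl; apply: sumr_ge0 => i _.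
    by have [] := HM i.
  have BD : B q <= D.
    rewrite /D (bigD1 (Ordinal qj)) //= lerDl; apply: sumr_ge0 => i _.
    by have [] := HB i.
  apply: le_trans (_ : (C * D) * eps <= _); last by apply: epsK => //; lra.
  set a := `|axis_jet k p u| in uM *; set b := `|_ y| in yB *.
  have e1 : eps ^+ (j - q).-1 <= 1 by apply: exprn_ile1 => //; exact: ltW.
  have e2 : 0 <= eps ^+ (j - q).-1 by apply: exprn_ge0; exact: ltW.
  have -> : a * (eps ^+ (j - q).-1 * eps * b) = (a * (eps ^+ (j - q).-1 * b)) * eps by ring.
  rewrite ler_wpM2r //; first exact: ltW.
  have a0 : 0 <= a by exact: normr_ge0.
  have b0 : 0 <= b by exact: normr_ge0.
  apply: (ler_pM a0 (mulr_ge0 e2 b0)); first exact: le_trans MC.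
  by apply: le_trans (_ : 1 * b <= _); [rewrite ler_wpM2r|rewrite mul1r; exact: le_trans BD].
- move=> u ur; apply: epsK => //.
  have [_ /(_ u ur)] := HM 0%N; rewrite /axis_jet /= => H; lra.
Qed.

End borel.

Section borel_sum.
Context (R : realType).
Local Notation V := 'rV[R]_2.
Local Notation e0 := (delta_mx 0 0 : V).
Local Notation e1 := (delta_mx 0 1 : V).
Implicit Types (x v : V) (r : R).

Lemma sin_le_norm (t : R) : `|sin t| <= `|t|.
Proof.
have ds (x : R^o) : differentiable (@sin R : R^o -> R^o) x.
  exact/derivable1_diffP/derivable_sin.
have [s _] := @mvt_line R R^o (@sin R) 0 t (fun s _ => ds _).
rewrite add0r sin0 subr0 add0r deriveE // => ->.
have -> : s *: (t : R^o) = s * t by [].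
rewrite -[X in 'd _ _ X](mulr1 t) (_ : 'd _ _ _ = t * cos (s * t)).
  by rewrite normrM ler_piMr // cos_max.
rewrite [LHS](linear_scale ('d (@sin R : R^o -> R^o) _) t 1) /GRing.scale /=; congr (_ * _).
by rewrite -deriveE // derive_val.
Qed.

Lemma half_pow_sum N n : \sum_(N <= j < n) 2^-1 ^+ j <= (2 : R).
Proof.
apply: le_trans (_ : \sum_(0 <= j < n) 2^-1 ^+ j <= _).
  have [Nn|nN] := leqP N n; last first.
    by rewrite big_geq ?(ltnW nN) // sumr_ge0 // => i _; exact: exprn_ge0.
  by rewrite [leRHS](big_cat_nat (leq0n N) Nn) /= lerDr sumr_ge0 // => i _; exact: exprn_ge0.
suff -> : \sum_(0 <= j < n) 2^-1 ^+ j = 2 - 2 * 2^-1 ^+ n :> R.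
  by rewrite gerBl mulr_ge0 // exprn_ge0.
elim: n => [|n IH]; first by rewrite big_geq // expr0 mulr1 subrr.
by rewrite big_nat_recr //= IH exprS; field.
Qed.

(** Finitely many terms are bounded only by their own constants: the factor [2 ^+ i]
    in [K] brings them under the geometric series. *)
Lemma geometric_dominated (X : Type) (S : set X) (u : nat -> X -> R) (n0 : nat) :
    (forall j, exists C : R, 0 <= C /\ forall z, S z -> `|u j z| <= C) ->
    (forall j z, (n0 <= j)%N -> S z -> `|u j z| <= 2^-1 ^+ j) ->
  exists M, forall z, S z -> dominated (u ^~ z) M.
Proof.
move=> /choice[C HC] Hu.
pose K := 1 + \sum_(i < n0) C i * 2 ^+ i.
have CS i0 : 0 <= \sum_(i < n0 | i != i0) C i * 2 ^+ i :> R.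
  by apply: sumr_ge0 => i _; apply: mulr_ge0; [have [] := HC i|exact: exprn_ge0].
exists (geometric K 2^-1) => x Sx; split.
  by apply: is_cvg_geometric_series; rewrite ger0_norm // invf_lt1 // ltr1n.
move=> j; rewrite /geometric /=; have h0 : (0 : R) <= 2^-1 ^+ j by exact: exprn_ge0.
have [jn|nj] := ltnP j n0; last first.
  apply: le_trans (Hu j x nj Sx) _; rewrite -{1}[2^-1 ^+ j]mul1r ler_wpM2r // lerDl.
  by apply: sumr_ge0 => i _; apply: mulr_ge0; [have [] := HC i|exact: exprn_ge0].
have [Cj0 /(_ x Sx) uC] := HC j; apply: le_trans uC _.
apply: le_trans (_ : (C j * 2 ^+ j) * 2^-1 ^+ j <= _).
  by rewrite -mulrA -exprMn mulfV // expr1n mulr1.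
apply: ler_wpM2r => //; rewrite /K (bigD1 (Ordinal jn)) //=.
by have := CS (Ordinal jn); lra.
Qed.

Lemma series_tail (u : nat -> R) N (K : R) : cvgn (series u) ->
  (forall n, (N <= n)%N -> `|\sum_(N <= j < n) u j| <= K) ->
  `|ssum u - \sum_(0 <= j < N) u j| <= K.
Proof.
move=> cu uK.
have cv : (fun n => `|series u n - \sum_(0 <= j < N) u j|) @ \oo --> `|ssum u - \sum_(0 <= j < N) u j|.
  by apply: cvg_norm; apply: cvgB => //; exact: cvg_cst.
apply: (cvgr_to_le cv); exists N => // n /= Nn.
by rewrite /series /= (big_cat_nat (leq0n N) Nn) /= addrAC subrr add0r uK.
Qed.

Lemma derive_axis (K : V -> R^o) x : differentiable K (mk2 (x 0 0) 0) ->
  differentiable (fun y : V => K (mk2 (y 0 0) 0)) x /\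
  forall v, 'D_v (fun y : V => K (mk2 (y 0 0) 0)) x = v 0 0 * 'D_e0 K (mk2 (x 0 0) 0).
Proof.
move=> dK; pose P (y : V) : V := (y 0 0 : R^o) *: e0.
have PE (y : V) : mk2 (y 0 0) 0 = P y by apply: row2P; rewrite !mxE /= ?mulr1 ?mulr0.
have df : differentiable (fun y : V => y 0 0 : R^o) x.
  exact: (smooth_diff (smooth_fst openT)).
have dP : differentiable P x by exact: differentiableZl.
rewrite PE in dK *.
have -> : (fun y : V => K (mk2 (y 0 0) 0)) = K \o P by apply/funext => y /=; rewrite PE.
split=> [|v]; first exact: differentiable_comp.
rewrite deriveE; last exact: differentiable_comp.
have D0 : 'd (fun y : V => y 0 0 : R^o) x v = v 0 0.
  by rewrite -deriveE // derive_coord ?derive_id.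
have DP : 'd P x v = v 0 0 *: e0 by rewrite /P (diffZl e0 df) /= D0.
rewrite (diff_comp dP dK) /= DP deriveE //.
exact: (linear_scale ('d K _)).
Qed.

(** Iterating the previous step from [e] gives even functions [k_j] and numbers
    [eps_j] with
    [e (u, v) = \sum_(j < N) k_j (u, 0) (eps_j sin (v^2 / eps_j))^j + v^(2N) k_N (u, v)].
    The series [B (u, y)] of the terms [k_j (u, 0) (eps_j sin (y / eps_j))^j]
    converges with all its derivatives by the choice of the [eps_j], and its tail
    from [N] on is of order [y^N]. *)
Theorem borel_even r r' (e : V -> R^o) : r' < r -> r' <= 1 ->
    smooth_on (box r) e -> even_on r e ->
  exists2 B : V -> R^o, smooth_on (box r') B &
    forall N, exists C : R, forall x, box r' x ->
      `|e x - B (mk2 (x 0 0) (x 0 1 ^+ 2))| <= C * `|x 0 1| ^+ N.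
Proof.
move=> rr r'1 se ee.
(* The steps are chained by dependent choice over the even smooth functions. *)
pose T := {k : V -> R^o | smooth_on (box r) k /\ even_on r k}.
pose good (nk : nat * T) (out : R * T) :=
  let: (j, k) := nk in let: (eps, k') := out in
  [/\ 0 < eps <= 1,
   forall x, box r x -> x 0 1 ^+ j.*2 * sval k x =
     sval k (mk2 (x 0 0) 0) * (eps * sin (x 0 1 ^+ 2 / eps)) ^+ j + x 0 1 ^+ j.+1.*2 * sval k' x,
   forall p q (u y : R), (p < j)%N -> (q < j)%N -> `|u| <= r' ->
     `|axis_jet (sval k) p u * (eps ^+ j / eps ^+ q * derive1n q (sin_pow j) y)| <= 2^-1 ^+ j
   & forall u : R, `|u| <= r' -> `|sval k (mk2 u 0)| * eps <= 2^-1 ^+ j].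
have /choice[F HF] : forall nk, exists out, good nk out.
  move=> [j [k [sk ek]]]; have [eps [k' [sk' e1 e2 e3 e4]]] := borel_step j rr sk ek.
  by exists (eps, exist _ k' sk').
pose s := fix s n : T := if n is n'.+1 then (F (n', s n')).2 else exist _ e (conj se ee).
pose eps n := (F (n, s n)).1.
have Hs j : good (j, s j) (eps j, s j.+1).
  by rewrite /eps /=; have := HF (j, s j); case: (F _).
pose k j : V -> R^o := sval (s j).
have sk j : smooth_on (box r) (k j) by have [] := svalP (s j).
have e0j j : 0 < eps j by have [/andP[]] := Hs j.
have e1j j : eps j <= 1 by have [/andP[]] := Hs j.
have bb x : box r' x -> box r x by move=> bx; exact: lt_trans rr.
(* The derivative of order (p, q) of the j-th term, in the variables (u, y). *)
pose g p q j x : R^o := axis_jet (k j) p (x 0 0) *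
   (eps j ^+ j / eps j ^+ q * derive1n q (sin_pow j) ((eps j)^-1 * x 0 1)).
have gdiff p q j x : box r' x -> differentiable (g p q j) x /\
       forall v, 'D_v (g p q j) x = v 0 0 * g p.+1 q j x + v 0 1 * g p q.+1 j x.
  move=> bx; have [x0 _] := (boxE r x).1 (bb _ bx).
  have [d1 D1] := derive_axis (smooth_diff (smooth_iter_derive p e0 (sk j)) (box_axis x0)).
  have [dj _] := @sin_pow_jet R j q.
  have [d2 D2] := @derive_snd_comp R (derive1n q (sin_pow j)) (eps j)^-1 x (dj _).
  pose c : R^o := eps j ^+ j / eps j ^+ q.
  have d3 : differentiable (c *: (fun y : V => derive1n q (sin_pow j) ((eps j)^-1 * y 0 1) : R^o)) x.
    exact: differentiableZ.
  pose G1 : V -> R^o := fun y => iter p (fun f : V -> R^o => 'D_e0 f) (k j) (mk2 (y 0 0) 0).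
  pose G2 : V -> R^o := c *: (fun y : V => derive1n q (sin_pow j) ((eps j)^-1 * y 0 1) : R^o).
  have gE : g p q j = G1 * G2 by [].
  rewrite gE; split=> [|v]; first exact: differentiableM.
  rewrite deriveM; [|exact: diff_derivable|exact: diff_derivable].
  rewrite D1 deriveZ; last exact: diff_derivable.
  rewrite D2 /g /G1 /G2 /c /axis_jet derive1nS iterS /GRing.scale /= /GRing.scale /= /GRing.scale /= exprS.
  have := e0j j; set ee0 := eps j; set X := derive1 _ _; set Y := derive1n q _ _.
  set Z := 'D_e0 _ _; set W := iter _ _ _ _ => h; field.
  by rewrite expf_neq0 ?gt_eqF.
have gdom p q : exists M, forall x, box r' x -> dominated (g p q ^~ x) M.
  apply: (@geometric_dominated V (box r') (g p q) (maxn p q).+1) => [j|j x pqj bx].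
    have [M M0 HM] := axis_jet_bounded p (sk j) rr.
    have [_ [B B0 HB]] := @sin_pow_jet R j q.
    exists (M * (`|eps j ^+ j / eps j ^+ q| * B)); split; first by rewrite !mulr_ge0.
    move=> x /boxE[x0 _]; rewrite /g normrM; apply: ler_pM => //; first exact/HM/ltW.
    by rewrite normrM; apply: ler_pM.
  have [_ _ H _] := Hs j; have /boxE[x0 _] := bx.
  apply: H; [exact: leq_ltn_trans (leq_maxl p q) pqj|exact: leq_ltn_trans (leq_maxr p q) pqj|exact: ltW].
exists (fun x => ssum (g 0 0 ^~ x)); first exact: smooth_series.
have tele N x : box r x -> e x = \sum_(0 <= j < N) k j (mk2 (x 0 0) 0) *
   (eps j * sin (x 0 1 ^+ 2 / eps j)) ^+ j + x 0 1 ^+ N.*2 * k N x.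
  move=> bx; elim: N => [|N IH]; first by rewrite big_geq // add0r mul1r.
  rewrite big_nat_recr //= {1}IH -addrA; congr (_ + _).
  by have [_ /(_ x bx)] := Hs N.
suff HN N : exists C : R, forall x, box r' x ->
      `|e x - ssum (g 0 0 ^~ (mk2 (x 0 0) (x 0 1 ^+ 2)))| <= C * `|x 0 1| ^+ N.*2.
  move=> N; have [C HC] := HN N; exists `|C| => x bx; apply: le_trans (HC x bx) _.
  have x1 : `|x 0 1| <= 1 by have [_ /ltW/le_trans] := (boxE r' x).1 bx; apply.
  apply: le_trans (_ : `|C| * `|x 0 1| ^+ N.*2 <= _).
    by apply: ler_wpM2r; [exact: exprn_ge0|exact: ler_norm].
  apply: ler_wpM2l => //; apply: ler_wiXn2l => //.
  by rewrite -addnn leq_addr.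
have [M M0 HM] := smooth_bounded (sk N.+1) rr.
exists (M + 2) => x bx.
have /boxE[x0 x1] := bx.
have x11 : `|x 0 1| <= 1 by apply: le_trans (ltW x1) _.
pose u j := g 0%N 0%N j (mk2 (x 0 0) (x 0 1 ^+ 2)).
have uE j : u j = k j (mk2 (x 0 0) 0) * (eps j * sin (x 0 1 ^+ 2 / eps j)) ^+ j.
  by rewrite /u /g /axis_jet /= !mk2_0 mk2_1 expr0 divr1 /sin_pow exprMn (mulrC (x 0 1 ^+ 2)).
have bq : box r' (mk2 (x 0 0) (x 0 1 ^+ 2)) by exact: box_sqr.
have cu : cvgn (series u) by have [M' /(_ _ bq) /dominated_cvg] := gdom 0%N 0%N.
have ub j : (N < j)%N -> `|u j| <= 2^-1 ^+ j * `|x 0 1| ^+ N.*2.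
  move=> Nj; rewrite uE normrM normrX.
  have [_ _ _ /(_ _ (ltW x0)) H] := Hs j.
  set t := `|eps j * _|.
  have t_eps : t <= eps j.
    by rewrite /t normrM gtr0_norm // ler_piMr ?sin_max // ltW.
  have t_x : t <= `|x 0 1| ^+ 2.
    rewrite /t normrM gtr0_norm //; apply: le_trans (ler_wpM2l (ltW (e0j j)) (sin_le_norm _)) _.
    by rewrite normrM normfV (gtr0_norm (e0j j)) mulrC divfK ?gt_eqF // normrX.
  have t0 : 0 <= t by exact: normr_ge0.
  have -> : t ^+ j = t ^+ (j - N) * t ^+ N by rewrite -exprD subnK // ltnW.
  rewrite mulrA; apply: ler_pM; rewrite ?mulr_ge0 ?exprn_ge0 //.
    apply: le_trans H; apply: ler_wpM2l => //.
    rewrite -(prednK (n := j - N)) ?subn_gt0 // exprS.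
    apply: le_trans t_eps; apply: ler_piMr => //; apply: exprn_ile1 => //.
    by apply: le_trans (e1j j); rewrite /t normrM gtr0_norm // ler_piMr ?sin_max // ltW.
  by rewrite -mul2n exprM; apply: lerXn2r => //; rewrite nnegrE // exprn_ge0.
have tail : `|ssum u - \sum_(0 <= j < N.+1) u j| <= 2 * `|x 0 1| ^+ N.*2.
  apply: series_tail => // n Nn; apply: le_trans (ler_norm_sum _ _ _) _.
  apply: le_trans (_ : \sum_(N.+1 <= j < n) 2^-1 ^+ j * `|x 0 1| ^+ N.*2 <= _).
    by rewrite big_nat_cond [leRHS]big_nat_cond; apply: ler_sum => j /andP[/andP[Nj _] _]; exact: ub.
  rewrite -mulr_suml; apply: ler_wpM2r; first exact: exprn_ge0.
  exact: half_pow_sum.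
rewrite (tele N.+1 x (bb _ bx)) -/(ssum u).
under eq_bigr do rewrite -uE.
rewrite addrAC; apply: le_trans (ler_normD _ _) _; rewrite distrC mulrDl addrC.
apply: lerD => //; rewrite normrM normrX mulrC; apply: ler_pM => //.
  by apply: HM; exact: ltW.
apply: ler_wiXn2l => //.
by rewrite leq_double.
Qed.

End borel_sum.

(** * Whitney's theorem on even functions *)

Section whitney.
Context (R : realType).
Local Notation V := 'rV[R]_2.
Local Notation e0 := (delta_mx 0 0 : V).
Local Notation e1 := (delta_mx 0 1 : V).
Implicit Types (x y v : V) (r : R).

Definition flat_on r (f : V -> R^o) :=
  smooth_on (box r) f /\ forall N, exists2 k : V -> R^o, smooth_on (box r) k &
    forall x, box r x -> f x = x 0 1 ^+ N * k x.

(** The bound of order [N + 1] makes the quotient by the [N]-th power vanish on the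
    axis, so that Hadamard's lemma can be applied again. *)
Lemma flat_of_bound r (f : V -> R^o) : smooth_on (box r) f ->
  (forall N, exists C : R, forall x, box r x -> `|f x| <= C * `|x 0 1| ^+ N) ->
  flat_on r f.
Proof.
move=> sf fN; split=> //; elim=> [|N [k sk fk]].
  by exists f => // x _; rewrite expr0 mul1r.
have ob := @open_box R r.
have [C HC] := fN N.+1.
have [u ur|k' sk' kk'] := hadamard sk.
  have bu := box_axis ur.
  apply: (@axis_vanish R (box r) k C) => //.
  - exact: smooth_continuous sk bu.
  - move=> y by_ y1; have := HC y by_.
    rewrite (fk _ by_) normrM normrX exprSr mulrCA ler_pM2l ?exprn_gt0 ?normr_gt0 //.
  - by rewrite mk2_1.
by exists k' => // x bx; rewrite fk // kk' // exprSr mulrA.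
Qed.

Lemma flat_d0 r (f : V -> R^o) : flat_on r f -> flat_on r ('D_e0 f).
Proof.
move=> [sf ff]; split=> [|N]; first exact: smooth_derive.
have [k sk fk] := ff N; exists ('D_e0 k); first exact: smooth_derive.
move=> x bx; have ob := @open_box R r.
have nfk : \forall y \near x, f y = y 0 1 ^+ N * k y.
  by have := open_nbhs_nbhs (conj ob bx); apply: filterS => y; exact: fk.
rewrite (near_eq_derive e0 nfk).
have dk : derivable k x e0 by exact/diff_derivable/(smooth_diff sk).
have [dp Dp] := @derive_snd_comp R (fun t => t ^+ N) 1 x (@exprn_derivable _ _ _ _).
have -> : (fun y => y 0 1 ^+ N * k y) = (fun y : V => (1 * y 0 1) ^+ N : R^o) * k.
  by apply/funext => y; rewrite !fctE mul1r.
rewrite deriveM //; last exact: diff_derivable.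
by rewrite Dp !mxE /= !mul0r scaler0 addr0 mul1r.
Qed.

(** The shape [2 v g] of the derivative is the one for which
    [f (u, sqrt y)] has [y]-derivative [g (u, sqrt y)]. *)
Lemma flat_d1 r (f : V -> R^o) : flat_on r f -> exists2 g : V -> R^o, flat_on r g &
  forall x, box r x -> 'D_e1 f x = 2 * x 0 1 * g x.
Proof.
move=> [sf ff]; have ob := @open_box R r.
have D N : exists2 k : V -> R^o, smooth_on (box r) k &
    forall x, box r x -> 'D_e1 f x = x 0 1 ^+ N * k x.
  have [k sk fk] := ff N.+1.
  exists (fun x => N.+1%:R * k x + x 0 1 * 'D_e1 k x).
    apply: (smooth_add ob (smooth_mul ob (smooth_cst _ _) sk)).
    exact: (smooth_mul ob (smooth_snd ob) (smooth_derive e1 sk)).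
  move=> x bx.
  have nfk : \forall y \near x, f y = y 0 1 ^+ N.+1 * k y.
    by have := open_nbhs_nbhs (conj ob bx); apply: filterS => y; exact: fk.
  rewrite (near_eq_derive e1 nfk).
  have dk : derivable k x e1 by exact/diff_derivable/(smooth_diff sk).
  have [dp Dp] := @derive_snd_comp R (fun t => t ^+ N.+1) 1 x (@exprn_derivable _ _ _ _).
  have -> : (fun y => y 0 1 ^+ N.+1 * k y) = (fun y : V => (1 * y 0 1) ^+ N.+1 : R^o) * k.
    by apply/funext => y; rewrite !fctE mul1r.
  rewrite deriveM //; last exact: diff_derivable.
  rewrite Dp exp_derive1 !mxE /= !mul1r /GRing.scale /= exprS; ring.
have [m sm fm] := D 1%N.
exists (fun x => 2^-1 * m x); last first.
  by move=> x bx; rewrite fm // expr1; field.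
split; first exact: (smooth_mul ob (smooth_cst _ _) sm).
move=> N; have [k sk fk] := D N.+1.
exists (fun x => 2^-1 * k x); first exact: (smooth_mul ob (smooth_cst _ _) sk).
move=> x bx; rewrite mulrCA; congr (_ * _); apply/eqP; rewrite -subr_eq0; apply/eqP.
apply: (snd_cancel (f := fun x => m x - x 0 1 ^+ N * k x) ob) bx.
  by apply: (smooth_minus ob sm (smooth_mul ob (smooth_exp N ob (smooth_snd ob)) sk)).
move=> y by_; rewrite mulrBr mulrA -exprS -fk // -[X in X * m y]expr1 -fm //.
exact: subrr.
Qed.

(** A flat even function of [v], read in the variable [y = v^2]; flatness is what
    makes the extension by 0 smooth. *)
Definition half_ext (f : V -> R^o) x : R^o :=
  if 0 < x 0 1 then f (mk2 (x 0 0) (Num.sqrt (x 0 1))) else 0.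

Lemma sqrt_box r x : 0 < r <= 1 -> box (r ^+ 2) x -> box r (mk2 (x 0 0) (Num.sqrt (x 0 1))).
Proof.
move=> /andP[r0 r1] /boxE[x0 x1]; apply/boxE; rewrite mk2_0 mk2_1; split.
  by apply: lt_le_trans x0 _; rewrite expr2 ler_piMr // ltW.
rewrite ger0_norm ?sqrtr_ge0 // -[ltRHS](ger0_norm (ltW r0)) -sqrtr_sqr.
rewrite ltr_sqrt ?exprn_gt0 //; exact: le_lt_trans (ler_norm _) x1.
Qed.

Lemma half_ext_diff r (f g : V -> R^o) x : 0 < r <= 1 -> flat_on r f -> 
  (forall x, box r x -> 'D_e1 f x = 2 * x 0 1 * g x) -> box (r ^+ 2) x ->
  differentiable (half_ext f) x /\ forall v, 'D_v (half_ext f) x =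
    v 0 0 * half_ext ('D_e0 f) x + v 0 1 * half_ext g x.
Proof.
move=> r01 [sf ff] fg bx; have ob := @open_box R (r ^+ 2).
have [x1|x1|x1] := ltgtP 0 (x 0 1).
- pose S y : V := mk2 (y 0 0) (Num.sqrt (1 * y 0 1)).
  have d1 : derivable (@Num.sqrt R) (1 * x 0 1) 1.
    by rewrite mul1r; have [] := is_derive1_sqrt x1.
  have [ds Ds] := @derive_snd_comp R (@Num.sqrt R) 1 x d1.
  have SE y : S y = (y 0 0 : R^o) *: e0 + (Num.sqrt (1 * y 0 1) : R^o) *: e1.
    by rewrite /S [LHS]vec2_sum mk2_0 mk2_1.
  have df : differentiable (fun y : V => y 0 0 : R^o) x.
    exact: (smooth_diff (smooth_fst openT)).
  have D0 v : 'D_v (fun y : V => y 0 0 : R^o) x = v 0 0.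
    by rewrite derive_coord ?derive_id.
  have dS : differentiable S x.
    rewrite (_ : S = fun y => (y 0 0 : R^o) *: e0 + (Num.sqrt (1 * y 0 1) : R^o) *: e1).
      by apply: differentiableD; exact: differentiableZl.
    by apply/funext.
  have bS : box r (S x) by rewrite /S mul1r; exact: sqrt_box.
  have dfS : differentiable f (S x) by exact: smooth_diff sf bS.
  have nE : \forall y \near x, f (S y) = half_ext f y.
    have : \forall y \near x, 0 < (y : V) 0 1.
      have := @coord_continuous R 1 2 0 1 x; move/cvgr_gt; exact.
    by apply: filterS => y y1; rewrite /half_ext y1 /S mul1r.
  have dc : differentiable (f \o S) x by exact: differentiable_comp.
  split=> [|v]; first exact: near_eq_differentiable nE dc.
  have DS : 'D_v S x = mk2 (v 0 0) (v 0 1 * (2 * Num.sqrt (x 0 1))^-1).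
    apply: row2P; rewrite ?mk2_0 ?mk2_1 -derive_coord //.
      by rewrite -[RHS]D0; congr ('D_v _ x); apply/funext => y; rewrite mk2_0.
    have -> : (fun y => S y 0 1 : R^o) = (fun y : V => Num.sqrt (1 * y 0 1) : R^o).
      by apply/funext => y; rewrite mk2_1.
    by rewrite Ds mulr1 mul1r derive1E; have [_ ->] := is_derive1_sqrt x1.
  rewrite -(near_eq_derive v nE) -[fun y => f (S y)]/(f \o S).
  rewrite deriveE // (diff_comp dS dfS) /= -deriveE // -deriveE // DS.
  rewrite (derive2 _ dfS) mk2_0 mk2_1 fg // /half_ext x1.
  have -> : S x = mk2 (x 0 0) (Num.sqrt (x 0 1)) by rewrite /S mul1r.
  rewrite mk2_1 /GRing.scale /=.
  have s0 : Num.sqrt (x 0 1) != 0 by rewrite gt_eqF // sqrtr_gt0.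
  by field.
- have nE : \forall y \near x, (cst 0 : V -> R^o) y = half_ext f y.
    have : \forall y \near x, (y : V) 0 1 < 0.
      have := @coord_continuous R 1 2 0 1 x; move/cvgr_lt; exact.
    by apply: filterS => y y1; rewrite /half_ext ltNge (ltW y1).
  split=> [|v]; first exact: near_eq_differentiable nE (differentiable_cst _ _).
  by rewrite -(near_eq_derive v nE) derive_cst /half_ext ltNge (ltW x1) /= !mulr0 addr0.
- have hx (h : V -> R^o) : half_ext h x = 0 by rewrite /half_ext -x1 ltxx.
  (* Since f is v^4 times a bounded function, the extension is O(y^2): its
     differential vanishes on the axis. *)
  have [k sk fk] := ff 4%N.
  have /andP[r0 r1] := r01.
  have xr : `|x| < r ^+ 2 := bx.
  have [M M0 HM] : exists2 M : R, 0 <= M & \forall y \near x, `|half_ext f y| <= M * ((y : V) 0 1) ^+ 2.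
    pose q := (`|x| + r ^+ 2) / 2.
    have xq : `|x| < q by rewrite /q; lra.
    have qr : q < r ^+ 2 by rewrite /q; lra.
    have q0 : 0 < q by apply: le_lt_trans xq.
    have sqr_ : Num.max q (Num.sqrt q) < r.
      rewrite gt_max -[X in _ && (_ < X)](ger0_norm (ltW r0)) -sqrtr_sqr ltr_sqrt ?exprn_gt0 // qr andbT.
      by apply: lt_le_trans qr _; rewrite expr2 ler_piMr // ltW.
    have [M M0 HM] := smooth_bounded sk sqr_.
    exists M => //.
    have oq := @open_box R q.
    have := open_nbhs_nbhs (conj oq (xq : box q x)).
    apply: filterS => y /boxE[y0 y1]; rewrite /half_ext; case: ifPn => [yp|_]; last first.
      by rewrite normr0 mulr_ge0 // sqr_ge0.
    have yq : Num.sqrt (y 0 1) < Num.sqrt q.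
      rewrite ltr_sqrt //; exact: le_lt_trans (ler_norm _) y1.
    rewrite fk; last first.
      apply: sqrt_box => //; apply/boxE; split; exact: lt_trans qr.
    rewrite mk2_1 (_ : 4 = 2 * 2)%N // exprM (sqr_sqrtr (ltW yp)) normrM mulrC.
    rewrite (ger0_norm (sqr_ge0 _)); apply: ler_wpM2r; first exact: sqr_ge0.
    apply: HM; apply/norm2_le; rewrite mk2_0 mk2_1 (ger0_norm (sqrtr_ge0 _)) !le_max.
    by rewrite (ltW y0) (ltW yq) orbT.
  have L0 h : lincomb2 0 0 h = 0 :> R by rewrite /lincomb2 !mulr0 addr0.
  have [|d D] := @differentiable_eps _ _ _ (half_ext f) x (lincomb2 0 0) (`|0:R| + `|0:R|)
     (lincomb2_bound 0 0); last first.
    by split=> // v; rewrite D [LHS]L0 !hx !mulr0 addr0.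
  move=> e ep.
  have n1 := near_translate HM.
  have n2 : \forall h \near (0 : V), `|h| < e / (M + 1).
    by apply: near_norm_lt; rewrite divr_gt0 // ltr_wpDl.
  near=> h.
  rewrite [X in `|_ - X|]L0 hx !subr0.
  have h1 : `|half_ext f (h + x)| <= M * (h + x) 0 1 ^+ 2 by near: h.
  have h2 : `|h| < e / (M + 1) by near: h.
  apply: le_trans h1 _; rewrite mxE -x1 addr0 -real_normK ?num_real //.
  have h3 : `|h 0 1| <= `|h| by exact: normrV_ge.
  apply: le_trans (_ : M * `|h| ^+ 2 <= _).
    by apply: ler_wpM2l => //; apply: lerXn2r => //; rewrite nnegrE.
  rewrite expr2 mulrA; apply: ler_wpM2r => //.
  apply: le_trans (_ : (M + 1) * `|h| <= _); first by apply: ler_wpM2r => //; lra.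
  by rewrite mulrC -ler_pdivlMr ?ltr_wpDl // ltW.
Unshelve. all: by end_near. Qed.

(** The partial derivatives of the extension are extensions of flat functions. *)
Lemma smooth_half_ext r (f : V -> R^o) : 0 < r <= 1 -> flat_on r f ->
  smooth_on (box (r ^+ 2)) (half_ext f).
Proof.
move=> r01 + k; elim: k f => [|k IH] f ff; have [g fg Dg] := flat_d1 ff.
  by move=> x bx; apply/differentiable_continuous; exact: (half_ext_diff r01 ff Dg bx).1.
split=> [x bx|v]; first exact: (half_ext_diff r01 ff Dg bx).1.
have ob := @open_box R (r ^+ 2).
have := Ck_add ob (Ck_mul ob (Ck_on_cst (W := R^o) k _ (v 0 0)) (IH _ (flat_d0 ff)))
                  (Ck_mul ob (Ck_on_cst (W := R^o) k _ (v 0 1)) (IH _ fg)).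
by apply: Ck_ext => // x bx; rewrite (half_ext_diff r01 ff Dg bx).2.
Qed.

(** Let [B] be a Borel sum of the expansion of [e] in powers of [v^2]. The
    difference [e (u, v) - B (u, v^2)] is flat and even, so it is the value at
    [(u, v^2)] of the extension above, and [b] is the sum of the two. *)
Theorem whitney_even r (e : V -> R^o) : 0 < r -> smooth_on (box r) e -> even_on r e ->
  exists2 rho : R, 0 < rho <= r & exists2 b : V -> R^o, smooth_on (box rho) b &
    forall x, box rho x -> box rho (mk2 (x 0 0) (x 0 1 ^+ 2)) /\
       e x = b (mk2 (x 0 0) (x 0 1 ^+ 2)).
Proof.
move=> r0 se ee.
pose r' := Num.min (r / 2) 1.
have r'r : r' < r by apply: le_lt_trans (_ : r / 2 < r); [rewrite ge_min lexx|lra].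
have r'1 : r' <= 1 by rewrite ge_min lexx orbT.
have r'0 : 0 < r' by rewrite lt_min ltr01 andbT; lra.
have [B sB HB] := borel_even r'r r'1 se ee.
have ob := @open_box R r'.
pose f x : R^o := e x - B (mk2 (x 0 0) (x 0 1 ^+ 2)).
have ff : flat_on r' f.
  apply: flat_of_bound => //; apply: (smooth_minus ob).
    by apply: smooth_subset se => x bx; exact: lt_trans r'r.
  apply: (@smooth_comp R V V (box r') (box r') (fun x => mk2 (x 0 0) (x 0 1 ^+ 2)) B ob) => //.
  - exact: fin_basis_rV.
  - by move=> x; exact: box_sqr.
  - exact: (smooth_mk2 ob (smooth_fst ob) (smooth_exp 2 ob (smooth_snd ob))).
have fe x : box r' x -> f (mk2 (x 0 0) `|x 0 1|) = f x.
  move=> bx; have [x1|x1] := ger0P (x 0 1); first by rewrite mk2E.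
  rewrite /f !mk2_0 !mk2_1 sqrrN; congr (_ - _).
  by rewrite ee ?mk2E //; exact: lt_trans r'r.
have r'01 : 0 < r' <= 1 by rewrite r'0.
have qr' : r' ^+ 2 <= r' by rewrite expr2 ler_piMr // ltW.
exists (r' ^+ 2); first by rewrite exprn_gt0 //= (le_trans qr') // ltW.
exists (fun x => half_ext f x + B x).
  apply: smooth_add; [exact: open_box|exact: smooth_half_ext|].
  by apply: smooth_subset sB => x bx; exact: lt_le_trans qr'.
move=> x bx; have bx' : box r' x by exact: lt_le_trans qr'.
split; first by apply: box_sqr => //; exact: le_trans qr' _.
have [x1|x1] := eqVneq (x 0 1) 0.
  rewrite /half_ext mk2_1 x1 expr0n /= ltxx add0r.
  have [C HC] := HB 1%N; have := HC x bx'; rewrite x1 normr0 expr1 mulr0 expr0n /=.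
  by rewrite normr_le0 subr_eq0 => /eqP.
have x2 : 0 < x 0 1 ^+ 2 by rewrite exprn_even_gt0.
rewrite /half_ext mk2_0 mk2_1 x2 sqrtr_sqr fe // /f subrK.
by [].
Qed.

End whitney.

(** * Local diffeomorphisms and equivalence of germs *)

Section local_diffeomorphisms.
Context (R : realType).
Implicit Types n : nat.

Lemma ldiff_id n (W : set 'rV[R]_n) : open W -> ldiff W id id.
Proof. by move=> oW; split; rewrite ?image_id //; exact: smooth_on_id. Qed.

Lemma open_preimage n m (A : set 'rV[R]_n) (B : set 'rV[R]_m) (h : 'rV[R]_n -> 'rV[R]_m) :
  open A -> open B -> smooth_on A h -> open (A `&` h @^-1` B).
Proof.
move=> oA oB sh; rewrite openE => x [Ax Bx]; apply: filterI; first exact: open_nbhs_nbhs.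
by apply: (smooth_continuous sh Ax); exact: open_nbhs_nbhs.
Qed.

Lemma ldiff_image n (W A : set 'rV[R]_n) h hi : ldiff W h hi ->
  h @` (W `&` A) = h @` W `&` hi @^-1` A.
Proof.
move=> [_ _ _ _ hK]; apply/seteqP; split=> [_ [x [Wx Ax] <-]|_ [[x Wx <-] /=]].
  by split; [exists x|rewrite /= hK].
by rewrite hK // => Ax; exists x.
Qed.

Lemma ldiff_restrict n (W A : set 'rV[R]_n) h hi : ldiff W h hi -> open A ->
  ldiff (W `&` A) h hi.
Proof.
move=> lh oA; have [oW ohW sh shi hK] := lh.
split; first exact: openI.
- by rewrite (ldiff_image A lh); exact: open_preimage.
- by apply: smooth_subset sh => x [].
- by rewrite (ldiff_image A lh); apply: smooth_subset shi => x [].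
- by move=> x [Wx _]; exact: hK.
Qed.

Lemma ldiff_inv n (W : set 'rV[R]_n) h hi : ldiff W h hi ->
  ldiff (h @` W) hi h /\ hi @` (h @` W) = W.
Proof.
move=> [oW ohW sh shi hK].
have E : hi @` (h @` W) = W.
  by apply/seteqP; split=> [_ [_ [x Wx <-] <-]|x Wx]; rewrite ?hK //;
     exists (h x); [exists x|exact: hK].
by split=> //; split; rewrite ?E // => _ [x Wx <-]; rewrite hK.
Qed.

Lemma ldiff_comp n (W1 W2 : set 'rV[R]_n) h1 h1i h2 h2i x :
  ldiff W1 h1 h1i -> ldiff W2 h2 h2i -> W1 x -> W2 (h1 x) ->
  ldiff (W1 `&` h1 @^-1` W2) (h2 \o h1) (h1i \o h2i).
Proof.
move=> l1 l2 W1x W2x; have [oW1 ohW1 sh1 sh1i h1K] := l1.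
have [oW2 ohW2 sh2 sh2i h2K] := l2.
have E : (h2 \o h1) @` (W1 `&` h1 @^-1` W2) = h2 @` (W2 `&` h1 @` W1).
  apply/seteqP; split=> [_ [y [W1y W2y] <-]|_ [z [W2z [y W1y hz]] <-]].
    by exists (h1 y) => //; split => //; exists y.
  by exists y; [split => //; rewrite /= hz|rewrite /= hz].
have bV := fin_basis_rV R n.
have o := ldiff_restrict l2 ohW1.
split.
- exact: open_preimage.
- by rewrite E; case: o.
- apply: (smooth_comp_mx _ oW2 bV _ _ sh2) => //; first exact: open_preimage.
  + by move=> y [].
  + by apply: smooth_subset sh1 => y [].
- rewrite E; have [_ oh _ so _] := o.
  apply: (smooth_comp_mx oh ohW1 bV _ so sh1i) => _ [z [W2z W1z] <-].
  by rewrite h2K.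
- by move=> y [W1y W2y] /=; rewrite h2K ?h1K.
Qed.

Lemma jacobian_comp n m p (f : 'rV[R]_n -> 'rV[R]_m) (g : 'rV[R]_m -> 'rV[R]_p) x :
  differentiable f x -> differentiable g (f x) ->
  'J (g \o f) x = 'J f x *m 'J g (f x).
Proof.
move=> df dg; apply/row_matrixP => i.
have dc : differentiable (g \o f) x by exact: differentiable_comp.
rewrite (jacobian_row _ dc) row_mul (jacobian_row _ df) -(deriveEjacobian _ dg).
by rewrite (deriveE _ dc) (diff_comp df dg) /= (deriveE _ df) (deriveE _ dg).
Qed.

Lemma derive_comp n (V : normedModType R) (W : normedModType R) (f : V -> 'rV[R]_n) (g : 'rV[R]_n -> W) x v :
  differentiable f x -> differentiable g (f x) ->
  'D_v (g \o f) x = 'D_('D_v f x) g (f x).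
Proof.
move=> df dg; have dc : differentiable (g \o f) x by exact: differentiable_comp.
by rewrite (deriveE _ dc) (diff_comp df dg) /= (deriveE _ df) (deriveE _ dg).
Qed.

Lemma ldiff_jac n (W : set 'rV[R]_n) h hi x : ldiff W h hi -> W x ->
  'J h x *m 'J hi (h x) = 1%:M /\ 'J h x \in unitmx.
Proof.
move=> [oW ohW sh shi hK] Wx.
have dh : differentiable h x by exact: smooth_diff sh Wx.
have dhi : differentiable hi (h x) by apply: smooth_diff shi _; exists x.
have E : 'J h x *m 'J hi (h x) = 1%:M.
  rewrite -jacobian_comp //; apply/row_matrixP => i.
  rewrite jacobian_row; last exact: differentiable_comp.
  rewrite row1 -[RHS](derive_id x); apply: near_eq_derive.
  by have := open_nbhs_nbhs (conj oW Wx); apply: filterS => y Wy; exact: hK.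
by split; [exact: E|exact: (mulmx1_unit E).1].
Qed.

Lemma unitmx_inj n (J : 'M[R]_n) : (forall v : 'rV[R]_n, v *m J = 0 -> v = 0) -> J \in unitmx.
Proof.
move=> J0; rewrite -row_free_unit -kermx_eq0; apply/eqP/row_matrixP => i; rewrite row0.
by apply: J0; rewrite -row_mul mulmx_ker row0.
Qed.

Lemma inverse_function_inj n (A : set 'rV[R]_n) h x0 : open A -> A x0 ->
  smooth_on A h -> (forall v, 'D_v h x0 = 0 -> v = 0) ->
  exists W hinv, [/\ W `<=` A, W x0 & ldiff W h hinv].
Proof.
move=> oA Ax0 sh h0; apply: inverse_function => //; apply: unitmx_inj => v.
by rewrite -deriveEjacobian; [exact: h0|exact: smooth_diff sh Ax0].
Qed.

End local_diffeomorphisms.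

Section germ_equivalence.
Context (R : realType).
Local Notation V2 := 'rV[R]_2.
Local Notation V3 := 'rV[R]_3.
Implicit Types F : V2 -> V3.

(** A-equivalence of germs between coordinate spaces, in the form
    [Phi \o F = F' \o phi], in which equivalences compose directly. *)
Definition germ_equiv F (p : V2) F' (q : V2) : Prop :=
  exists W phi phii W' Phi Phii,
    [/\ @ldiff R 2 W phi phii, W p /\ phi p = q, @ldiff R 3 W' Phi Phii, W' (F p)
      & \forall x \near p, Phi (F x) = F' (phi x)].

Lemma germ_equiv_trans F p F' q F'' s :
  germ_equiv F p F' q -> germ_equiv F' q F'' s -> germ_equiv F p F'' s.
Proof.
move=> [W [h [hi [W' [H [Hi [lh [Wp hp] lH W'p HF]]]]]]].
move=> [W1 [k [ki [W1' [K [Ki [lk [W1q kq] lK W1'q KF]]]]]]].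
have HFp : H (F p) = F' q by rewrite -hp; exact: (nbhs_singleton HF).
exists (W `&` h @^-1` W1), (k \o h), (hi \o ki), (W' `&` H @^-1` W1'), (K \o H), (Hi \o Ki).
split.
- by apply: (ldiff_comp (x := p)) => //; rewrite hp.
- by split; [split=> //; rewrite /= hp|rewrite /= hp].
- by apply: (ldiff_comp (x := F p)) => //; rewrite HFp.
- by split=> //; rewrite /= HFp.
- have ch : {for p, continuous h} by case: lh => _ _ sh _ _; exact: smooth_continuous sh Wp.
  have nK : nbhs (h p) [set y | K (F' y) = F'' (k y)] by rewrite hp.
  by apply: filterS2 HF (ch _ nK) => x /= ->.
Qed.

Lemma germ_equiv_src F p (W : set V2) h hi q : ldiff W h hi -> W q -> h q = p ->
  germ_equiv F p (F \o h) q.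
Proof.
move=> lh Wq hq; have [lhi E] := ldiff_inv lh.
have Wp : (h @` W) p by exists q.
have hK : hi p = q by case: lh => _ _ _ _ hK; rewrite -hq hK.
exists (h @` W), hi, h, setT, id, id; split=> //.
- exact/ldiff_id/openT.
- have [_ oh _ _ _] := lh.
  have := open_nbhs_nbhs (conj oh Wp); apply: filterS => _ [y Wy <-] /=.
  by case: lh => _ _ _ _ ->.
Qed.

Lemma germ_equiv_tgt F p (W : set V3) h hi : ldiff W h hi -> W (F p) ->
  germ_equiv F p (h \o F) p.
Proof.
move=> lh WFp; exists setT, id, id, W, h, hi; split=> //; first exact/ldiff_id/openT.
by apply: (@nearW _ (nbhs p)) => x.
Qed.

Lemma germ_equiv_near F p F' F'' q : (\forall x \near q, F' x = F'' x) ->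
  germ_equiv F p F' q -> germ_equiv F p F'' q.
Proof.
move=> FF [W [h [hi [W' [H [Hi [lh [Wp hp] lH W'p HF]]]]]]].
exists W, h, hi, W', H, Hi; split=> //.
have ch : {for p, continuous h} by case: lh => _ _ sh _ _; exact: smooth_continuous sh Wp.
have nK : nbhs (h p) [set y | F' y = F'' y] by rewrite hp.
by apply: filterS2 HF (ch _ nK) => x -> /= ->.
Qed.

End germ_equivalence.

(** * Determinants in space, division by the square of a coordinate *)

Section space.
Context (R : realType).
Local Notation V2 := 'rV[R]_2.
Local Notation V3 := 'rV[R]_3.
Local Notation i2 := (ord_max : 'I_3).

Definition mk3 (a b c : R) : V3 := \row_(k < 3) [:: a; b; c]`_k.

Lemma mk3_0 a b c : mk3 a b c 0 0 = a. Proof. by rewrite mxE. Qed.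
Lemma mk3_1 a b c : mk3 a b c 0 1 = b. Proof. by rewrite mxE. Qed.
Lemma mk3_2 a b c : mk3 a b c 0 i2 = c. Proof. by rewrite mxE. Qed.
Definition mk3E := (mk3_0, mk3_1, mk3_2).

Lemma row3P (x y : V3) : x 0 0 = y 0 0 -> x 0 1 = y 0 1 -> x 0 i2 = y 0 i2 -> x = y.
Proof.
move=> h0 h1 h2; apply/rowP => -[[|[|[|//]]] lt3].
- by rewrite (_ : Ordinal lt3 = 0) //; exact: val_inj.
- by rewrite (_ : Ordinal lt3 = 1) //; exact: val_inj.
- by rewrite (_ : Ordinal lt3 = i2) //; exact: val_inj.
Qed.

Lemma mk3_eta (x : V3) : mk3 (x 0 0) (x 0 1) (x 0 i2) = x.
Proof. by apply: row3P; rewrite mk3E. Qed.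

Lemma smooth_mk3 (W : normedModType R) (A : set W) (f g h : W -> R^o) : open A ->
  smooth_on A f -> smooth_on A g -> smooth_on A h ->
  smooth_on A (fun y => mk3 (f y) (g y) (h y)).
Proof.
move=> oA sf sg sh; apply/smooth_mxP => // i -[[|[|[|//]]] j2].
- by under eq_fun do rewrite mxE /=.
- by under eq_fun do rewrite mxE /=.
- by under eq_fun do rewrite mxE /=.
Qed.

(** The expanded determinant, a polynomial in the entries of its arguments. *)
Definition det3 (a b c : V3) : R :=
  a 0 0 * (b 0 1 * c 0 i2 - b 0 i2 * c 0 1)
  - a 0 1 * (b 0 0 * c 0 i2 - b 0 i2 * c 0 0)
  + a 0 i2 * (b 0 0 * c 0 1 - b 0 1 * c 0 0).

Lemma det3_det (a b c : V3) : \det (\matrix_(k < 3) [:: a; b; c]`_k) = det3 a b c.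
Proof.
rewrite (expand_det_row _ 0) !big_ord_recl big_ord0 /cofactor.
rewrite !(expand_det_row _ 0) !big_ord_recl !big_ord0 /cofactor !det_mx11 !mxE /=.
rewrite -(mk3_eta a) -(mk3_eta b) -(mk3_eta c) /det3 !mk3E !mxE /=.
by rewrite !expr0 /bump /= expr1 expr2; ring.
Qed.

Lemma det3_scale2 (a b c : V3) (t : R) : det3 a (t *: b) c = t * det3 a b c.
Proof. by rewrite /det3 !mxE; ring. Qed.

Lemma det3_comb (a b c : V3) (s t u w : R) :
  det3 (s *: a + t *: b) (u *: a + w *: b) c = (s * w - t * u) * det3 a b c.
Proof. by rewrite /det3 !mxE; ring. Qed.

(** Cramer's rule: the determinant with one row replaced by the combination is a
    coefficient times [det3 a b c]. *)
Lemma det3_free (a b c : V3) (s t w : R) : det3 a b c != 0 ->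
  s *: a + t *: b + w *: c = 0 -> [/\ s = 0, t = 0 & w = 0].
Proof.
move=> d0 E.
have e i : s * a 0 i + t * b 0 i + w * c 0 i = 0.
  by have := congr1 (fun v : V3 => v 0 i) E; rewrite !mxE.
have h0 := e 0; have h1 := e 1; have h2 := e i2.
have S : s * det3 a b c = 0.
  have -> : s * det3 a b c = det3 (s *: a + t *: b + w *: c) b c.
    by rewrite /det3 !mxE; ring.
  by rewrite E /det3 !mxE; ring.
have T : t * det3 a b c = 0.
  have -> : t * det3 a b c = det3 a (s *: a + t *: b + w *: c) c.
    by rewrite /det3 !mxE; ring.
  by rewrite E /det3 !mxE; ring.
have W : w * det3 a b c = 0.
  have -> : w * det3 a b c = det3 a b (s *: a + t *: b + w *: c).
    by rewrite /det3 !mxE; ring.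
  by rewrite E /det3 !mxE; ring.
by split; apply/eqP; [move: S|move: T|move: W] => /eqP; rewrite mulf_eq0 (negPf d0) orbF.
Qed.

Lemma smooth_det3 (V : normedModType R) (A : set V) (f g h : V -> V3) : open A ->
  smooth_on A f -> smooth_on A g -> smooth_on A h ->
  smooth_on A (fun x => det3 (f x) (g x) (h x) : R^o).
Proof.
move=> oA sf sg sh; rewrite /det3.
by do ?[apply: smooth_add => //|apply: smooth_opp => //|apply: smooth_mul => //];
  exact: smooth_coord.
Qed.

Lemma smooth_scale (V : normedModType R) (A : set V) m n (f : V -> R^o) (g : V -> 'M[R]_(m, n)) :
  open A -> smooth_on A f -> smooth_on A g -> smooth_on A (fun x => f x *: g x).
Proof.
move=> oA sf sg; apply/smooth_mxP => // i j; under eq_fun do rewrite mxE.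
by apply: smooth_mul => //; exact: smooth_coord.
Qed.

Lemma derive_affine (V W : normedModType R) (f : V -> W) x v w :
  (forall h : R, f (h *: v + x) = f x + h *: w) -> 'D_v f x = w.
Proof.
move=> fE; apply: cvg_lim => //.
have -> : (fun h => h^-1 *: ((f \o shift x) (h *: v) - f x)) = (fun h => (h^-1 * h) *: w).
  by apply/funext => h /=; rewrite fE addrC addKr scalerA.
apply: (@cvg_trans _ ((fun=> w) @ (0 : R)^')); last exact: cvg_cst.
apply: near_eq_cvg; near=> h; rewrite mulVf ?scale1r //.
by near: h; exact: nbhs_dnbhs_neq.
Unshelve. all: by end_near. Qed.

End space.

Section plane_factorization.
Context (R : realType).
Local Notation V2 := 'rV[R]_2.
Local Notation e0 := (delta_mx 0 0 : V2).
Local Notation e1 := (delta_mx 0 1 : V2).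
Implicit Types (x y v : V2) (r : R).

Lemma mk2_00 : mk2 0 0 = 0 :> V2.
Proof. by apply: row2P; rewrite !mxE. Qed.

Lemma box_nbhs (A : set V2) : nbhs (0 : V2) A -> exists2 r : R, 0 < r & box r `<=` A.
Proof.
move=> /nbhs_ballP[r /= r0 rA]; exists r => // x xr; apply: rA.
by rewrite -ball_normE /ball_ /= sub0r normrN.
Qed.

Lemma box0 r : 0 < r -> box r (0 : V2).
Proof. by move=> r0; rewrite /box /= normr0. Qed.

Lemma box_le r s : r <= s -> box r `<=` (box s : set V2).
Proof. by move=> rs x xr; exact: lt_le_trans rs. Qed.

Lemma near_box (P : V2 -> Prop) r : 0 < r -> (forall x, box r x -> P x) -> \forall x \near (0 : V2), P x.
Proof.
by move=> r0 H; apply: filterS (open_nbhs_nbhs (conj (@open_box R r) (box0 r0))).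
Qed.

Lemma derive_mul_snd (k : V2 -> R^o) x v : differentiable k x ->
  'D_v (fun y => y 0 1 * k y : R^o) x = x 0 1 * 'D_v k x + v 0 1 * k x.
Proof.
move=> dk; have ds : differentiable (fun y : V2 => y 0 1 : R^o) x.
  exact: (smooth_diff (smooth_snd openT)).
have := deriveM (diff_derivable (v := v) ds) (diff_derivable (v := v) dk).
by rewrite derive_coord // derive_id [k x *: _]mulrC.
Qed.

(** The quotient by the second coordinate takes the value [h_v] on the axis, so it
    vanishes there and can be divided again. *)
Lemma hadamard2 (h : V2 -> R^o) r : smooth_on (box r) h ->
  (forall u : R, `|u| < r -> h (mk2 u 0) = 0) -> (forall u : R, `|u| < r -> 'D_e1 h (mk2 u 0) = 0) ->
  exists2 k : V2 -> R^o, smooth_on (box r) k & forall x, box r x -> h x = x 0 1 ^+ 2 * k x.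
Proof.
move=> sh h0 h1; have [k sk hk] := hadamard sh h0.
have ob := @open_box R r.
have [u ur|k' sk' kk'] := hadamard sk.
  have bu := box_axis ur.
  have nh : \forall y \near mk2 u 0, h y = y 0 1 * k y.
    by apply: filterS (open_nbhs_nbhs (conj ob bu)) => y; exact: hk.
  have := h1 u ur; rewrite (near_eq_derive e1 nh) derive_mul_snd; last exact: smooth_diff sk bu.
  by rewrite mk2_1 mul0r add0r mxE /= mul1r.
by exists k' => // x bx; rewrite hk // kk' // mulrA expr2.
Qed.

Lemma hadamard2_vec n (h : V2 -> 'rV[R]_n) r : smooth_on (box r) h ->
  (forall u : R, `|u| < r -> h (mk2 u 0) = 0) -> (forall u : R, `|u| < r -> 'D_e1 h (mk2 u 0) = 0) ->
  exists2 k : V2 -> 'rV[R]_n, smooth_on (box r) k & forall x, box r x -> h x = x 0 1 ^+ 2 *: k x.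
Proof.
move=> sh h0 h1; have ob := @open_box R r.
have /choice[k Hk] : forall j : 'I_n, exists k : V2 -> R^o, smooth_on (box r) k /\
    forall x, box r x -> h x 0 j = x 0 1 ^+ 2 * k x.
  move=> j; have [||k sk hk] := hadamard2 (smooth_coord 0 j ob sh).
  - by move=> u ur; rewrite h0 // mxE.
  - move=> u ur; rewrite derive_coord ?h1 ?mxE //.
    by apply: smooth_diff sh _; exact: box_axis.
  - by exists k.
exists (fun x => \row_j k j x).
  apply/smooth_mxP => // i j; under eq_fun do rewrite mxE; exact: (Hk j).1.
by move=> x bx; apply/rowP => j; rewrite !mxE (Hk j).2.
Qed.

Lemma derive_snd_sqr n (F K : V2 -> 'rV[R]_n) r : smooth_on (box r) F -> smooth_on (box r) K ->
  (forall x, box r x -> F x = F (mk2 (x 0 0) 0) + x 0 1 ^+ 2 *: K x) ->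
  forall x, box r x -> 'D_e1 F x = x 0 1 *: (2 *: K x + x 0 1 *: 'D_e1 K x).
Proof.
move=> sF sK FK x bx; have ob := @open_box R r.
apply/rowP => i; rewrite -derive_coord; last exact: smooth_diff sF bx.
have sKi := smooth_coord 0 i ob sK.
have s1 : smooth_on (box r) (fun y => y 0 1 * K y 0 i : R^o).
  exact: (smooth_mul ob (smooth_snd ob) sKi).
have s2 : smooth_on (box r) (fun y => y 0 1 * (y 0 1 * K y 0 i) : R^o).
  exact: (smooth_mul ob (smooth_snd ob) s1).
have nE : \forall y \near x, (F y 0 i : R^o) = F (mk2 (y 0 0) 0) 0 i + y 0 1 * (y 0 1 * K y 0 i).
  apply: filterS (open_nbhs_nbhs (conj ob bx)) => y by_.
  by rewrite {1}FK // !mxE expr2 mulrA.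
rewrite (near_eq_derive e1 nE).
have sa : smooth_on (box r) (fun y => F (mk2 (y 0 0) 0) 0 i : R^o).
  apply: (smooth_coord 0 i ob); apply: (smooth_comp_mx ob ob (fin_basis_rV R 2) _ _ sF).
    by move=> y /boxE[y0 _]; exact: box_axis.
  exact: (smooth_mk2 ob (smooth_fst ob) (smooth_cst _ _)).
rewrite deriveD; [|exact/diff_derivable/(smooth_diff sa)|exact/diff_derivable/(smooth_diff s2)].
rewrite (@derive_affine _ _ _ _ _ _ 0) => [|h]; last first.
  by rewrite scaler0 addr0 !mxE /= mulr0 add0r.
rewrite (derive_mul_snd (k := fun y => y 0 1 * K y 0 i)); last exact: smooth_diff s1 bx.
rewrite (derive_mul_snd (k := fun y => K y 0 i)); last exact: smooth_diff sKi bx.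
rewrite derive_coord; last exact: smooth_diff sK bx.
by rewrite !mxE /=; ring.
Qed.

Lemma derive2_snd_sqr (h k : V2 -> R^o) r : 0 < r -> smooth_on (box r) k ->
  (forall x, box r x -> h x = x 0 1 ^+ 2 * k x) -> 'D_e1 ('D_e1 h) 0 = 2 * k 0.
Proof.
move=> r0 sk hk; have ob := @open_box R r.
pose m x : R^o := 2 * k x + x 0 1 * 'D_e1 k x.
have sD := smooth_derive e1 sk.
have sm : smooth_on (box r) m.
  by apply: (smooth_add ob (smooth_mul ob (smooth_cst _ _) sk) (smooth_mul ob (smooth_snd ob) sD)).
have Dh x : box r x -> 'D_e1 h x = x 0 1 * m x.
  move=> bx.
  have nh : \forall y \near x, h y = y 0 1 * (y 0 1 * k y).
    by apply: filterS (open_nbhs_nbhs (conj ob bx)) => y by_; rewrite hk // mulrA expr2.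
  have sk1 : smooth_on (box r) (fun y => y 0 1 * k y : R^o).
    exact: (smooth_mul ob (smooth_snd ob) sk).
  rewrite (near_eq_derive e1 nh) (derive_mul_snd (k := fun y => y 0 1 * k y)); last exact: smooth_diff sk1 bx.
  rewrite derive_mul_snd; last exact: smooth_diff sk bx.
  by rewrite mxE /= /m; ring.
have nD : \forall x \near (0 : V2), 'D_e1 h x = x 0 1 * m x by exact: near_box r0 Dh.
rewrite (near_eq_derive e1 nD) derive_mul_snd; last by apply: smooth_diff sm (box0 r0).
by rewrite /m !mxE /= !mul0r add0r addr0 mul1r.
Qed.

(** Whitney's theorem for the even part of [f] and for the odd part divided by the
    second coordinate. *)
Lemma even_odd_whitney r (f : V2 -> R^o) : 0 < r -> smooth_on (box r) f ->
  exists2 rho : R, 0 < rho & exists b c : V2 -> R^o,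
    [/\ smooth_on (box rho) b, smooth_on (box rho) c
      & forall x, box rho x -> box rho (mk2 (x 0 0) (x 0 1 ^+ 2)) /\
        f x = b (mk2 (x 0 0) (x 0 1 ^+ 2)) + x 0 1 * c (mk2 (x 0 0) (x 0 1 ^+ 2))].
Proof.
move=> r0 sf; have ob := @open_box R r.
pose fe x : R^o := 2^-1 * (f x + f (flip x)).
pose fo x : R^o := 2^-1 * (f x - f (flip x)).
have sfe : smooth_on (box r) fe.
  exact: (smooth_mul ob (smooth_cst _ _) (smooth_add ob sf (smooth_flip sf))).
have sfo : smooth_on (box r) fo.
  exact: (smooth_mul ob (smooth_cst _ _) (smooth_minus ob sf (smooth_flip sf))).
have efe : even_on r fe by move=> u w _; rewrite /fe -flip_mk2 flipK addrC.
have [u ur|k sk fk] := hadamard sfo.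
  by rewrite /fo flip_mk2 oppr0 subrr mulr0.
have ek : even_on r k.
  move=> u w buw; suff H x : box r x -> k (flip x) - k x = 0.
    by have /eqP := H _ buw; rewrite flip_mk2 subr_eq0 => /eqP.
  apply: (snd_cancel (f := fun x => k (flip x) - k x) ob).
    exact: (smooth_minus ob (smooth_flip sk) sk).
  move=> y by_; have := fk _ by_; have := fk _ (box_flip by_).
  rewrite /fo flipK mk2_1; lra.
have [r1 /andP[r10 r1r] [b sb eb]] := whitney_even r0 sfe efe.
have [r2 /andP[r20 r2r] [c sc ec]] := whitney_even r0 sk ek.
pose rho := Num.min (Num.min r1 r2) 1.
have rho0 : 0 < rho by rewrite !lt_min r10 r20 ltr01.
have l1 : rho <= r1 by rewrite !ge_min lexx.
have l2 : rho <= r2 by rewrite !ge_min lexx orbT.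
have l3 : rho <= 1 by rewrite ge_min lexx orbT.
exists rho => //; exists b, c; split.
- exact: smooth_subset (box_le l1) sb.
- exact: smooth_subset (box_le l2) sc.
move=> x bx; split; first exact: box_sqr.
have [_ <-] := eb x (box_le l1 bx); have [_ <-] := ec x (box_le l2 bx).
rewrite -fk; last exact: box_le (le_trans l1 r1r) _ bx.
by rewrite /fe /fo; field.
Qed.

End plane_factorization.

(** * Coordinates adapted to a transversal null direction *)

Section adapted.
Context (R : realType).
Local Notation V2 := 'rV[R]_2.
Local Notation V3 := 'rV[R]_3.
Local Notation i2 := (ord_max : 'I_3).
Local Notation e0 := (delta_mx 0 0 : V2).
Local Notation e1 := (delta_mx 0 1 : V2).
Implicit Types (x y v : V2) (r : R).

(** By transversality [alpha (s, v) = gamma s + v eta s] is a coordinate system at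
    the origin. Along [v = 0] the [v]-derivative of [F1 = F \o alpha] vanishes, so
    Hadamard's lemma can be used twice.

    Let [mu] be the area density of [F] and [j] the Jacobian determinant of
    [alpha]. Then [j * (mu \o alpha) = v * kappa], where [kappa] is, at the
    origin, twice the determinant in the conclusion; if it vanished, the
    differential of [mu] at [p] would vanish. *)
Lemma adapted_coordinates (F nu : V2 -> V3) (U : set V2) (p : V2) (eps : R)
    (gamma eta : R -> V2) :
  0 < eps -> smooth_on `]-eps, eps[ (gamma : R^o -> V2) ->
  smooth_on `]-eps, eps[ (eta : R^o -> V2) -> gamma 0 = p ->
  open U -> smooth_on U F -> smooth_on U nu ->
  (forall t, -eps < t < eps -> U (gamma t) /\ 'D_(eta t) F (gamma t) = 0) ->
  (forall a b : R, a *: eta 0 + b *: derive1 gamma 0 = 0 -> a = 0 /\ b = 0) ->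
  (exists v, 'D_v (fun x => det3 ('D_e0 F x) ('D_e1 F x) (nu x) : R^o) p != 0) ->
  exists (F1 K : V2 -> V3) (r : R) (nu0 : V3),
   [/\ 0 < r /\ germ_equiv F p F1 0, smooth_on (box r) F1, smooth_on (box r) K,
       forall x, box r x -> F1 x = F1 (mk2 (x 0 0) 0) + x 0 1 ^+ 2 *: K x
     & det3 ('D_e0 F1 0) (K 0) nu0 != 0].
Proof.
move=> eps0 sg se g0 oU sF snu Fnull free [v0 Dv0].
have Up : U p by rewrite -g0; apply: (Fnull 0 _).1; rewrite oppr_lt0 eps0.
pose I : set R^o := `]-eps, eps[.
have oI : open I by exact: interval_open.
pose A : set V2 := [set x | I (x 0 0)].
have oA : open A.
  apply: (@open_comp _ _ (fun x : V2 => x 0 0 : R^o) I) => // x _.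
  exact: coord_continuous.
have IE t : I t <-> -eps < t < eps by rewrite /I /= in_itv.
pose alpha x : V2 := gamma (x 0 0) + x 0 1 *: eta (x 0 0).
have sfst (h : R^o -> V2) : smooth_on I h -> smooth_on A (fun x => h (x 0 0)).
  move=> sh; apply: (smooth_comp_mx oA oI (fin_basis_scalar R) _ (smooth_fst oA) sh).
  by move=> x.
have salpha : smooth_on A alpha.
  exact: (smooth_add oA (sfst _ sg) (smooth_scale oA (smooth_snd oA) (sfst _ se))).
have A0 : A 0 by apply/IE; rewrite mxE oppr_lt0 eps0.
have alpha_axis s : alpha (mk2 s 0) = gamma s.
  by rewrite /alpha mk2_0 mk2_1 scale0r addr0.
have alpha0 : alpha 0 = p by rewrite (_ : 0 = mk2 0 0) ?alpha_axis //; apply: row2P; rewrite !mxE.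
have D0alpha : 'D_e0 alpha 0 = derive1 gamma 0.
  have E : (fun h => h^-1 *: ((alpha \o shift 0) (h *: e0) - alpha 0)) =
      (fun h => h^-1 *: (gamma (h + 0) - gamma 0)).
    apply/funext => h /=.
    rewrite (_ : h *: e0 + 0 = mk2 (h + 0) 0); last by apply: row2P; rewrite !mxE /= ?mulr1 ?mulr0 ?addr0.
    by rewrite alpha_axis alpha0 -g0.
  by rewrite /derive E.
have D1alpha x : 'D_e1 alpha x = eta (x 0 0).
  apply: derive_affine => h; rewrite /alpha !mxE /= mulr0 mulr1 add0r.
  by rewrite (addrC h) scalerDl addrA.
have [W [alphai [WA W0 la]]] : exists W hinv, [/\ W `<=` A `&` alpha @^-1` U, W 0 & ldiff W alpha hinv].
  apply: inverse_function_inj.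
  - exact: open_preimage.
  - by split=> //=; rewrite alpha0.
  - by apply: smooth_subset salpha => x [].
  - move=> v; rewrite derive2; last exact: smooth_diff salpha A0.
    rewrite D0alpha D1alpha mxE addrC => /free[v1 v0'].
    by apply: row2P; rewrite !mxE.
have [oW oaW saW _ _] := la.
pose F1 : V2 -> V3 := F \o alpha.
have [r r0 rW] := box_nbhs (open_nbhs_nbhs (conj oW W0)).
have ob := @open_box R r.
have bA x : box r x -> A x by move=> /rW/WA[].
have bU x : box r x -> U (alpha x) by move=> /rW/WA[].
have bV2 := fin_basis_rV R 2.
have salb : smooth_on (box r) alpha by exact: smooth_subset salpha.
have sF1 : smooth_on (box r) F1 by exact: (smooth_comp_mx ob oU bV2 bU salb sF).
have dF1 x v : box r x -> 'D_v F1 x = 'D_('D_v alpha x) F (alpha x).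
  move=> bx; apply: derive_comp; first exact: smooth_diff salb bx.
  exact: smooth_diff sF (bU _ bx).
have D1F1 u : `|u| < r -> 'D_e1 F1 (mk2 u 0) = 0.
  move=> ur; have bu := box_axis ur; rewrite dF1 // D1alpha mk2_0 alpha_axis.
  by apply: (Fnull u _).2; apply/IE; have := bA _ bu; rewrite /A /= mk2_0.
pose axis x : V2 := mk2 (x 0 0) 0.
have baxis x : box r x -> box r (axis x) by move=> /boxE[x0 _]; exact: box_axis.
have saxis : smooth_on (box r) axis by exact: (smooth_mk2 ob (smooth_fst ob) (smooth_cst _ _)).
have sF1a : smooth_on (box r) (F1 \o axis) by exact: (smooth_comp_mx ob ob bV2 baxis saxis sF1).
have [u ur|u ur|K sK FK] := hadamard2_vec (h := fun x => F1 x - F1 (axis x)) (smooth_minus ob sF1 sF1a).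
- by rewrite /axis mk2_0 subrr.
- have bu := box_axis ur.
  rewrite deriveB; [|exact/diff_derivable/(smooth_diff sF1)|exact/diff_derivable/(smooth_diff sF1a)].
  rewrite D1F1 // sub0r (@derive_affine _ _ _ _ _ _ 0) ?oppr0 // => h.
  by rewrite scaler0 addr0 /axis /= !mxE /= mulr0 add0r.
have FK' x : box r x -> F1 x = F1 (axis x) + x 0 1 ^+ 2 *: K x.
  by move=> bx; rewrite -FK // addrC subrK.
exists F1, K, r, (nu p); split=> //.
  split=> //; apply: (germ_equiv_src F la W0); exact: alpha0.
(* Both sides of j * (mu o alpha) = v * kappa are differentiated at the origin,
   under the assumption kappa(0) = 0. *)
apply/negP => /eqP det0.
move/negP: Dv0; apply; apply/eqP.
set mu := fun x => _ : R^o.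
have smu : smooth_on U mu by apply: smooth_det3 => //; exact: smooth_derive.
pose j x : R^o := ('D_e0 alpha x) 0 0 * ('D_e1 alpha x) 0 1 - ('D_e0 alpha x) 0 1 * ('D_e1 alpha x) 0 0.
have sj : smooth_on (box r) j.
  have s0 := smooth_derive e0 salb; have s1 := smooth_derive e1 salb.
  by apply: (smooth_minus ob); apply: (smooth_mul ob); exact: smooth_coord.
pose kappa x : R^o := det3 ('D_e0 F1 x) (2 *: K x + x 0 1 *: 'D_e1 K x) (nu (alpha x)).
have snua : smooth_on (box r) (nu \o alpha) by exact: (smooth_comp_mx ob oU bV2 bU salb snu).
have sk2 : smooth_on (box r) (fun x => 2 *: K x + x 0 1 *: 'D_e1 K x).
  apply: (smooth_add ob (smooth_scale ob (smooth_cst _ _) sK)).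
  exact: (smooth_scale ob (smooth_snd ob) (smooth_derive e1 sK)).
have skappa : smooth_on (box r) kappa.
  exact: (smooth_det3 ob (smooth_derive e0 sF1) sk2 snua).
have D1K := derive_snd_sqr sF1 sK FK'.
have jmu x : box r x -> j x * mu (alpha x) = x 0 1 * kappa x.
  move=> bx.
  have dFx : differentiable F (alpha x) by exact: smooth_diff sF (bU _ bx).
  have -> : x 0 1 * kappa x = det3 ('D_e0 F1 x) ('D_e1 F1 x) (nu (alpha x)).
    by rewrite (D1K _ bx) /kappa det3_scale2.
  have E0 := etrans (dF1 _ e0 bx) (derive2 ('D_e0 alpha x) dFx).
  have E1 := etrans (dF1 _ e1 bx) (derive2 ('D_e1 alpha x) dFx).
  by rewrite E0 E1 det3_comb.
have kappa0 : kappa 0 = 0.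
  by rewrite /kappa alpha0 mxE scale0r addr0 det3_scale2 det0 mulr0.
have j0 : j 0 != 0.
  apply/negP => /eqP jz.
  have [_ Ju] := ldiff_jac la W0.
  have da : differentiable alpha (0 : V2) by exact: smooth_diff salpha A0.
  move: jz; rewrite /j D1alpha mxE D0alpha => jz.
  set a := derive1 gamma 0 in jz free *; set b := eta 0 in jz free *.
  have [|h1 h2] := free (a 0 1) (- b 0 1).
    by apply: row2P; rewrite !mxE; lra.
  have [|h3 h4] := free (a 0 0) (- b 0 0).
    by apply: row2P; rewrite !mxE; lra.
  have [|h _] := free 1 0; last by move: h => /eqP; rewrite oner_eq0.
  by apply: row2P; rewrite !mxE; lra.
have mup : mu p = 0.
  have := jmu 0 (box0 r0); rewrite alpha0 mxE mul0r => /eqP.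
  by rewrite mulf_eq0 (negPf j0) => /eqP.
have Dmua v : 'D_v (mu \o alpha) 0 = 0.
  have sma : smooth_on (box r) (mu \o alpha) by exact: (smooth_comp ob bV2 bU salb smu).
  have dma := smooth_diff sma (box0 r0); have dj := smooth_diff sj (box0 r0).
  have dk := smooth_diff skappa (box0 r0).
  have nE : \forall x \near (0 : V2), (j * (mu \o alpha)) x = x 0 1 * kappa x.
    exact: near_box r0 jmu.
  have := near_eq_derive v nE.
  rewrite (derive_mul_snd (k := kappa)) // kappa0 mxE mul0r mulr0 addr0.
  rewrite deriveM; [|exact: diff_derivable|exact: diff_derivable].
  rewrite /= alpha0 mup scale0r addr0 => /eqP.
  by rewrite scaler_eq0 (negPf j0) => /eqP.
have [_ Ju] := ldiff_jac la W0.
have := Dmua (v0 *m invmx ('J alpha 0)).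
rewrite derive_comp; [|exact: smooth_diff salpha A0|by rewrite alpha0; exact: smooth_diff smu Up].
rewrite deriveEjacobian; last exact: smooth_diff salpha A0.
by rewrite mulmxKV // alpha0.
Qed.

End adapted.

(** * The normal form (u, v^2, v^3 c(u, v^2)) *)

Section normal_form.
Context (R : realType).
Local Notation V2 := 'rV[R]_2.
Local Notation V3 := 'rV[R]_3.
Local Notation i2 := (ord_max : 'I_3).
Local Notation e0 := (delta_mx 0 0 : V2).
Local Notation e1 := (delta_mx 0 1 : V2).
Implicit Types (x y v : V2) (r : R).

(** For [c = u] this is the cuspidal cross cap, for [c = 1] the cuspidal edge. *)
Definition cross_form (c : V2 -> R^o) x : V3 :=
  mk3 (x 0 0) (x 0 1 ^+ 2) (x 0 1 ^+ 3 * c (mk2 (x 0 0) (x 0 1 ^+ 2))).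

Lemma Ck_sqrt k : Ck_on k [set t : R^o | 0 < t] (Num.sqrt : R^o -> R^o).
Proof.
have oP : open [set t : R^o | 0 < t] by exact: open_gt.
elim: k => [|k IH].
  by move=> t _; exact: sqrt_continuous.
have ds (t : R^o) : 0 < t -> differentiable (Num.sqrt : R^o -> R^o) t.
  by move=> t0; apply/derivable1_diffP; have [] := is_derive1_sqrt t0.
split=> [t t0|v]; first exact: ds.
have D : Ck_on k [set t : R^o | 0 < t] (fun t : R^o => v * (2 * Num.sqrt t)^-1 : R^o).
  apply: (Ck_mul oP (Ck_on_cst (W := R^o) k _ v)).
  apply: (Ck_inv oP) => [t t0|]; first by rewrite mulf_neq0 // gt_eqF // sqrtr_gt0.
  exact: (Ck_mul oP (Ck_on_cst (W := R^o) k _ 2) IH).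
apply: Ck_ext D => // t t0.
have [_ <-] := is_derive1_sqrt (t0 : 0 < (t : R)).
rewrite !deriveE; [|exact: ds|exact: ds].
by rewrite -{2}[v]mulr1; apply/esym; exact: (linear_scale ('d (Num.sqrt : R^o -> R^o) t) v 1).
Qed.

Lemma smooth_sqrt : smooth_on [set t : R^o | 0 < t] (Num.sqrt : R^o -> R^o).
Proof. by move=> k; exact: Ck_sqrt. Qed.

Lemma derive_coordZ n (W : normedModType R) (w : W) i (z v : 'rV[R]_n) :
  differentiable (fun z : 'rV[R]_n => (z 0 i : R^o) *: w) z /\
  'D_v (fun z : 'rV[R]_n => (z 0 i : R^o) *: w) z = v 0 i *: w.
Proof.
have dc : differentiable (fun z : 'rV[R]_n => z 0 i : R^o) z by apply: diff_coord.
have d := differentiableZl w dc; split=> //.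
rewrite deriveE // (diffZl w dc) /= -deriveE // derive_coord //.
by rewrite derive_id.
Qed.

Lemma shear_ldiff rho (b : V2 -> R^o) : smooth_on (box rho) b ->
  ldiff [set z : V3 | box rho (mk2 (z 0 0) (z 0 1))]
    (fun z => mk3 (z 0 0) (z 0 1) (z 0 i2 - z 0 1 * b (mk2 (z 0 0) (z 0 1))))
    (fun z => mk3 (z 0 0) (z 0 1) (z 0 i2 + z 0 1 * b (mk2 (z 0 0) (z 0 1)))).
Proof.
move=> sb; set W := [set z : V3 | _]; set h := fun z => _; set hi := fun z => _.
have sT : smooth_on setT (fun z : V3 => mk2 (z 0 0) (z 0 1)).
  by apply: (smooth_mk2 openT); apply: (smooth_coord _ _ openT); exact: smooth_on_id.
have ob := @open_box R rho.
have oW : open W.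
  have := open_preimage openT ob sT; rewrite setTI; apply.
have sc i : smooth_on W (fun z : V3 => z 0 i : R^o).
  by apply: (smooth_coord _ _ oW); exact: smooth_on_id.
have sbW : smooth_on W (fun z => b (mk2 (z 0 0) (z 0 1)) : R^o).
  apply: (smooth_comp oW (fin_basis_rV R 2) _ _ sb); first by move=> z.
  exact: smooth_subset sT.
have hK z : hi (h z) = z by rewrite /h /hi !mk3E subrK mk3_eta.
have hiK z : h (hi z) = z by rewrite /h /hi !mk3E addrK mk3_eta.
have hW : h @` W = W.
  apply/seteqP; split=> [_ [z Wz <-]|z Wz]; first by rewrite /W /h /= !mk3E.
  by exists (hi z) => //; rewrite /W /hi /= !mk3E.
split; rewrite ?hW //.
- by apply: (smooth_mk3 oW (sc 0) (sc 1)); apply: (smooth_minus oW (sc i2)); exact: (smooth_mul oW (sc 1)).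
- by apply: (smooth_mk3 oW (sc 0) (sc 1)); apply: (smooth_add oW (sc i2)); exact: (smooth_mul oW (sc 1)).
Qed.

(** Write [beta (u, v) = b (u, v^2) + v c (u, v^2)]. The shear
    [(x, y, z) |-> (x, y, z - y b (x, y))] of the target removes the even part. *)
Lemma even_odd_normal_form (beta : V2 -> R^o) r : 0 < r -> smooth_on (box r) beta ->
  exists2 rho : R, 0 < rho & exists2 c : V2 -> R^o, smooth_on (box rho) c &
    germ_equiv (fun x => mk3 (x 0 0) (x 0 1 ^+ 2) (x 0 1 ^+ 2 * beta x)) 0 (cross_form c) 0.
Proof.
move=> r0 sb; have [rho rho0 [b [c [sb' sc bc]]]] := even_odd_whitney r0 sb.
exists rho => //; exists c => //.
set F := fun x => _.
have lT := shear_ldiff sb'.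
apply: germ_equiv_near (germ_equiv_tgt (p := 0) (F := F) lT _); last first.
  rewrite /F /= !mk3E !mxE expr0n /= mk2_00; exact: box0.
apply: near_box rho0 _ => x bx /=; rewrite /F !mk3E /cross_form.
have [_ ->] := bc x bx; congr mk3.
by rewrite mulrDr addrAC subrr add0r mulrA -exprSr.
Qed.

(** The independence of [F1_u], [K] and [nu0] at the origin makes
    [Psi (x, y, z) = F1 (x, 0) + y K 0 + z nu0] a local diffeomorphism. In these
    target coordinates the map is [(u, 0, 0) + v^2 L (u, v)], and the second
    component of [L] is 1 at the origin because [Psi] sends the second axis to
    [K 0]. The first component of the map and [v] times the square root of the
    second component of [L] are then source coordinates in which the map is
    [(u, v^2, v^2 beta (u, v))]. *)
Lemma normal_form (F1 K : V2 -> V3) r (nu0 : V3) : 0 < r ->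
  smooth_on (box r) F1 -> smooth_on (box r) K ->
  (forall x, box r x -> F1 x = F1 (mk2 (x 0 0) 0) + x 0 1 ^+ 2 *: K x) ->
  det3 ('D_e0 F1 0) (K 0) nu0 != 0 ->
  exists2 rho : R, 0 < rho & exists2 c : V2 -> R^o, smooth_on (box rho) c &
    germ_equiv F1 0 (cross_form c) 0.
Proof.
move=> r0 sF1 sK FK det0; have ob := @open_box R r.
have bV2 := fin_basis_rV R 2; have bV3 := fin_basis_rV R 3.
have b0 := box0 r0.
pose A : set V3 := [set z | box r (mk2 (z 0 0) 0)].
have sax : smooth_on setT (fun z : V3 => mk2 (z 0 0) 0).
  apply: (smooth_mk2 openT _ (smooth_cst _ _)); apply: (smooth_coord _ _ openT); exact: smooth_on_id.
have oA : open A by have := open_preimage openT ob sax; rewrite setTI; apply.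
pose Psi (z : V3) : V3 := F1 (mk2 (z 0 0) 0) + (z 0 1 : R^o) *: K 0 + (z 0 i2 : R^o) *: nu0.
have sc i : smooth_on A (fun z : V3 => z 0 i : R^o).
  by apply: (smooth_coord _ _ oA); exact: smooth_on_id.
have saxA : smooth_on A (fun z : V3 => mk2 (z 0 0) 0) by exact: smooth_subset sax.
have sF1a : smooth_on A (fun z : V3 => F1 (mk2 (z 0 0) 0)).
  by apply: (smooth_comp_mx oA ob bV2 _ saxA sF1) => z.
have sPsi : smooth_on A Psi.
  by apply: (smooth_add oA (smooth_add oA sF1a _)); exact: smooth_scalev.
have z0 : mk2 ((0 : V3) 0 0) 0 = 0 :> V2 by apply: row2P; rewrite !mxE.
have A0 : A 0 by rewrite /A /= z0.
have DPsi (v : V3) : 'D_v Psi 0 = v 0 0 *: 'D_e0 F1 0 + v 0 1 *: K 0 + v 0 i2 *: nu0.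
  have [d1 D1] := derive_coordZ (K 0) 1 (0 : V3) v.
  have [d2 D2] := derive_coordZ nu0 i2 (0 : V3) v.
  have d0 : differentiable (fun z : V3 => F1 (mk2 (z 0 0) 0)) (0 : V3) by exact: smooth_diff sF1a A0.
  rewrite /Psi deriveD; [|apply: diff_derivable; exact: differentiableD|exact: diff_derivable].
  rewrite deriveD; [|exact: diff_derivable|exact: diff_derivable].
  rewrite D1 D2; congr (_ + _ + _).
  have dx : differentiable (fun z : V3 => mk2 (z 0 0) 0) (0 : V3) by exact: smooth_diff saxA A0.
  rewrite (derive_comp (f := fun z : V3 => mk2 (z 0 0) 0) (g := F1)) // z0; last exact: smooth_diff sF1 b0.
  have -> : (fun z : V3 => mk2 (z 0 0) 0) = (fun z : V3 => (z 0 0 : R^o) *: e0).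
    by apply/funext => z; apply: row2P; rewrite !mxE /= ?mulr1 ?mulr0.
  have [_ ->] := derive_coordZ e0 0 (0 : V3) v.
  have dF0 := smooth_diff sF1 b0.
  by rewrite !deriveE // (linear_scale ('d F1 _)).
have [W [Psii [WA W0 lPsi]]] : exists W hinv, [/\ W `<=` A, W 0 & ldiff W Psi hinv].
  apply: inverse_function_inj => // v; rewrite DPsi => E.
  have [v0 v1 v2] := det3_free det0 E.
  by apply: row3P; rewrite ?v0 ?v1 ?v2 mxE.
have Psi0 : Psi 0 = F1 0 by rewrite /Psi z0 !mxE !scale0r !addr0.
have [oW oPW sPW sPi PK] := lPsi.
have [lPi PiE] := ldiff_inv lPsi.
pose F2 : V2 -> V3 := Psii \o F1.
have g12 : germ_equiv F1 0 F2 0.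
  by apply: (germ_equiv_tgt lPi); exists 0.
have WF1 : (Psi @` W) (F1 0) by exists 0.
have [r1 r10 r1P] : exists2 r1 : R, 0 < r1 & forall x, box r1 x ->
    [/\ box r x, (Psi @` W) (F1 x) & W (mk3 (x 0 0) 0 0)].
  have n1 : nbhs (0 : V2) (box r) by exact: open_nbhs_nbhs.
  have n2 : nbhs (0 : V2) [set x | (Psi @` W) (F1 x)].
    by apply: (smooth_continuous sF1 b0); exact: open_nbhs_nbhs.
  have n3 : nbhs (0 : V2) [set x | W (mk3 (x 0 0) 0 0)].
    have s3 : smooth_on setT (fun x => mk3 (x 0 0) 0 0).
      exact: (smooth_mk3 openT (smooth_fst openT) (smooth_cst _ _) (smooth_cst _ _)).
    have c3 := smooth_continuous s3 (I : setT (0 : V2)).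
    apply: c3; apply: open_nbhs_nbhs; split=> //.
    by rewrite (_ : mk3 _ _ _ = 0) //; apply: row3P; rewrite !mxE.
  have [r1 r10 H] := box_nbhs (filterI n1 (filterI n2 n3)).
  by exists r1 => // x /H[? []].
have ob1 := @open_box R r1; have b10 := box0 r10.
have sF1b : smooth_on (box r1) F1 by apply: smooth_subset sF1 => x /r1P[].
have sF2 : smooth_on (box r1) F2.
  by apply: (smooth_comp_mx ob1 oPW bV3 _ sF1b sPi) => x /r1P[].
have D1F1x := derive_snd_sqr sF1 sK FK.
have D1F1 u : `|u| < r -> 'D_e1 F1 (mk2 u 0) = 0.
  by move=> ur; rewrite (D1F1x _ (box_axis ur)) mk2_1 scale0r.
have F2axis u : `|u| < r1 -> F2 (mk2 u 0) = mk3 u 0 0.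
  move=> ur; have [_ _ Wu] := r1P _ (box_axis ur); rewrite mk2_0 in Wu.
  rewrite /F2 /= -(PK _ Wu); congr (Psii _).
  by rewrite /Psi !mk3E !scale0r !addr0.
have DF2 v x : box r1 x -> 'D_v F2 x = 'D_v F1 x *m 'J Psii (F1 x).
  move=> bx; have [_ Px _] := r1P x bx.
  have dP : differentiable Psii (F1 x) by exact: smooth_diff sPi Px.
  rewrite derive_comp //; last exact: smooth_diff sF1b bx.
  by rewrite deriveEjacobian.
have D1F2 u : `|u| < r1 -> 'D_e1 F2 (mk2 u 0) = 0.
  move=> ur; have bu := box_axis ur; have [bu' _ _] := r1P _ bu.
  by rewrite DF2 // D1F1 ?mul0mx //; have [] := (boxE r _).1 bu'; rewrite mk2_0.
have ax1 : smooth_on (box r1) (fun x => mk3 (x 0 0) 0 0).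
  exact: (smooth_mk3 ob1 (smooth_fst ob1) (smooth_cst _ _) (smooth_cst _ _)).
have [u ur|u ur|L sL F2L] := hadamard2_vec (h := fun x => F2 x - mk3 (x 0 0) 0 0) (smooth_minus ob1 sF2 ax1).
- by rewrite F2axis // mk2_0 subrr.
- have bu := box_axis ur.
  rewrite deriveB; [|exact/diff_derivable/(smooth_diff sF2)|exact/diff_derivable/(smooth_diff ax1)].
  rewrite D1F2 // sub0r (@derive_affine _ _ _ _ _ _ 0) ?oppr0 // => h.
  by rewrite scaler0 addr0 !mxE /= mulr0 add0r.
have sLi i := smooth_coord 0 i ob1 sL.
have F2E x : box r1 x -> F2 x = mk3 (x 0 0 + x 0 1 ^+ 2 * L x 0 0) (x 0 1 ^+ 2 * L x 0 1) (x 0 1 ^+ 2 * L x 0 i2).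
  move=> bx; have E : F2 x = mk3 (x 0 0) 0 0 + x 0 1 ^+ 2 *: L x.
    by rewrite -(F2L x bx) addrC subrK.
  have e i : F2 x 0 i = mk3 (x 0 0) 0 0 0 i + x 0 1 ^+ 2 * L x 0 i.
    by rewrite E mxE; congr (_ + _); rewrite mxE.
  by apply: row3P; rewrite e !mk3E ?add0r.
(* The second derivative along the null direction is 2 K(0), which the inverse
   of Psi sends to twice the second axis. *)
have L1 : L 0 0 1 = 1.
  have bb1 x : box r1 x -> F2 x 0 1 = x 0 1 ^+ 2 * L x 0 1 by move=> bx; rewrite F2E // mk3E.
  have := derive2_snd_sqr r10 (sLi 1) bb1 => E2.
  have sD1F1 := smooth_derive e1 sF1b.
  have dD : differentiable ('D_e1 F1) (0 : V2) by exact: smooth_diff sD1F1 b10.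
  have sJ : smooth_on (box r1) (fun x => 'J Psii (F1 x)).
    apply: (smooth_comp_mx ob1 oPW bV3 _ sF1b (smooth_jacobian oPW sPi)).
    by move=> x /r1P[].
  have dJ := smooth_diff sJ b10.
  have dDF2 : differentiable ('D_e1 F2) (0 : V2) by exact: smooth_diff (smooth_derive e1 sF2) b10.
  have nE : \forall x \near (0 : V2), 'D_e1 F2 x = 'D_e1 F1 x *m 'J Psii (F1 x).
    exact: near_box r10 (DF2 e1).
  have DD : 'D_e1 ('D_e1 F2) 0 = 2 *: (delta_mx 0 1 : V3).
    rewrite (near_eq_derive e1 nE) derive_mulmx //.
    rewrite (_ : 'D_e1 F1 0 = 0); last first.
      rewrite (_ : 0 = mk2 0 0) ?D1F1 ?normr0 //; by apply: row2P; rewrite !mxE.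
    rewrite mul0mx addr0.
    have -> : 'D_e1 ('D_e1 F1) 0 = 2 *: K 0.
      pose m x := 2 *: K x + x 0 1 *: 'D_e1 K x.
      have sm : smooth_on (box r) m.
        apply: (smooth_add ob (smooth_scale ob (smooth_cst _ _) sK)).
        exact: (smooth_scale ob (smooth_snd ob) (smooth_derive e1 sK)).
      apply/rowP => i; rewrite -derive_coord //.
      have nm : \forall x \near (0 : V2), ('D_e1 F1 x 0 i : R^o) = x 0 1 * m x 0 i.
        by apply: near_box r0 _ => x bx; rewrite (D1F1x _ bx) [LHS]mxE.
      rewrite (near_eq_derive e1 nm) (derive_mul_snd (k := fun x => m x 0 i)); last first.
        exact: smooth_diff (smooth_coord 0 i ob sm) b0.
      by rewrite /m !mxE /= !mul0r add0r mul1r addr0.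
    rewrite -scalemxAl; congr (_ *: _).
    have [JJ _] := ldiff_jac lPsi W0; rewrite Psi0 in JJ.
    have -> : K 0 = delta_mx 0 1 *m 'J Psi 0.
      rewrite -deriveEjacobian; last exact: smooth_diff sPsi A0.
      by rewrite DPsi !mxE /= !scale0r scale1r add0r addr0.
    by rewrite -mulmxA JJ mulmx1.
  have E3 : 'D_e1 ('D_e1 (fun x => F2 x 0 1 : R^o)) 0 = 2.
    have nE2 : \forall x \near (0 : V2), 'D_e1 (fun x => F2 x 0 1 : R^o) x = ('D_e1 F2 x 0 1 : R^o).
      by apply: near_box r10 _ => x bx; rewrite derive_coord //; exact: smooth_diff sF2 bx.
    by rewrite (near_eq_derive e1 nE2) derive_coord // DD !mxE /= mulr1.
  by have := E2; rewrite E3 => H; lra.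
(* On a square where L_1 > 0 its square root is smooth. *)
have [r2 r20 r2P] : exists2 r2 : R, 0 < r2 & forall x, box r2 x -> box r1 x /\ 0 < L x 0 1.
  have n1 : nbhs (0 : V2) (box r1) by exact: open_nbhs_nbhs.
  have n2 : nbhs (0 : V2) [set x | 0 < L x 0 1].
    have c := smooth_continuous (sLi 1) b10.
    have oP : open [set t : R^o | 0 < t] by exact: open_gt.
    have nP : nbhs (L 0 0 1 : R^o) [set t : R^o | 0 < t].
      by apply: open_nbhs_nbhs; split => //=; rewrite L1.
    exact: (c _ nP).
  by have [r2 r20 H] := box_nbhs (filterI n1 n2); exists r2.
have ob2 := @open_box R r2; have b20 := box0 r20.
have sub21 : box r2 `<=` box r1 by move=> x /r2P[].
have sL2 i : smooth_on (box r2) (fun x => L x 0 i : R^o) by exact: smooth_subset (sLi i).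
have ssq : smooth_on (box r2) (fun x => Num.sqrt (L x 0 1) : R^o).
  apply: (smooth_comp ob2 (fin_basis_scalar R) _ (sL2 1) smooth_sqrt).
  by move=> x /r2P[].
pose kap x : V2 := mk2 (F2 x 0 0) (x 0 1 * Num.sqrt (L x 0 1)).
have sF20 : smooth_on (box r2) (fun x => F2 x 0 0 : R^o).
  by apply: (smooth_coord 0 0 ob2); exact: smooth_subset sF2.
have skap : smooth_on (box r2) kap.
  exact: (smooth_mk2 ob2 sF20 (smooth_mul ob2 (smooth_snd ob2) ssq)).
have kap0 : kap 0 = 0.
  rewrite /kap mxE mul0r (_ : F2 0 = 0); first by apply: row2P; rewrite !mxE.
  by rewrite F2E // !mxE expr0n /= !mul0r addr0; apply: row3P; rewrite !mxE.
have Dkap v : 'D_v kap 0 = v.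
  have dk : differentiable kap (0 : V2) by exact: smooth_diff skap b20.
  apply: row2P; rewrite -derive_coord //.
    under eq_fun do rewrite mk2_0.
    have s1 : smooth_on (box r1) (fun y => y 0 1 * L y 0 0 : R^o).
      exact: (smooth_mul ob1 (smooth_snd ob1) (sLi 0)).
    have s2 : smooth_on (box r1) (fun y => y 0 1 * (y 0 1 * L y 0 0) : R^o).
      exact: (smooth_mul ob1 (smooth_snd ob1) s1).
    have nE : \forall x \near (0 : V2), (F2 x 0 0 : R^o) = x 0 0 + x 0 1 * (x 0 1 * L x 0 0).
      by apply: near_box r10 _ => x bx; rewrite F2E // mk3E expr2 mulrA.
    rewrite (near_eq_derive v nE) deriveD; last 2 first.
    - exact/diff_derivable/(smooth_diff (smooth_fst ob1) b10).
    - exact/diff_derivable/(smooth_diff s2 b10).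
    rewrite (derive_mul_snd (k := fun y => y 0 1 * L y 0 0)); last exact: smooth_diff s1 b10.
    by rewrite derive_coord // derive_id !mxE !mul0r mulr0 !addr0.
  under eq_fun do rewrite mk2_1.
  rewrite (derive_mul_snd (k := fun y => Num.sqrt (L y 0 1))); last exact: smooth_diff ssq b20.
  by rewrite !mxE mul0r add0r L1 sqrtr1 mulr1.
have [W2 [kapi [W2b W20 lk]]] : exists W hinv, [/\ W `<=` box r2, W 0 & ldiff W kap hinv].
  by apply: inverse_function_inj => // v; rewrite Dkap.
have [oW2 okW2 skW2 ski kK] := lk.
have [lki kiE] := ldiff_inv lk.
have kW20 : (kap @` W2) 0 by exists 0.
have g23 : germ_equiv F2 0 (F2 \o kapi) 0.
  apply: (germ_equiv_src F2 lki) => //.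
  by rewrite -kap0 kK.
pose beta y : R^o := L (kapi y) 0 i2 / L (kapi y) 0 1.
have [r3 r30 r3P] := box_nbhs (open_nbhs_nbhs (conj okW2 kW20)).
have ob3 := @open_box R r3.
have bki y : box r3 y -> box r2 (kapi y).
  by move=> /r3P[x Wx <-]; rewrite kK //; exact: W2b.
have ski3 : smooth_on (box r3) kapi by exact: smooth_subset ski.
have sLk i : smooth_on (box r3) (fun y => L (kapi y) 0 i : R^o).
  exact: (smooth_comp ob3 bV2 bki ski3 (sL2 i)).
have sbeta : smooth_on (box r3) beta.
  apply: (smooth_mul ob3 (sLk i2)); apply: (smooth_inv ob3 _ (sLk 1)) => y /bki/r2P[_].
  by move=> L0; rewrite gt_eqF.
have [rho rho0 [c sc' g34]] := even_odd_normal_form r30 sbeta.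
exists rho => //; exists c => //.
apply: germ_equiv_trans g12 _; apply: germ_equiv_trans _ g34.
apply: germ_equiv_near g23; apply: near_box r30 _ => y b3y /=.
have bx := bki y b3y; have [b1x Lx] := r2P _ bx.
have yE : kap (kapi y) = y by have [x Wx <-] := r3P y b3y; rewrite kK.
have Y0 : y 0 0 = F2 (kapi y) 0 0 by rewrite -{1}yE mk2_0.
have Y1 : y 0 1 ^+ 2 = kapi y 0 1 ^+ 2 * L (kapi y) 0 1.
  by rewrite -{1}yE mk2_1 exprMn (sqr_sqrtr (ltW Lx)).
apply: row3P; rewrite !mk3E ?Y0 ?Y1 // F2E // mk3E //.
by rewrite /beta; field; rewrite gt_eqF.
Qed.

End normal_form.

(** * The geometry of the normal form *)

Section cross_forms.
Context (R : realType).
Local Notation V2 := 'rV[R]_2.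
Local Notation V3 := 'rV[R]_3.
Local Notation i2 := (ord_max : 'I_3).
Local Notation e0 := (delta_mx 0 0 : V2).
Local Notation e1 := (delta_mx 0 1 : V2).
Implicit Types (x y v : V2) (r : R).

Lemma diff_coord_id n (i : 'I_n) (z : 'rV[R]_n) : differentiable (fun z : 'rV[R]_n => z 0 i : R^o) z.
Proof. exact: diff_coord. Qed.

Lemma derive_coord_id n (i : 'I_n) (z v : 'rV[R]_n) :
  'D_v (fun z : 'rV[R]_n => z 0 i : R^o) z = v 0 i.
Proof. by rewrite derive_coord ?derive_id. Qed.

(** As [c_u] does not vanish, [c (u, v^2)] can replace [u] as first coordinate of
    the source, and [c (x, y)] can replace [x] as first coordinate of the target.
    The two changes are compatible because the second component of the map is
    [v^2], and together they turn the third component into [u v^3]. *)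
Lemma cross_form_cuspidal_cross_cap (c : V2 -> R^o) rho : 0 < rho -> smooth_on (box rho) c ->
  c 0 = 0 -> 'D_e0 c 0 != 0 ->
  germ_equiv (cross_form c) 0 (@cuspidal_cross_cap R) 0.
Proof.
move=> rho0 sc c0 cu; have ob := @open_box R rho; have b0 := box0 rho0.
have bV2 := fin_basis_rV R 2.
have dc := smooth_diff sc b0.
pose P (z : V3) : V2 := mk2 (z 0 0) (z 0 1).
have sP : smooth_on setT P.
  by apply: (smooth_mk2 openT); apply: (smooth_coord _ _ openT); exact: smooth_on_id.
pose A : set V3 := [set z | box rho (P z)].
have oA : open A by have := open_preimage openT ob sP; rewrite setTI; apply.
have P0 : P 0 = 0 by apply: row2P; rewrite !mxE.
have A0 : A 0 by rewrite /A /= P0.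
have scP : smooth_on A (c \o P).
  by apply: (smooth_comp oA bV2 _ _ sc); [move=> z|exact: smooth_subset sP].
have scoord i : smooth_on A (fun z : V3 => z 0 i : R^o).
  by apply: (smooth_coord _ _ oA); exact: smooth_on_id.
pose Phi (z : V3) : V3 := mk3 (c (P z)) (z 0 1) (z 0 i2).
have sPhi : smooth_on A Phi by exact: (smooth_mk3 oA scP (scoord 1) (scoord i2)).
have [W' [Phii [_ W'0 lPhi]]] : exists W hinv, [/\ W `<=` A, W 0 & ldiff W Phi hinv].
  apply: inverse_function_inj => // v Dv.
  have dPhi := smooth_diff sPhi A0.
  have D i : 'D_v (fun z => Phi z 0 i : R^o) 0 = 0 by rewrite derive_coord // Dv mxE.
  have E0 : (fun z => Phi z 0 0 : R^o) = c \o P by apply/funext => z; rewrite /Phi mk3E.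
  have E1 : (fun z => Phi z 0 1 : R^o) = (fun z : V3 => z 0 1 : R^o) by apply/funext => z; rewrite /Phi mk3E.
  have E2 : (fun z => Phi z 0 i2 : R^o) = (fun z : V3 => z 0 i2 : R^o) by apply/funext => z; rewrite /Phi mk3E.
  have v1 : v 0 1 = 0 by have := D 1; rewrite E1 derive_coord_id.
  have v2 : v 0 i2 = 0 by have := D i2; rewrite E2 derive_coord_id.
  have dP : differentiable P (0 : V3) by exact: (smooth_diff sP).
  have DP : 'D_v P 0 = v 0 0 *: e0.
    apply: row2P; rewrite -derive_coord //.
      under eq_fun do rewrite mk2_0; by rewrite derive_coord_id !mxE /= mulr1.
    by under eq_fun do rewrite mk2_1; rewrite derive_coord_id v1 !mxE /= mulr0.
  have := D 0; rewrite E0 derive_comp ?P0 // DP deriveE // (linear_scale ('d c 0)) -deriveE // => /eqP.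
  rewrite scaler_eq0 (negPf cu) orbF => /eqP v0.
  by apply: row3P; rewrite ?v0 ?v1 ?v2 mxE.
pose q x : V2 := mk2 (x 0 0) (x 0 1 ^+ 2).
have sq : smooth_on setT q.
  exact: (smooth_mk2 openT (smooth_fst openT) (smooth_exp 2 openT (smooth_snd openT))).
pose B : set V2 := [set x | box rho (q x)].
have oB : open B by have := open_preimage openT ob sq; rewrite setTI; apply.
have q0 : q 0 = 0 by apply: row2P; rewrite !mxE // expr0n.
have B0 : B 0 by rewrite /B /= q0.
have scq : smooth_on B (c \o q).
  by apply: (smooth_comp oB bV2 _ _ sc); [move=> z|exact: smooth_subset sq].
pose phi x : V2 := mk2 (c (q x)) (x 0 1).
have sphi : smooth_on B phi by exact: (smooth_mk2 oB scq (smooth_snd oB)).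
have [W [phii [_ W0 lphi]]] : exists W hinv, [/\ W `<=` B, W 0 & ldiff W phi hinv].
  apply: inverse_function_inj => // v Dv.
  have dphi := smooth_diff sphi B0.
  have D i : 'D_v (fun z => phi z 0 i : R^o) 0 = 0 by rewrite derive_coord // Dv mxE.
  have E0 : (fun z => phi z 0 0 : R^o) = c \o q by apply/funext => z; rewrite /phi mk2_0.
  have E1 : (fun z => phi z 0 1 : R^o) = (fun z : V2 => z 0 1 : R^o) by apply/funext => z; rewrite /phi mk2_1.
  have v1 : v 0 1 = 0 by have := D 1; rewrite E1 derive_coord_id.
  have dq : differentiable q (0 : V2) by exact: (smooth_diff sq).
  have Dq : 'D_v q 0 = v 0 0 *: e0.
    apply: row2P; rewrite -derive_coord //.
      under eq_fun do rewrite mk2_0; by rewrite derive_coord_id !mxE /= mulr1.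
    under eq_fun do rewrite mk2_1 expr2.
    rewrite (derive_mul_snd (k := fun x => x 0 1)); last exact: diff_coord_id.
    by rewrite v1 !mxE mul0r mul0r addr0 /= mulr0.
  have := D 0; rewrite E0 derive_comp ?q0 // Dq deriveE // (linear_scale ('d c 0)) -deriveE // => /eqP.
  rewrite scaler_eq0 (negPf cu) orbF => /eqP v0.
  by apply: row2P; rewrite ?v0 ?v1 mxE.
have cf0 : cross_form c 0 = 0.
  by rewrite /cross_form; apply: row3P; rewrite !mk3E !mxE ?expr0n //= mul0r.
exists W, phi, phii, W', Phi, Phii; split=> //.
- by split=> //; rewrite /phi q0 c0; apply: row2P; rewrite !mxE.
- by rewrite cf0.
- apply: (@nearW _ (nbhs (0 : V2))) => x; rewrite /Phi /cross_form /P !mk3E -/(q x) /phi /cuspidal_cross_cap mk2_0 mk2_1.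
  by rewrite mulrC.
Qed.

Lemma det3_mulmx (a b c : V3) (G : 'M[R]_3) :
  det3 (a *m G) (b *m G) (c *m G) = det3 a b c * \det G.
Proof.
rewrite -!det3_det -det_mulmx; congr (\det _); apply/row_matrixP => k.
by rewrite row_mul !rowK; case: k => -[|[|[|]]].
Qed.

Lemma smooth_cross_form (c : V2 -> R^o) r : r <= 1 -> smooth_on (box r) c ->
  smooth_on (box r) (cross_form c).
Proof.
move=> r1 sc; have ob := @open_box R r.
have bq x := @box_sqr R r x r1.
have sq2 := smooth_exp 2 ob (smooth_snd ob).
have scq : smooth_on (box r) (fun x => c (mk2 (x 0 0) (x 0 1 ^+ 2)) : R^o).
  exact: (smooth_comp ob (fin_basis_rV R 2) bq (smooth_mk2 ob (smooth_fst ob) sq2) sc).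
apply: (smooth_mk3 ob (smooth_fst ob) sq2); exact: (smooth_mul ob (smooth_exp 3 ob (smooth_snd ob)) scq).
Qed.

(** Here [C (u, v) = c (u, v^2)]. *)
Lemma cross_form_derive (c : V2 -> R^o) r : r <= 1 -> smooth_on (box r) c ->
  exists C : V2 -> R^o, [/\ smooth_on (box r) C, forall u, C (mk2 u 0) = c (mk2 u 0)
    & forall x v, box r x -> 'D_v (cross_form c) x =
      mk3 (v 0 0) (2 * x 0 1 * v 0 1) (x 0 1 ^+ 3 * 'D_v C x + 3 * x 0 1 ^+ 2 * v 0 1 * C x)].
Proof.
move=> r1 sc; have ob := @open_box R r.
have bq x := @box_sqr R r x r1.
have sq2 := smooth_exp 2 ob (smooth_snd ob).
pose C x : R^o := c (mk2 (x 0 0) (x 0 1 ^+ 2)).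
have sC : smooth_on (box r) C.
  exact: (smooth_comp ob (fin_basis_rV R 2) bq (smooth_mk2 ob (smooth_fst ob) sq2) sc).
exists C; split=> // [u|x v bx]; first by rewrite /C mk2_0 mk2_1 expr0n.
have df := smooth_diff (smooth_cross_form r1 sc) bx.
have s1 : smooth_on (box r) (fun y => y 0 1 * C y : R^o) by exact: (smooth_mul ob (smooth_snd ob) sC).
have s2 : smooth_on (box r) (fun y => y 0 1 * (y 0 1 * C y) : R^o) by exact: (smooth_mul ob (smooth_snd ob) s1).
apply: row3P; rewrite -derive_coord // ?mk3E.
- by under eq_fun do rewrite mk3E; rewrite derive_coord_id.
- under eq_fun do rewrite mk3E expr2.
  rewrite (derive_mul_snd (k := fun x => x 0 1)); last exact: diff_coord_id.
  by rewrite derive_coord_id; ring.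
- rewrite (_ : (fun y => _) = (fun y => y 0 1 * (y 0 1 * (y 0 1 * C y)) : R^o)); last first.
    by apply/funext => y; rewrite mk3E /C; ring.
  rewrite (derive_mul_snd (k := fun y => y 0 1 * (y 0 1 * C y))); last exact: smooth_diff s2 bx.
  rewrite (derive_mul_snd (k := fun y => y 0 1 * C y)); last exact: smooth_diff s1 bx.
  rewrite (derive_mul_snd (k := C)); last exact: smooth_diff sC bx.
  ring.
Qed.

(** The lowered normal [w = n G] annihilates [f_u] and [f_v]. The latter is
    [v * (0, 2, 3 v C + v^2 C_v)], and dividing by [v] gives
    [w_1 = - (v / 2) w_2 (3 C + v C_v)], while [w_0] is divisible by [v^3]. Hence
    on the axis [w = (0, 0, w_2)] and [w_v = (0, - 3 / 2 w_2 c, _)], where [w_2]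
    does not vanish because [n] is a unit vector. As the derivative of [G] along
    [v] vanishes on the axis, [w_v = n_v G], and multiplying the three rows of the
    determinant by [G] gives the formula. *)
Lemma model_identity (c : V2 -> R^o) (n : V2 -> V3) (G : V2 -> 'M[R]_3) r : 
  0 < r <= 1 -> smooth_on (box r) c -> smooth_on (box r) n -> smooth_on (box r) G ->
  (forall x, box r x -> (G x)^T = G x) ->
  (forall x, box r x -> (n x *m G x *m (n x)^T) 0 0 = 1) ->
  (forall x v, box r x -> ('D_v (cross_form c) x *m G x *m (n x)^T) 0 0 = 0) ->
  (forall u, `|u| < r -> 'D_e1 G (mk2 u 0) = 0) ->
  exists2 h : V2 -> R^o, smooth_on (box r) h & forall u, `|u| < r ->
    h (mk2 u 0) != 0 /\
    det3 (mk3 1 0 0) ('D_e1 n (mk2 u 0)) (n (mk2 u 0)) * \det (G (mk2 u 0)) =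
      - (3 / 2) * h (mk2 u 0) ^+ 2 * G (mk2 u 0) 0 0 * c (mk2 u 0).
Proof.
move=> /andP[r0 r1] sc sn sG Gs nG fG DG; have ob := @open_box R r.
have [C [sC Caxis Df]] := cross_form_derive r1 sc.
pose w x := n x *m G x.
have sw : smooth_on (box r) w by exact: (smooth_mulmx ob sn sG).
have swi i := smooth_coord 0 i ob sw.
have sum3 (f : 'I_3 -> R) : \sum_i f i = f 0 + f 1 + f i2.
  rewrite !big_ord_recl big_ord0 addr0 addrA; congr (f _ + f _ + f _); exact: val_inj.
have wE (a : V3) x : box r x -> (a *m G x *m (n x)^T) 0 0 = a 0 0 * w x 0 0 + a 0 1 * w x 0 1 + a 0 i2 * w x 0 i2.
  move=> bx; rewrite -mulmxA -[G x]Gs // -trmx_mul -/(w x) mxE sum3.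
  by rewrite !(mxE _ _ _ 0).
have e00 : e0 0 0 = 1 by rewrite mxE.
have e01 : e0 0 1 = 0 by rewrite mxE.
have e10 : e1 0 0 = 0 by rewrite mxE.
have e11 : e1 0 1 = 1 by rewrite mxE.
have w0 x : box r x -> w x 0 0 = x 0 1 * (x 0 1 * (x 0 1 * (- w x 0 i2 * 'D_e0 C x))).
  move=> bx; have := fG x e0 bx; rewrite (wE _ _ bx) (Df _ _ bx) !mk3E e00 e01 => H.
  have : w x 0 0 = - (x 0 1 ^+ 3 * 'D_e0 C x * w x 0 i2) by lra.
  by move=> ->; ring.
have s3 : smooth_on (box r) (fun x => 3 * C x + x 0 1 * 'D_e1 C x : R^o).
  apply: (smooth_add ob (smooth_mul ob (smooth_cst _ _) sC)).
  exact: (smooth_mul ob (smooth_snd ob) (smooth_derive e1 sC)).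
pose m x : R^o := - (1 / 2) * (w x 0 i2 * (3 * C x + x 0 1 * 'D_e1 C x)).
have sm : smooth_on (box r) m.
  exact: (smooth_mul ob (smooth_cst _ _) (smooth_mul ob (swi i2) s3)).
have w1 x : box r x -> w x 0 1 = x 0 1 * m x.
  move=> bx; apply/eqP; rewrite -subr_eq0; apply/eqP.
  apply: (snd_cancel (f := fun x => w x 0 1 - x 0 1 * m x : R^o) ob _ _ bx).
    exact: (smooth_minus ob (swi 1) (smooth_mul ob (smooth_snd ob) sm)).
  move=> y by_; have := fG y e1 by_; rewrite (wE _ _ by_) (Df _ _ by_) !mk3E e10 e11 /m => H.
  have -> : y 0 1 * (w y 0 1 - y 0 1 * (- (1 / 2) * (w y 0 i2 * (3 * C y + y 0 1 * 'D_e1 C y)))) =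
    1 / 2 * (0 * w y 0 0 + 2 * y 0 1 * 1 * w y 0 1 + (y 0 1 ^+ 3 * 'D_e1 C y + 3 * y 0 1 ^+ 2 * 1 * C y) * w y 0 i2) by field.
  by rewrite H mulr0.
exists (fun x => w x 0 i2) => // u ur.
have bu := box_axis ur; set y := mk2 u 0 in bu *.
have y1 : y 0 1 = 0 by rewrite mk2_1.
have wy0 : w y 0 0 = 0 by rewrite w0 // y1 mul0r.
have wy1 : w y 0 1 = 0 by rewrite w1 // y1 mul0r.
have h0 : w y 0 i2 != 0.
  have := nG y bu; rewrite wE // wy0 wy1 !mulr0 !add0r => H.
  by apply/eqP => h0; move: H; rewrite h0 mulr0 => /esym/eqP; rewrite oner_eq0.
have dw := smooth_diff sw bu.
have Dw0 : 'D_e1 w y 0 0 = 0.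
  rewrite -derive_coord //.
  pose k1 x : R^o := - w x 0 i2 * 'D_e0 C x.
  have sk1 : smooth_on (box r) k1.
    exact: (smooth_mul ob (smooth_opp ob (swi i2)) (smooth_derive e0 sC)).
  have sk2 : smooth_on (box r) (fun x => x 0 1 * k1 x : R^o) by exact: (smooth_mul ob (smooth_snd ob) sk1).
  have sk3 : smooth_on (box r) (fun x => x 0 1 * (x 0 1 * k1 x) : R^o) by exact: (smooth_mul ob (smooth_snd ob) sk2).
  have nE : \forall x \near y, (w x 0 0 : R^o) = x 0 1 * (x 0 1 * (x 0 1 * k1 x)).
    by apply: filterS (open_nbhs_nbhs (conj ob bu)) => x; exact: w0.
  rewrite (near_eq_derive e1 nE) (derive_mul_snd (k := fun x => x 0 1 * (x 0 1 * k1 x))); last exact: smooth_diff sk3 bu.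
  by rewrite y1 !mul0r mulr0 addr0.
have Dw1 : 'D_e1 w y 0 1 = - (3 / 2) * w y 0 i2 * c y.
  rewrite -derive_coord //.
  have nE : \forall x \near y, (w x 0 1 : R^o) = x 0 1 * m x.
    by apply: filterS (open_nbhs_nbhs (conj ob bu)) => x; exact: w1.
  rewrite (near_eq_derive e1 nE) derive_mul_snd; last exact: smooth_diff sm bu.
  by rewrite y1 mul0r add0r e11 /m y1 mul0r addr0 mul1r -Caxis -/y; field.
have Dw : 'D_e1 w y = 'D_e1 n y *m G y.
  rewrite derive_mulmx; [|exact: smooth_diff sn bu|exact: smooth_diff sG bu].
  by rewrite DG // mulmx0 addr0.
split=> //.
rewrite -det3_mulmx -Dw -/(w y) /det3 wy0 wy1 Dw0 Dw1.
have -> : (mk3 1 0 0 *m G y) 0 0 = G y 0 0.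
  by rewrite mxE sum3 !mk3E; ring.
ring.
Qed.

End cross_forms.

(** * The invariant of a germ equivalent to a normal form *)

Section invariance.
Context (R : realType).
Local Notation V2 := 'rV[R]_2.
Local Notation V3 := 'rV[R]_3.
Local Notation i2 := (ord_max : 'I_3).
Local Notation e0 := (delta_mx 0 0 : V2).
Local Notation e1 := (delta_mx 0 1 : V2).
Implicit Types (x y v : V2) (r : R).

Lemma posdef_unit n (G : 'M[R]_n) : (forall v : 'rV[R]_n, v != 0 -> 0 < (v *m G *m v^T) 0 0) ->
  G \in unitmx.
Proof.
move=> Gp; apply: unitmx_inj => v vG; apply/eqP; apply: contraT => /Gp.
by rewrite vG mul0mx mxE ltxx.
Qed.

(** The metric and the normal field are transported to the model by the target
    diffeomorphism: [Gh] is the metric along the model and [nh] the normal. The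
    model has singular set [v = 0] and kernel spanned by the [v]-direction there,
    so the transported curve is [t |-> (sigma t, 0)] with [sigma' <> 0], and the
    transported null field [w] has only a [v]-component; this gives the
    independence. The metric along the model has vanishing [v]-derivative on the
    axis because it is a function of the point of the target, so that
    [model_identity] evaluates the determinant, up to the determinants of the
    metric and of the coordinate change. *)
Lemma cusp_edge_invariant (F n : V2 -> V3) (U : set V2) (N0 : set V3) (G : V3 -> 'M[R]_3)
    (p : V2) (eps : R) (gamma eta : R -> V2) (c : V2 -> R^o) (rho : R) :
  open U -> smooth_on U F -> smooth_on U n ->
  open N0 -> smooth_on N0 G -> (forall x, U x -> N0 (F x)) ->
  (forall z, N0 z -> (G z)^T = G z) ->
  (forall z, N0 z -> forall v : V3, v != 0 -> 0 < (v *m G z *m v^T) 0 0) ->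
  (forall x, U x -> (n x *m G (F x) *m (n x)^T) 0 0 = 1) ->
  (forall x v, U x -> ('D_v F x *m G (F x) *m (n x)^T) 0 0 = 0) ->
  0 < eps -> smooth_on `]-eps, eps[ (gamma : R^o -> V2) ->
  smooth_on `]-eps, eps[ (eta : R^o -> V2) -> gamma 0 = p ->
  (forall t, -eps < t < eps ->
    [/\ U (gamma t), derive1 gamma t != 0, eta t != 0 & 'D_(eta t) F (gamma t) = 0]) ->
  0 < rho -> smooth_on (box rho) c -> germ_equiv F p (cross_form c) 0 ->
  (forall a b : R, a *: eta 0 + b *: derive1 gamma 0 = 0 -> a = 0 /\ b = 0) /\
  exists sigma E : R -> R,
    [/\ derivable E 0 1 /\ E 0 != 0, sigma 0 = 0, derivable sigma 0 1 /\ derive1 sigma 0 != 0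
      & \forall t \near (0 : R), 
         det3 ('D_(derive1 gamma t) F (gamma t)) ('D_(eta t) n (gamma t)) (n (gamma t)) =
           E t * c (mk2 (sigma t) 0)].
Proof.
move=> oU sF sn oN0 sG UN0 Gsym Gpos nGn FGn eps0 sg se g0 gP rho0 sc.
move=> [W [phi [phii [W' [Phi [Phii [lphi [Wp phip] lPhi W'p PhiF]]]]]]].
have bV2 := fin_basis_rV R 2; have bV3 := fin_basis_rV R 3;
have [oW ophiW sphi sphii phiK] := lphi.
have [oW' oPhiW' sPhi sPhii PhiK] := lPhi.
have [lphii phiiE] := ldiff_inv lphi.
have Up : U p by rewrite -g0; have [] := gP 0; rewrite ?oppr_lt0 ?eps0.
set f := cross_form c in PhiF.
have phii0 : phii 0 = p by rewrite -phip phiK.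
have im0 : (phi @` W) 0 by exists p.
have [r r01 rP] : exists2 r : R, 0 < r <= 1 & forall y, box r y ->
    [/\ (phi @` W) y, U (phii y), W' (F (phii y)), box rho y & Phi (F (phii y)) = f y].
  have ci : {for (0 : V2), continuous phii} by exact: smooth_continuous sphii im0.
  have cF : {for p, continuous F} by exact: smooth_continuous sF Up.
  have n1 : nbhs (0 : V2) (phi @` W) by exact: open_nbhs_nbhs.
  have n2 : nbhs (phii 0) [set x | U x /\ W' (F x) /\ Phi (F x) = f (phi x)].
    rewrite phii0; apply: filterI; first exact: open_nbhs_nbhs.
    apply: filterI => //; apply: cF; exact: open_nbhs_nbhs.
  have n3 : nbhs (0 : V2) (box rho) by apply: open_nbhs_nbhs; split; [exact: open_box|exact: box0].
  have n4 : nbhs (0 : V2) (phii @^-1` [set x | U x /\ W' (F x) /\ Phi (F x) = f (phi x)]) by exact: ci.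
  have [r r0 H] := box_nbhs (filterI n1 (filterI n4 n3)).
  exists (Num.min r 1); first by rewrite lt_min r0 ltr01 ge_min lexx orbT.
  move=> y yr; have /H[Iy [/= [Uy [W'y E]] by_]] : box r y.
    by apply: box_le yr; rewrite ge_min lexx.
  split=> //; rewrite E; have [x Wx xy] := Iy.
  by rewrite -xy phiK.
have /andP[r0 r1] := r01.
have ob := @open_box R r.
have scr : smooth_on (box r) c by apply: smooth_subset sc => y /rP[].
have sf := smooth_cross_form r1 scr.
have [C [sC _ Df]] := cross_form_derive r1 scr.
have sphiir : smooth_on (box r) phii by apply: smooth_subset sphii => y /rP[].
pose Ft y := F (phii y).
have sFt : smooth_on (box r) Ft by apply: (smooth_comp_mx ob oU bV2 _ sphiir sF) => y /rP[].
have snt : smooth_on (box r) (n \o phii) by apply: (smooth_comp_mx ob oU bV2 _ sphiir sn) => y /rP[].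
pose J (z : V3) := 'J Phi z.
have sJ : smooth_on W' J by exact: smooth_jacobian.
have Ju z : W' z -> J z \in unitmx by move=> W'z; exact: (ldiff_jac lPhi W'z).2.
pose WN := W' `&` N0.
have oWN : open WN by exact: openI.
have sKW : smooth_on WN (fun z => invmx (J z)).
  by apply: (smooth_invmx oWN) => [z [W'z _]|]; [exact: Ju|apply: smooth_subset sJ => z []].
pose H (z : V3) := invmx (J z) *m G z *m (invmx (J z))^T.
have sH : smooth_on WN H.
  apply: (smooth_mulmx oWN (smooth_mulmx oWN sKW _)); last exact: (smooth_trmx oWN sKW).
  by apply: smooth_subset sG => z [].
have FtWN y : box r y -> WN (Ft y) by move=> /rP[_ Uy W'y _ _]; split=> //; exact: UN0.
pose Gh y := H (Ft y).
pose nh y := n (phii y) *m J (Ft y).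
have sJt : smooth_on (box r) (fun y => J (Ft y)).
  by apply: (smooth_comp_mx ob oW' bV3 _ sFt sJ) => y /FtWN[].
have sGh : smooth_on (box r) Gh by exact: (smooth_comp_mx ob oWN bV3 FtWN sFt sH).
have snh : smooth_on (box r) nh by exact: (smooth_mulmx ob snt sJt).
have Jtu y : box r y -> J (Ft y) \in unitmx by move=> /FtWN[W'y _]; exact: Ju.
have DFt y v : box r y -> 'D_v Ft y = 'D_('D_v phii y) F (phii y).
  move=> by_; have [_ Uy _ _ _] := rP y by_.
  by rewrite /Ft -[fun y => _]/(F \o phii) derive_comp //; [exact: smooth_diff sphiir by_|exact: smooth_diff sF Uy].
have fPhi y : box r y -> f y = (Phi \o Ft) y by move=> /rP[_ _ _ _ <-].
have DfE y v : box r y -> 'D_v f y = 'D_v Ft y *m J (Ft y).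
  move=> by_; have [W'y _] := FtWN y by_.
  have nE : \forall y \near y, f y = (Phi \o Ft) y.
    by apply: filterS (open_nbhs_nbhs (conj ob by_)); exact: fPhi.
  rewrite (near_eq_derive v nE) derive_comp; [|exact: smooth_diff sFt by_|exact: smooth_diff sPhi W'y].
  by rewrite deriveEjacobian //; exact: smooth_diff sPhi W'y.
have Dfaxis u v : `|u| < r -> 'D_v f (mk2 u 0) = v 0 0 *: mk3 1 0 0.
  move=> ur; rewrite Df; last exact: box_axis.
  by apply: row3P; rewrite mk2_1 !mk3E !mxE /= ?mulr1 ?expr0n /= ?(mulr0, mul0r, addr0).
have De1F u : `|u| < r -> 'D_e1 Ft (mk2 u 0) = 0.
  move=> ur; have bu := box_axis ur.
  have := DfE _ e1 bu; rewrite Dfaxis // mxE /= scale0r => E.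
  by rewrite -[LHS](mulmxK (Jtu _ bu)) -E mul0mx.
have Ghsym y : box r y -> (Gh y)^T = Gh y.
  move=> by_; rewrite /Gh /H !trmx_mul trmxK Gsym ?mulmxA //.
  by have [] := FtWN y by_.
have JK y : box r y -> J (Ft y) *m invmx (J (Ft y)) = 1%:M.
  by move=> by_; rewrite mulmxV // Jtu.
have cancelG (a : V3) y : box r y ->
    a *m J (Ft y) *m Gh y *m (nh y)^T = a *m G (Ft y) *m (n (phii y))^T.
  move=> by_; rewrite /Gh /H /nh trmx_mul !mulmxA.
  rewrite -(mulmxA a) JK // mulmx1.
  rewrite -(mulmxA _ _ (J (Ft y))^T) -trmx_mul JK // trmx1 mulmx1 //.
have nGnh y : box r y -> (nh y *m Gh y *m (nh y)^T) 0 0 = 1.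
  by move=> by_; rewrite {1}/nh cancelG // nGn //; have [] := rP y by_.
have fGnh y v : box r y -> ('D_v f y *m Gh y *m (nh y)^T) 0 0 = 0.
  by move=> by_; rewrite DfE // cancelG // DFt // FGn //; have [] := rP y by_.
have DGh u : `|u| < r -> 'D_e1 Gh (mk2 u 0) = 0.
  move=> ur; have bu := box_axis ur.
  rewrite /Gh -[fun y => _]/(H \o Ft) derive_comp; [|exact: smooth_diff sFt bu|exact: smooth_diff sH (FtWN _ bu)].
  by rewrite De1F // derive0.
have DJ u : `|u| < r -> 'D_e1 (fun y => J (Ft y)) (mk2 u 0) = 0.
  move=> ur; have bu := box_axis ur; have [W'u _] := FtWN _ bu.
  rewrite -[fun y => _]/(J \o Ft) derive_comp; [|exact: smooth_diff sFt bu|exact: smooth_diff sJ W'u].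
  by rewrite De1F // derive0.
have [h sh hE] := model_identity r01 scr snh sGh Ghsym nGnh fGnh DGh.
(* On T the curve stays in the domain of the model coordinates; y is the
   transported curve, w the transported null field and s its velocity. *)
pose I : set R^o := `]-eps, eps[.
have oI : open I by exact: interval_open.
have IE t : I t <-> -eps < t < eps by rewrite /I /= in_itv.
pose O := W `&` phi @^-1` box r.
have oO : open O by exact: open_preimage.
pose T : set R^o := I `&` (gamma : R^o -> V2) @^-1` O.
have oT : open T.
  rewrite openE => t [It Ot]; apply: filterI; first exact: open_nbhs_nbhs.
  apply: (smooth_continuous sg It); exact: open_nbhs_nbhs.
have T0 : T 0.
  split; first by apply/IE; rewrite oppr_lt0 eps0.
  by rewrite /O /= g0 phip; split=> //; exact: box0.
have TI : T `<=` I by move=> t [].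
have sgT := smooth_subset TI sg; have seT := smooth_subset TI se.
have TO t : T t -> O (gamma t) by case.
have sO : smooth_on O phi by apply: smooth_subset sphi => x [].
pose y t := phi (gamma t).
have sy : smooth_on T (y : R^o -> V2) by exact: (smooth_comp_mx oT oO bV2 TO sgT sO).
have Ty t : T t -> box r (y t) by case=> _ [].
have yK t : T t -> phii (y t) = gamma t by case=> _ [Wg _]; exact: phiK.
pose Jp t := 'J phi (gamma t).
have sJp : smooth_on T (Jp : R^o -> 'M[R]_2).
  exact: (smooth_comp_mx oT oO bV2 TO sgT (smooth_jacobian oO sO)).
have Jpu t : T t -> Jp t \in unitmx by case=> _ [Wg _]; exact: (ldiff_jac lphi Wg).2.
pose w t := eta t *m Jp t.
pose s t := derive1 gamma t *m Jp t.
have sw : smooth_on T (w : R^o -> V2) by exact: (smooth_mulmx oT seT sJp).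
have sg' : smooth_on T (derive1 gamma : R^o -> V2).
  apply: (smooth_ext oT (f := 'D_(1 : R^o) (gamma : R^o -> V2))); last exact: smooth_derive.
  by move=> t _; rewrite derive1E.
have ss : smooth_on T (s : R^o -> V2) by exact: (smooth_mulmx oT sg' sJp).
have diffphi t : T t -> differentiable phi (gamma t) by case=> _ [Wg _]; exact: smooth_diff sphi Wg.
have fphiE t v : T t -> 'D_(v *m Jp t) f (y t) = 'D_v F (gamma t) *m J (Ft (y t)).
  move=> Tt; have by_ := Ty t Tt.
  have [Wg _] := TO t Tt.
  have Dphii : 'D_(v *m Jp t) phii (y t) = v.
    rewrite deriveEjacobian; last exact: smooth_diff sphiir by_.
    by rewrite /Jp /y -mulmxA (ldiff_jac lphi Wg).1 mulmx1.
  by rewrite [LHS](DfE _ _ by_) [X in X *m _ = _](DFt _ _ by_) Dphii (yK _ Tt).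
have wE t : T t -> w t 0 0 = 0 /\ w t 0 1 != 0 /\ y t 0 1 = 0.
  move=> Tt; have /IE/gP[_ _ eta0 Deta] := TI t Tt; have by_ := Ty t Tt.
  have := fphiE t (eta t) Tt; rewrite Deta mul0mx -/(w t) Df // => E.
  have E0 : w t 0 0 = 0 by have /= := congr1 (fun a : V3 => a 0 0) E; rewrite mk3_0 [RHS]mxE.
  have E1 : 2 * y t 0 1 * w t 0 1 = 0 by have /= := congr1 (fun a : V3 => a 0 1) E; rewrite mk3_1 [RHS]mxE.
  have w0 : w t != 0.
    apply/eqP => w0; move/eqP: eta0; apply.
    by rewrite -[LHS](mulmxK (Jpu t Tt)) -/(w t) w0 mul0mx.
  have w1 : w t 0 1 != 0.
    by apply: contra w0 => /eqP w1; apply/eqP; apply: row2P; rewrite ?E0 ?w1 mxE.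
  split=> //; split=> //; move/eqP: E1; rewrite !mulf_eq0 (negPf w1) orbF pnatr_eq0 /=.
  by move/eqP.
pose sigma t := y t 0 0.
have yE t : T t -> y t = mk2 (sigma t) 0.
  by move=> /wE[_ [_ y1]]; apply: row2P; rewrite ?mk2_0 ?mk2_1.
have sigr t : T t -> `|sigma t| < r by move=> /Ty/boxE[].
have Dy t : T t -> derive1 y t = s t.
  move=> Tt; rewrite derive1E /y -[fun t => _]/(phi \o gamma).
  rewrite (derive_comp (V := R^o)) -?derive1E; [|exact: smooth_diff sgT Tt|exact: diffphi].
  by rewrite deriveEjacobian //; exact: diffphi.
have dy t : T t -> differentiable (y : R^o -> V2) t by move=> Tt; exact: smooth_diff sy Tt.
have Dyi t i : T t -> derive1 (fun t => y t 0 i) t = s t 0 i.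
  move=> Tt; rewrite derive1E -(Dy t Tt) derive1E.
  exact: (derive_coord (V := R^o) _ _ _ (dy t Tt)).
have s1 t : T t -> s t 0 1 = 0.
  move=> Tt; rewrite -Dyi // derive1E.
  have nE : \forall t \near (t : R^o), (fun t => y t 0 1 : R^o) t = cst 0 t.
    by apply: filterS (open_nbhs_nbhs (conj oT Tt)) => u /wE[_ []].
  by rewrite (near_eq_derive (1 : R^o) nE) derive_cst.
have s0 t : T t -> s t 0 0 != 0.
  move=> Tt; have /IE/gP[_ g' _ _] := TI t Tt.
  apply: contra g' => /eqP s00; apply/eqP.
  rewrite -[LHS](mulmxK (Jpu t Tt)) -/(s t) (_ : s t = 0) ?mul0mx //.
  by apply: row2P; rewrite ?s00 ?s1 // mxE.
split.
  move=> a b E; have := congr1 (fun v => v *m Jp 0) E.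
  rewrite mul0mx mulmxDl -!scalemxAl -/(w 0) -/(s 0) => Ew.
  have [w00 [w01 _]] := wE 0 T0.
  have lin2 (w' s' : V2) : a *: w' + b *: s' = 0 -> forall i, a * w' 0 i + b * s' 0 i = 0.
    by move=> E' i; have := congr1 (fun v : V2 => v 0 i) E'; rewrite !mxE.
  have Ei := lin2 _ _ Ew.
  have := Ei 0; rewrite w00 mulr0 add0r => /eqP.
  rewrite mulf_eq0 (negPf (s0 0 T0)) orbF => /eqP b0; split=> //.
  have := Ei 1; rewrite b0 mul0r addr0 => /eqP.
  by rewrite mulf_eq0 (negPf w01) orbF => /eqP.
pose E t : R^o := s t 0 0 * w t 0 1 * (- (3 / 2) * h (y t) ^+ 2 * Gh (y t) 0 0) /
    (\det (J (Ft (y t))) * \det (Gh (y t))).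
have Ghp y0 : box r y0 -> forall v : V3, v != 0 -> 0 < (v *m Gh y0 *m v^T) 0 0.
  move=> by_ v v0; have [W'y N0y] := FtWN _ by_.
  have -> : v *m Gh y0 *m v^T = (v *m invmx (J (Ft y0))) *m G (Ft y0) *m (v *m invmx (J (Ft y0)))^T.
    by rewrite /Gh /H trmx_mul !mulmxA.
  apply: Gpos => //; apply: contra v0 => /eqP vK.
  by rewrite -[v](mulmxKV (Jtu _ by_)) vK mul0mx.
have detG0 y0 : box r y0 -> \det (Gh y0) != 0.
  by move=> by_; rewrite -unitfE -unitmxE; apply: posdef_unit; exact: Ghp.
have detJ0 y0 : box r y0 -> \det (J (Ft y0)) != 0.
  by move=> by_; rewrite -unitfE -unitmxE; exact: Jtu.
have G00 y0 : box r y0 -> Gh y0 0 0 != 0.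
  move=> by_; have := Ghp y0 by_ (delta_mx 0 0).
  rewrite -rowE trmx_delta -colE !mxE => H0; rewrite gt_eqF // H0 //.
  by apply/eqP => /(congr1 (fun v : V3 => v 0 0)); rewrite !mxE /= => /eqP; rewrite oner_eq0.
have sE : smooth_on T (E : R^o -> R^o).
  have scy (k : V2 -> R^o) : smooth_on (box r) k -> smooth_on T (fun t => k (y t) : R^o).
    by move=> sk; exact: (smooth_comp oT bV2 Ty sy sk).
  have sh2 := smooth_exp 2 ob sh.
  have sG00 := smooth_coord 0 0 ob sGh.
  have m1 := smooth_mul oT (smooth_coord 0 0 oT ss) (smooth_coord 0 1 oT sw).
  have m2 := smooth_mul ob (smooth_mul ob (smooth_cst _ (- (3 / 2) : R^o)) sh2) sG00.
  have m3 := smooth_mul ob (smooth_det ob sJt) (smooth_det ob sGh).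
  have m4 : smooth_on (box r) (fun z => (\det (J (Ft z)) * \det (Gh z))^-1 : R^o).
    by apply: (smooth_inv ob _ m3) => z bz; rewrite mulf_neq0 ?detG0 ?detJ0.
  exact: (smooth_mul oT (smooth_mul oT m1 (scy _ m2)) (scy _ m4)).
exists sigma, E; split.
- split; first by apply/derivable1_diffP; exact: smooth_diff sE T0.
  have b0 := Ty 0 T0; have [_ [w01 _]] := wE 0 T0.
  have [h0 _] := hE _ (sigr 0 T0); rewrite -yE // in h0.
  have c32 : - (3 / 2) != 0 :> R by rewrite oppr_eq0 mulf_neq0 ?invr_eq0 ?pnatr_eq0.
  apply: mulf_neq0; last first.
    by rewrite invr_eq0; apply: mulf_neq0; [exact: detJ0|exact: detG0].
  apply: mulf_neq0; first by apply: mulf_neq0; [exact: s0|].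
  apply: mulf_neq0; last exact: G00.
  by apply: mulf_neq0 => //; exact: expf_neq0.
- by rewrite /sigma /y g0 phip mxE.
- split; last by rewrite Dyi // s0.
  apply/derivable1_diffP; apply: (diff_coord (V := R^o) (f := y)); exact: dy.
- apply: filterS (open_nbhs_nbhs (conj oT T0)) => t Tt.
  have by_ := Ty t Tt; have [h0] := hE _ (sigr t Tt); rewrite -yE // => hE'.
  have [_ [w1 _]] := wE t Tt.
  apply: (mulIf (detG0 _ by_)); apply: (mulIf (detJ0 _ by_)).
  rewrite mulrAC -det3_mulmx -fphiE // -/(s t).
  have -> : 'D_(s t) f (y t) = s t 0 0 *: mk3 1 0 0 by rewrite [y t]yE // Dfaxis // sigr.
  have nhE : n (gamma t) *m J (Ft (y t)) = nh (y t) by rewrite /nh yK.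
  have DnE : 'D_(eta t) n (gamma t) *m J (Ft (y t)) = w t 0 1 *: 'D_e1 nh (y t).
    rewrite /nh derive_mulmx; [|exact: smooth_diff snt by_|exact: smooth_diff sJt by_].
    have -> : 'D_e1 (fun z => J (Ft z)) (y t) = 0 by rewrite yE // DJ // sigr.
    rewrite mulmx0 addr0 scalemxAl; congr (_ *m _).
    have [_ Uy _ _ _] := rP _ by_.
    have dn : differentiable n (phii (y t)) by exact: smooth_diff sn Uy.
    have dpi : differentiable phii (y t) by exact: smooth_diff sphiir by_.
    have yKt := yK t Tt; rewrite yKt in dn.
    have -> : 'D_e1 (n \o phii) (y t) = 'D_('D_e1 phii (y t)) n (gamma t).
      by rewrite derive_comp ?yKt.
    have Ee : eta t = w t 0 1 *: 'D_e1 phii (y t).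
      have we : w t = w t 0 1 *: e1 by rewrite [LHS]vec2_sum (wE t Tt).1 scale0r add0r.
      rewrite [X in _ *: X]deriveE // -(linear_scale ('d phii (y t))) -we -deriveE //.
      rewrite deriveEjacobian // /w -mulmxA.
      by have [Wg _] := TO t Tt; rewrite (ldiff_jac lphi Wg).1 mulmx1.
    rewrite [in LHS]Ee (deriveE _ dn) (deriveE _ dn).
    exact: (linear_scale ('d n (gamma t))).
  rewrite nhE DnE det3_scale2.
  have -> : det3 (s t 0 0 *: mk3 1 0 0) ('D_e1 nh (y t)) (nh (y t)) = s t 0 0 * det3 (mk3 1 0 0) ('D_e1 nh (y t)) (nh (y t)).
    by rewrite /det3 !mxE; ring.
  rewrite /E; move: hE' (detG0 _ by_) (detJ0 _ by_).
  move: (det3 _ _ _) (\det _) (\det _) (Gh _ _ _) (h _) (c _) (s t 0 0) (w t 0 1).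
  move=> D3 dJ dG G0 h1 c1 a1 b1 HD dG0 dJ0.
  have -> : b1 * (a1 * D3) * dG = b1 * a1 * (D3 * dG) by ring.
  rewrite HD; field.
  by rewrite dJ0 dG0.
Qed.

End invariance.

(** * Frontals in charts *)

Section charts.
Context (R : realType) (n : nat) (N : manifold R n).
Implicit Types (i j : atlas N) (x : N).

Lemma open_chart_image i (A : set N) : open A -> A `<=` mdom i -> open (chart i @` A).
Proof.
move=> oA Ai.
have -> : chart i @` A = chart i @` mdom i `&` param i @^-1` A.
  apply/seteqP; split=> [_ [x Ax <-]|_ [[x ix <-] /=]].
    by split; [exists x => //; exact: Ai|rewrite /= chartK //; exact: Ai].
  by rewrite chartK // => Ax; exists x.
rewrite openE => y [[x ix <-] /= Ax]; apply: filterI.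
  by apply: open_nbhs_nbhs; split; [exact: open_chart_img|exists x].
by apply: (continuous_param ix); exact: open_nbhs_nbhs.
Qed.

Lemma open_transition_dom i j : open (chart i @` (mdom i `&` mdom j)).
Proof.
by apply: open_chart_image => [|x []//]; apply: openI; exact: open_mdom.
Qed.

Lemma diff_transition i j x : mdom i x -> mdom j x ->
  differentiable (chart j \o param i) (chart i x).
Proof.
by move=> ix jx; apply: (smooth_diff (@smooth_transition _ _ N i j)); exists x.
Qed.

Lemma derive_chart_change (V : normedModType R) (h : V -> N) v0 w i j :
  {for v0, continuous h} -> mdom i (h v0) -> mdom j (h v0) ->
  differentiable (chart i \o h) v0 ->
  'D_w (chart j \o h) v0 = 'D_w (chart i \o h) v0 *m 'J (chart j \o param i) (chart i (h v0)).
Proof.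
move=> ch ih jh dh.
have nE : \forall v \near v0, (chart j \o h) v = ((chart j \o param i) \o (chart i \o h)) v.
  have nh : nbhs (h v0) (mdom i) by apply: open_nbhs_nbhs; split; [exact: open_mdom|].
  have nh2 : nbhs v0 (h @^-1` mdom i) by exact: ch.
  by apply: filterS nh2 => v iv /=; rewrite chartK.
have dt := diff_transition ih jh.
by rewrite (near_eq_derive w nE) derive_comp // deriveEjacobian.
Qed.

Lemma smooth_chart_comp m (U : set 'rV[R]_m) (f : 'rV[R]_m -> N) i : open U ->
  smooth_map (U : set (euclid R m)) f ->
  open (U `&` f @^-1` mdom i) /\ smooth_on (U `&` f @^-1` mdom i) (chart i \o f).
Proof.
move=> oU [cf sf]; split.
  rewrite openE => x [Ux ix]; apply: filterI; first exact: open_nbhs_nbhs.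
  by apply: (cf x Ux); apply: open_nbhs_nbhs; split; [exact: open_mdom|].
have := sf tt i; rewrite /= image_id (_ : U `&` setT = U) //.
by apply/seteqP; split=> x // [].
Qed.

End charts.

Section riemannian_charts.
Context (R : realType) (N : manifold R 3) (g : riemannian_metric N)
  (Om : volume_element g).
Variables (U : set 'rV[R]_2) (f : 'rV[R]_2 -> N) (nu : 'rV[R]_2 -> tvec N).
Hypotheses (oU : open U) (fr : frontal g U f nu).
Local Notation V2 := 'rV[R]_2.
Local Notation V3 := 'rV[R]_3.
Implicit Types (i j : atlas N) (u v : V2).

Definition chart_dom i : set V2 := U `&` f @^-1` mdom i.

Let sf : smooth_map (U : set (euclid R 2)) f. Proof. by case: fr. Qed.

Lemma frontal_continuous u : U u -> {for u, continuous f}.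
Proof. by case: sf => cf _; exact: cf. Qed.

Lemma open_chart_dom i : open (chart_dom i).
Proof. exact: (smooth_chart_comp i oU sf).1. Qed.

Lemma smooth_chart_f i : smooth_on (chart_dom i) (chart i \o f).
Proof. exact: (smooth_chart_comp i oU sf).2. Qed.

Lemma smooth_normal i : smooth_on (chart_dom i) (nu ^~ i).
Proof. by case: fr => _ _ sn _ _; exact: sn. Qed.

Lemma pushforward_tangent u v : U u -> is_tangent (f u) (Defs.pushforward f u v).
Proof.
move=> Uu i j iu ju; apply: derive_chart_change => //; first exact: frontal_continuous.
by apply: smooth_diff (@smooth_chart_f i) _.
Qed.

Lemma normal_tangent u : U u -> is_tangent (f u) (nu u).
Proof. by case: fr => _ tn _ _ _; exact: tn. Qed.

Lemma normal_unit i u : chart_dom i u ->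
  (nu u i *m gram g i ((chart i \o f) u) *m (nu u i)^T) 0 0 = 1.
Proof.
move=> [Uu iu]; case: fr => _ tn _ n1 _.
by rewrite -(inner_chart g (tn u Uu) (tn u Uu) iu) n1.
Qed.

Lemma normal_orthogonal i u v : chart_dom i u ->
  ('D_v (chart i \o f) u *m gram g i ((chart i \o f) u) *m (nu u i)^T) 0 0 = 0.
Proof.
move=> [Uu iu]; case: fr => _ tn _ _ n0.
by rewrite -(inner_chart g (pushforward_tangent v Uu) (tn u Uu) iu) n0.
Qed.

Lemma null_pushforward u v i : U u -> mdom i (f u) -> v *m df_mx f u = 0 ->
  'D_v (chart i \o f) u = 0.
Proof.
move=> Uu iu vk; have cu := mdom_chart_at (f u).
rewrite -[LHS]/(Defs.pushforward f u v i) (pushforward_tangent v Uu cu iu).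
rewrite /Defs.pushforward deriveEjacobian; last by apply: smooth_diff (@smooth_chart_f _) _.
by rewrite -/(df_mx f u) vk mul0mx.
Qed.

(** The Christoffel terms are multiplied by the vanishing push-forward. *)
Lemma null_covariant_derivative u v i : U u -> mdom i (f u) -> v *m df_mx f u = 0 ->
  covariant_derivative g f nu u v i = 'D_v (nu ^~ i) u.
Proof.
move=> Uu iu vk; rewrite /covariant_derivative (_ : \row_k _ = 0) ?addr0 //.
apply/rowP => k; rewrite !mxE big1 // => a _; rewrite big1 // => b _.
by rewrite /Defs.pushforward null_pushforward // mxE mulr0 mul0r.
Qed.

(** Differentiating the transition rule of [nu], the derivative of the Jacobian
    matrix of the transition along [f] is multiplied by the push-forward of [v],
    which vanishes; what remains is the transition rule of a tangent vector. *)
Lemma null_covariant_tangent u v : U u -> v *m df_mx f u = 0 ->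
  is_tangent (f u) (covariant_derivative g f nu u v).
Proof.
move=> Uu vk i j iu ju; rewrite !null_covariant_derivative //.
pose A := chart i @` (mdom i `&` mdom j).
pose T (y : V3) := 'J (chart j \o param i) y.
have oA : open A by exact: open_transition_dom.
have sT : smooth_on A T by apply: smooth_jacobian oA _; exact: smooth_transition.
have Au : A (chart i (f u)) by exists (f u).
have dF : differentiable (chart i \o f) u by apply: smooth_diff (@smooth_chart_f i) _.
have dT : differentiable T ((chart i \o f) u) by exact: smooth_diff sT Au.
have nE : \forall x \near u, nu x j = nu x i *m (T \o (chart i \o f)) x.
  have ni := open_nbhs_nbhs (conj (@open_chart_dom i) (conj Uu iu)).
  have nj := open_nbhs_nbhs (conj (@open_chart_dom j) (conj Uu ju)).
  apply: filterS2 ni nj => x [Ux ix] [_ jx].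
  exact: (normal_tangent Ux).
rewrite (near_eq_derive v nE) (derive_mulmx (f := nu ^~ i) (g := T \o (chart i \o f))).
- by rewrite derive_comp // null_pushforward // derive0 mulmx0 addr0.
- by apply: smooth_diff (@smooth_normal i) _.
- exact: differentiable_comp.
Qed.

Lemma velocity_tangent (gamma : R -> V2) t : U (gamma t) ->
  differentiable (gamma : R^o -> V2) t ->
  is_tangent (f (gamma t)) (velocity (f \o gamma) t) /\
  forall i, mdom i (f (gamma t)) ->
    velocity (f \o gamma) t i = 'D_(derive1 gamma t) (chart i \o f) (gamma t).
Proof.
move=> Ug dg.
have V i : mdom i (f (gamma t)) -> velocity (f \o gamma) t i = 'D_(derive1 gamma t) (chart i \o f) (gamma t).
  move=> ig; have dF : differentiable (chart i \o f) (gamma t) by apply: smooth_diff (@smooth_chart_f i) _.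
  rewrite /velocity !derive1E.
  exact: (derive_comp (V := R^o) (f := gamma) (g := chart i \o f) (1 : R^o) dg dF).
by split=> // i j ig jg; rewrite !V //; exact: (pushforward_tangent _ Ug).
Qed.

Lemma psi_chart (gamma eta : R -> V2) t i : U (gamma t) -> mdom i (f (gamma t)) ->
  differentiable (gamma : R^o -> V2) t -> eta t *m df_mx f (gamma t) = 0 ->
  psi Om f nu gamma eta t = density Om i (chart i (f (gamma t))) *
    det3 ('D_(derive1 gamma t) (chart i \o f) (gamma t)) ('D_(eta t) (nu ^~ i) (gamma t)) (nu (gamma t) i).
Proof.
move=> Ug ig dg vk; have [vt vE] := velocity_tangent Ug dg.
rewrite /psi (vol_chart _ vt (null_covariant_tangent Ug vk) (normal_tangent Ug) ig).
by rewrite det3_det vE // null_covariant_derivative.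
Qed.

Lemma area_density_chart u i : chart_dom i u ->
  area_density Om f nu u = density Om i (chart i (f u)) *
    det3 ('D_(delta_mx 0 0) (chart i \o f) u) ('D_(delta_mx 0 1) (chart i \o f) u) (nu u i).
Proof.
move=> [Uu iu]; rewrite /area_density.
rewrite (vol_chart _ (pushforward_tangent _ Uu) (pushforward_tangent _ Uu) (normal_tangent Uu) iu).
by rewrite det3_det.
Qed.

Lemma density_neq0 i x : mdom i x -> density Om i (chart i x) != 0.
Proof.
move=> ix; have := density_sqr Om ix; have := gram_unitmx g ix.
rewrite unitmxE unitfE => d0 E; apply: contra d0 => /eqP d0.
by rewrite -E d0 expr0n.
Qed.

End riemannian_charts.

(** * Equivalence of germs on manifolds and in charts *)

Section a_equivalence_in_charts.
Context (R : realType).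

Lemma smooth_map_euclidP m n (W : set 'rV[R]_m) (h : 'rV[R]_m -> 'rV[R]_n) :
  @smooth_map R m n (euclid R m) (euclid R n) W h <-> smooth_on W h.
Proof.
have E : id @` (W `&` setT `&` h @^-1` setT) = W.
  by rewrite image_id; apply/seteqP; split=> x // [[]].
split=> [[_ /(_ tt tt)] /=|sh]; first by rewrite E.
split=> [x Wx|i j /=]; first exact: smooth_continuous sh Wx.
by rewrite E.
Qed.

Lemma local_diffeo_euclidP n (x : 'rV[R]_n) h hi :
  @local_diffeo R n (euclid R n) (euclid R n) x h hi <-> exists2 W, W x & ldiff W h hi.
Proof.
split=> [[W [[oW Wx] oh sh shi hK]]|[W Wx [oW oh sh shi hK]]].
  by exists W => //; split=> //; apply/smooth_map_euclidP.
by exists W; split=> //; apply/smooth_map_euclidP.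
Qed.

Context (N : manifold R 3) (f : 'rV[R]_2 -> N) (p : 'rV[R]_2) (i : atlas N).
Hypotheses (cf : {for p, continuous f}) (ip : mdom i (f p)).
Local Notation V2 := 'rV[R]_2.
Local Notation V3 := 'rV[R]_3.

Let near_mdom : nbhs p (f @^-1` mdom i).
Proof. by apply: cf; apply: open_nbhs_nbhs; split; [exact: open_mdom|]. Qed.

Lemma A_equivalent_germ (f' : V2 -> V3) (q : V2) :
  @A_equivalent R N (euclid R 3) f p f' q -> germ_equiv (chart i \o f) p f' q.
Proof.
move=> [phi [phii [Phi [Phii [/local_diffeo_euclidP[W Wp lphi] pq lPhi Pq PhiE]]]]].
have [B [[oB Bp] oPB sP sPi PK]] := lPhi.
have [_ _ sphi _ phiK] := lphi.
pose B' := B `&` mdom i.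
have oB' : open B' by apply: openI => //; exact: open_mdom.
have B'i : B' `<=` mdom i by move=> x [].
pose W' : set V3 := chart i @` B'.
have oW' : open W' by exact: open_chart_image.
have imW' : (Phi \o param i) @` W' = Phi @` B `&` Phii @^-1` mdom i.
  apply/seteqP; split=> [_ [_ [x [Bx ix] <-] <-] /=|_ [[x Bx <-] /=]].
    by rewrite chartK //; split; [exists x|rewrite /= PK].
  rewrite PK // => ix; exists (chart i x); first by exists x.
  by rewrite /= chartK.
exists W, phi, phii, W', (Phi \o param i), (chart i \o Phii); split=> //.
- split=> //.
  + rewrite imW' openE => y [By iy]; apply: filterI; first exact: open_nbhs_nbhs.
    case: sPi => cPi _; apply: (cPi y By).
    by apply: open_nbhs_nbhs; split; [exact: open_mdom|].
  + case: sP => _ /(_ i tt) /=.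
    by rewrite (_ : B `&` mdom i `&` Phi @^-1` setT = B') //; apply/seteqP; split=> x // [].
  + rewrite imW'; case: sPi => _ /(_ tt i) /=; rewrite image_id.
    by rewrite (_ : Phi @` B `&` setT = Phi @` B) //; apply/seteqP; split=> x // [].
  + by move=> _ [x [Bx ix] <-] /=; rewrite chartK // PK.
- by exists (f p).
- have cphi : {for p, continuous phi} by exact: smooth_continuous sphi Wp.
  have n1 : nbhs (phi p) [set y | f' y = Phi (f (phii y))] by rewrite pq.
  have n2 : nbhs p (phi @^-1` [set y | f' y = Phi (f (phii y))]) by exact: cphi.
  have n3 : nbhs p W by case: lphi => oW _ _ _ _; exact: open_nbhs_nbhs.
  apply: filterS2 near_mdom (filterI n2 n3) => x /= ix [-> Wx].
  by rewrite phiK // chartK.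
Qed.

Lemma germ_A_equivalent (f' : V2 -> V3) (q : V2) :
  germ_equiv (chart i \o f) p f' q -> @A_equivalent R N (euclid R 3) f p f' q.
Proof.
move=> [W [phi [phii [W' [Phi [Phii [lphi [Wp pq] lPhi W'p PhiE]]]]]]].
have oC := @open_chart_img _ _ N i.
have oW' : open W' by case: lPhi.
have {lPhi}lPhi := ldiff_restrict lPhi oC.
set B := W' `&` _ in lPhi.
have [oB oPB sP sPi PK] := lPhi.
have [oW opW sphi sphii phiK] := lphi.
pose A : set N := mdom i `&` chart i @^-1` W'.
have oA : open A.
  rewrite openE => x [ix W'x]; apply: filterI.
    by apply: open_nbhs_nbhs; split; [exact: open_mdom|].
  apply: (continuous_chart ix); apply: open_nbhs_nbhs; split => //.
have AE : chart i @` A = B.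
  apply/seteqP; split=> [_ [x [ix Wx] <-]|y [Wy [x ix xy]]]; first by split=> //; exists x.
  by exists x => //; split=> //; rewrite /= xy.
have imA : (Phi \o chart i) @` A = Phi @` B by rewrite -AE -image_comp.
have ABx x : A x -> B (chart i x) by rewrite -AE; exists x.
have ciP y : (Phi @` B) y -> {for y, continuous (param i \o Phii)}.
  move=> [b Bb by_]; have [x [ix _] xb] : (chart i @` A) b by rewrite AE.
  have E : Phii y = chart i x by rewrite -by_ PK.
  apply: continuous_comp; first by apply: (smooth_continuous sPi); exists b.
  rewrite E; exact: continuous_param.
have pA y : (Phi @` B) y -> exists2 x, mdom i x & Phii y = chart i x.
  move=> [b Bb <-]; have [x [ix _] xb] : (chart i @` A) b by rewrite AE.
  by exists x => //; rewrite PK.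
exists phi, phii, (Phi \o chart i), (param i \o Phii); split=> //.
- by apply/local_diffeo_euclidP; exists W.
- exists A; split=> //.
  + by rewrite imA.
  + split=> [x Ax|k j /=].
      have [ix _] := Ax; apply: continuous_comp; first exact: continuous_chart.
      by apply: (smooth_continuous sP); exact: ABx.
    rewrite (_ : A `&` mdom k `&` _ @^-1` setT = A `&` mdom k); last by apply/seteqP; split=> x // [].
    have oD : open (chart k @` (A `&` mdom k)).
      by apply: open_chart_image => [|x []//]; apply: openI => //; exact: open_mdom.
    rewrite -[_ \o param k]/(Phi \o (chart i \o param k)).
    apply: (smooth_comp_mx oD oB (fin_basis_rV R 3) _ _ sP).
      by move=> _ [x [Ax kx] <-] /=; rewrite chartK //; exact: ABx.
    apply: smooth_subset (@smooth_transition _ _ N k i) => _ [x [[ix _] kx] <-].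
    by exists x.
  + rewrite imA; split=> [y By|j k /=]; first exact: ciP.
    rewrite image_id; set D := _ `&` _ `&` _.
    have DE : D = Phi @` B `&` (param i \o Phii) @^-1` mdom k.
      by apply/seteqP; split=> y; [move=> [[]]|move=> []].
    have oD : open D.
      rewrite DE openE => y [By ky]; apply: filterI; first exact: open_nbhs_nbhs.
      by apply: (ciP y By); apply: open_nbhs_nbhs; split; [exact: open_mdom|].
    rewrite -[chart k \o _]/((chart k \o param i) \o Phii).
    apply: (smooth_comp_mx oD (@open_transition_dom _ _ N i k) (fin_basis_rV R 3) _ _ (@smooth_transition _ _ N i k)).
      move=> y; rewrite DE => -[By /= ky]; have [x ix E] := pA y By.
      by exists x => //; split => //; move: ky; rewrite E chartK.
    by apply: smooth_subset sPi => y; rewrite DE => -[].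
  + move=> x Ax /=; rewrite PK ?chartK //; last exact: ABx.
    by case: Ax.
- by rewrite -pq; exact: (nbhs_singleton PhiE).
- have qW : (phi @` W) q by exists p.
  have phiq : phii q = p by rewrite -pq phiK.
  have cphii : {for q, continuous phii} by exact: smooth_continuous sphii qW.
  have n1 : nbhs (phii q) [set x | Phi ((chart i \o f) x) = f' (phi x)] by rewrite phiq.
  have n2 : nbhs q (phii @^-1` [set x | Phi ((chart i \o f) x) = f' (phi x)]) by exact: cphii.
  have n3 : nbhs q (phi @` W) by exact: open_nbhs_nbhs.
  apply: filterS2 n2 n3 => y /= -> [x Wx <-].
  by rewrite phiK.
Qed.

End a_equivalence_in_charts.

(** * The criterion *)

Section criterion_pieces.
Context (R : realType).
Local Notation V2 := 'rV[R]_2.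
Local Notation e0 := (delta_mx 0 0 : V2).

Lemma transverseP (v w : V2) :
  transverse v w <-> forall a b : R, a *: v + b *: w = 0 -> a = 0 /\ b = 0.
Proof.
have E a b : (mk2 a b : 'rV_(1 + 1)) *m col_mx v w = a *: v + b *: w.
  have -> : mk2 a b = row_mx a%:M b%:M :> 'rV_(1 + 1).
    apply/rowP => j; rewrite [RHS]mxE.
    by case: splitP => k jk; rewrite (ord1 k) in jk *; rewrite !mxE eqxx mulr1n jk.
  by rewrite mul_row_col !mul_scalar_mx.
split=> [fr a b ab0|free].
  have : (mk2 a b : 'rV_(1 + 1)) *m col_mx v w = 0 *m col_mx v w by rewrite E mul0mx.
  move=> /(row_free_inj fr) ab; split.
    by rewrite -[a](mk2_0 a b) ab mxE.
  by rewrite -[b](mk2_1 a b) ab mxE.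
rewrite /transverse -kermx_eq0; apply/eqP/row_matrixP => i; rewrite row0.
have : row i (kermx (col_mx v w)) *m col_mx v w = 0 by rewrite -row_mul mulmx_ker row0.
set x := row i _; rewrite -[x]mk2E E => /free[-> ->].
exact: mk2_00.
Qed.

(** At a zero of [k] the derivative of [A * k] is [A * k']. *)
Lemma simple_zero_transfer (P A k : R -> R) : (\forall t \near (0 : R^o), P t = A t * k t) ->
  derivable A 0 1 -> A 0 != 0 -> derivable k 0 1 ->
  (P 0 = 0 /\ derive1 P 0 != 0) <-> (k 0 = 0 /\ derive1 k 0 != 0).
Proof.
move=> PE dA A0 dk.
have P0 : P 0 = A 0 * k 0 by exact: (nbhs_singleton PE).
have P' : derive1 P 0 = A 0 * derive1 k 0 + k 0 * derive1 A 0.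
  rewrite !derive1E (near_eq_derive (1 : R^o) PE).
  exact: (deriveM dA dk).
have z : (P 0 == 0) = (k 0 == 0) by rewrite P0 mulf_eq0 (negPf A0).
split=> -[/eqP h0 h1]; split; apply/eqP.
- by rewrite -z.
- move: h0 h1; rewrite z P' => /eqP -> h1; apply/eqP; apply: contra h1 => /eqP ->.
  by rewrite mulr0 mul0r addr0.
- by rewrite z.
- move: h0 h1 => /eqP h0 h1; apply/eqP; rewrite P' h0 mul0r addr0.
  exact: mulf_neq0.
Qed.

Lemma axis_restriction (c : V2 -> R^o) (sigma : R -> R) : differentiable c 0 ->
  sigma 0 = 0 -> derivable sigma 0 1 ->
  let k t : R := c (mk2 (sigma t) 0) in
  [/\ k 0 = c 0, derivable k 0 1 & derive1 k 0 = derive1 sigma 0 * 'D_e0 c 0].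
Proof.
move=> dc s0 ds k.
have dsd : differentiable (sigma : R^o -> R^o) (0 : R^o) by exact/derivable1_diffP.
pose s t : V2 := sigma t *: e0.
have sE t : mk2 (sigma t) 0 = s t by apply: row2P; rewrite !mxE /= ?mulr1 ?mulr0.
have kE : k = c \o s by apply/funext => t; rewrite /k sE.
have s00 : s 0 = 0 by rewrite /s s0 scale0r.
have dss : differentiable (s : R^o -> V2) (0 : R^o) by exact: differentiableZl.
have dcs : differentiable c (s 0) by rewrite s00.
split; first by rewrite kE /= s00.
  by rewrite kE; apply/derivable1_diffP; exact: (differentiable_comp (U := R^o)).
rewrite kE derive1E (derive_comp (V := R^o) (f := s) (g := c) (1 : R^o) dss dcs) s00.
have -> : 'D_(1 : R^o) s 0 = derive1 sigma 0 *: e0.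
  by rewrite deriveE // diffZl //= derive1E [X in _ = X *: _]deriveE.
rewrite deriveE // [X in _ * X]deriveE //.
exact: (linear_scale ('d c 0)).
Qed.

Lemma cuspidal_cross_cap_cross_form :
  @cuspidal_cross_cap R = cross_form (fun x : V2 => x 0 0).
Proof.
by apply/funext => x; apply: row3P; rewrite /cross_form mk3E mxE //= mk2_0 mulrC.
Qed.

End criterion_pieces.

Theorem corollary1p5 (R : realType)
    (N : manifold R 3) (g : riemannian_metric N) (Om : volume_element g)
    (U : set 'rV[R]_2) (f : 'rV[R]_2 -> N) (nu : 'rV[R]_2 -> tvec N)
    (p : 'rV[R]_2) (eps : R) (gamma eta : R -> 'rV[R]_2)
    (open_U : open U) (connected_U : connected U)
    (f_frontal : frontal g U f nu)
    (p_nondeg : nondegenerate_singular_point Om U f nu p)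
    (eps_gt0 : 0 < eps)
    (gamma_sing : singular_curve U f p eps gamma)
    (eta_null : null_vector_field f eps gamma eta) :
  @A_equivalent R N (euclid R 3) f p (@cuspidal_cross_cap R) 0 <->
  transverse (eta 0) (derive1 gamma 0) /\
  (psi Om f nu gamma eta 0 = 0 /\ derive1 (psi Om f nu gamma eta) 0 != 0).
Proof.
pose i := chart_at (f p); pose F := chart i \o f; pose n := nu^~ i.
have ip : mdom i (f p) by exact: mdom_chart_at.
have [_ g'0 g0 _ _] := gamma_sing.
have [sg _ _ _ _] := gamma_sing; have [se eta0 etaker] := eta_null.
have Up : U p by case: p_nondeg => -[].
have cf : {for p, continuous f} by exact: (frontal_continuous f_frontal).
pose U0 := chart_dom U f i.
have oU0 : open U0 by exact: (open_chart_dom open_U f_frontal).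
have sF : smooth_on U0 F by exact: (smooth_chart_f open_U f_frontal).
have sn : smooth_on U0 n by exact: (smooth_normal f_frontal).
have U0p : U0 p by [].
pose N0 := chart i @` mdom i.
have oN0 : open N0 by exact: open_chart_img.
have UN0 x : U0 x -> N0 (F x) by move=> [_ ix]; exists (f x).
have [d d0 gU0] : exists2 d : R, 0 < d & forall t : R, -d < t < d -> -eps < t < eps /\ U0 (gamma t).
  have I0 : (`]-eps, eps[ : set R) 0 by rewrite /= in_itv /= oppr_lt0 eps_gt0.
  have nU0 : nbhs (gamma 0) U0 by rewrite g0; exact: open_nbhs_nbhs.
  have cg : {for (0 : R^o), continuous (gamma : R^o -> _)} by exact: (smooth_continuous sg I0).
  have nI : nbhs (0 : R^o) (`]-eps, eps[ : set R^o).
    by apply: open_nbhs_nbhs; split=> //; exact: interval_open.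
  have nU : nbhs (0 : R^o) (gamma @^-1` U0) by exact: cg.
  have [d /= d0 dP] := (@nbhs_ballP _ R^o _ _).1 (filterI nI nU).
  exists d => // t; rewrite -ltr_norml => td.
  have [|It Ut] := dP t; first by rewrite /ball /= sub0r normrN.
  by split=> //; move: It; rewrite /= in_itv.
have dI : (`]-d, d[ : set R^o) `<=` `]-eps, eps[.
  by move=> t; rewrite /= !in_itv /= => /gU0[].
have sgd := smooth_subset dI sg; have sed := smooth_subset dI se.
have ker (t : R) : -d < t < d -> eta t *m df_mx f (gamma t) = 0.
  by move=> /gU0[te _]; apply/sub_kermxP; have /andP[] := etaker t te.
have DF0 (t : R) : -d < t < d -> 'D_(eta t) F (gamma t) = 0.
  move=> td; have [_ [Ut it]] := gU0 t td.
  exact: (null_pushforward open_U f_frontal Ut it (ker t td)).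
have gP (t : R) : -d < t < d -> [/\ U0 (gamma t), derive1 gamma t != 0, eta t != 0 & 'D_(eta t) F (gamma t) = 0].
  by move=> td; have [te Ut] := gU0 t td; split=> //; [exact: g'0|exact: eta0|exact: DF0].
have t0d : - d < 0 < d by rewrite oppr_lt0 d0.
pose dens : _ -> R^o := density Om i \o F.
have sdens : smooth_on U0 dens by exact: (smooth_comp oU0 (fin_basis_rV R 3) UN0 sF (@density_smooth _ _ _ _ Om i)).
have dens0 x : U0 x -> dens x != 0 by move=> [_ ix]; exact: density_neq0.
(* The area density is the unit dens times mu, and mu vanishes at p, so the two
   have proportional differentials there. *)
have nondeg : exists v, 'D_v (fun x => det3 ('D_(delta_mx 0 0) F x) ('D_(delta_mx 0 1) F x) (n x) : R^o) p != 0.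
  pose mu x : R^o := det3 ('D_(delta_mx 0 0) F x) ('D_(delta_mx 0 1) F x) (n x).
  rewrite -/mu.
  have smu : smooth_on U0 mu.
    by apply: (smooth_det3 oU0) => //; exact: smooth_derive.
  have dmu := smooth_diff smu U0p; have ddens := smooth_diff sdens U0p.
  have mup : mu p = 0.
    have := DF0 0 t0d; have [_ _ etan0 _] := gP 0 t0d.
    rewrite g0 derive2; last exact: smooth_diff sF U0p.
    move=> E; apply/eqP; apply: contraT => /det3_free.
    move=> /(_ (eta 0 0 0) (eta 0 0 1) 0); rewrite scale0r addr0 => /(_ E)[a b _].
    by move: etan0; rewrite (_ : eta 0 = 0) ?eqxx //; apply: row2P; rewrite ?a ?b mxE.
  have nE : \forall x \near p, area_density Om f nu x = (dens * mu) x.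
    apply: filterS (open_nbhs_nbhs (conj oU0 U0p)) => x U0x.
    exact: (area_density_chart Om open_U f_frontal U0x).
  have [_ [v dv]] := p_nondeg; exists v; apply: contra dv => /eqP Dmu.
  have dM : differentiable (dens * mu) p by exact: differentiableM.
  have nE' : \forall x \near p, (dens * mu) x = area_density Om f nu x.
    by apply: filterS nE => x ->.
  have dA := near_eq_differentiable nE' dM.
  rewrite -deriveE // (near_eq_derive v nE) deriveM; [|exact: diff_derivable..].
  by rewrite Dmu mup scale0r scaler0 addr0.
have psiE (t : R) : -d < t < d -> psi Om f nu gamma eta t =
    dens (gamma t) * det3 ('D_(derive1 gamma t) F (gamma t)) ('D_(eta t) n (gamma t)) (n (gamma t)).
  move=> td; have [_ [Ut it]] := gU0 t td.
  apply: (psi_chart Om open_U f_frontal Ut it _ (ker t td)).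
  by apply: (smooth_diff sgd); rewrite /= in_itv.
(* For every normal form c of the germ, psi is a unit times c along the axis. *)
have key (c : 'rV[R]_2 -> R^o) rho : 0 < rho -> smooth_on (box rho) c ->
    germ_equiv F p (cross_form c) 0 ->
    (forall a b : R, a *: eta 0 + b *: derive1 gamma 0 = 0 -> a = 0 /\ b = 0) /\
    (psi Om f nu gamma eta 0 = 0 /\ derive1 (psi Om f nu gamma eta) 0 != 0 <->
     c 0 = 0 /\ 'D_(delta_mx 0 0) c 0 != 0).
  move=> rho0 sc eqF.
  have [||free [sigma [E [[dE E0] s0 [ds s'0] nE]]]] := cusp_edge_invariant oU0 sF sn oN0
    (@gram_smooth _ _ _ g i) UN0 _ _ (fun x => @normal_unit _ _ _ _ _ _ f_frontal i x)
    (fun x v => @normal_orthogonal _ _ _ _ _ _ open_U f_frontal i x v) d0 sgd sed g0 gP rho0 sc eqF.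
  - by move=> _ [x ix <-]; exact: gram_sym.
  - by move=> _ [x ix <-] v; exact: gram_pos.
  split=> //.
  have dc : differentiable c 0 by apply: (smooth_diff sc); exact: box0.
  pose k t : R := c (mk2 (sigma t) 0).
  have [k0 dk k'0] : [/\ k 0 = c 0, derivable k 0 1 & derive1 k 0 = derive1 sigma 0 * 'D_(delta_mx 0 0) c 0].
    exact: axis_restriction dc s0 ds.
  have g00 : (`]-d, d[ : set R^o) 0 by rewrite /= in_itv.
  have dg : differentiable (dens \o (gamma : R^o -> _)) (0 : R^o).
    apply: (differentiable_comp (U := R^o)); first exact: (smooth_diff sgd g00).
    by rewrite g0; exact: smooth_diff sdens U0p.
  have dAd : derivable (dens \o (gamma : R^o -> _)) (0 : R^o) 1 by exact/derivable1_diffP.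
  have nP : \forall t \near (0 : R^o), psi Om f nu gamma eta t = ((dens \o gamma) * E) t * k t.
    have nd : nbhs (0 : R^o) (`]-d, d[ : set R^o).
      by apply: open_nbhs_nbhs; split=> //; exact: interval_open.
    apply: filterS2 nd nE => t td Et; rewrite psiE; last by move: td; rewrite /= in_itv.
    by rewrite Et mulrA.
  have A0 : ((dens \o gamma) * E) 0 != 0.
    by apply: mulf_neq0 => //; rewrite /= g0; exact: dens0.
  have dA : derivable ((dens \o gamma) * E) 0 1 by exact: (derivableM dAd dE).
  apply: (iff_trans (simple_zero_transfer nP dA A0 dk)); rewrite k0 k'0.
  by rewrite mulf_eq0 (negPf s'0).
split.
  move=> /(A_equivalent_germ cf ip); rewrite cuspidal_cross_cap_cross_form => eqF.
  have sx : smooth_on (box 1) (fun x : 'rV[R]_2 => x 0 0 : R^o) by apply: smooth_fst; exact: open_box.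
  have [free psiP] := key _ 1 ltr01 sx eqF.
  split; first exact/transverseP.
  by apply/psiP; rewrite derive_coord_id !mxE /= oner_neq0.
move=> [/transverseP free psiP].
have gP' (t : R) : -d < t < d -> U0 (gamma t) /\ 'D_(eta t) F (gamma t) = 0 by move=> /gP[].
have [F1 [K [r [nu0 [[r0 eq1] sF1 sK F1E det0]]]]] :=
  adapted_coordinates d0 sgd sed g0 oU0 sF sn gP' free nondeg.
have [rho rho0 [c sc eq2]] := normal_form r0 sF1 sK F1E det0.
have eqF := germ_equiv_trans eq1 eq2.
have [_ /iffLR /(_ psiP)[c0 c'0]] := key c rho rho0 sc eqF.
have eq3 := cross_form_cuspidal_cross_cap rho0 sc c0 c'0.
exact: (germ_A_equivalent ip (germ_equiv_trans eqF eq3)).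
Qed.
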